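(* Every $\{r_1,r_2,r_3\}$-internally 3-connected plane graph $G$ contains a spanning tree $T$ of maximum degree at most $4$ whose co-tree $\neg T^*$ also has maximum degree at most $4$.
   Context: All graphs are simple. For a plane graph $G$ and vertices $r_1,r_2,r_3$ on its outer face boundary in clockwise order, the suspension $G^\sigma$ adds at each $r_i$ a half-edge pointing into the outer face; $G$ is $\{r_1,r_2,r_3\}$-internally 3-connected if the graph obtained from $G^\sigma$ by making the three half-edges incident to a common new vertex in the outer face is 3-connected. $G^*$ denotes the plane dual of $G$ (possibly with multiple edges), and $e^*$ the dual edge of $e$. For a spanning tree $T$ of $G$, the co-tree $\neg T^*$ is the spanning subgraph of $G^*$ with edge set $(E(G)\setminus E(T))^*$; it is a spanning tree of $G^*$. *)

(* Defs.v *)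
(* Plane graphs are encoded combinatorially as genus-0
   combinatorial maps (rotation systems). *)
From mathcomp Require Import all_boot.
Set Implicit Arguments. Unset Strict Implicit. Unset Printing Implicit Defensive.

(* A plane map on vertex type V with darts (half-edges) D:
   - alpha : D -> D  the edge involution (d and alpha d are the two halves of one edge),
   - sigma : D -> D  the rotation (cyclic order of darts around each vertex),
   - vert  : D -> V  the tail vertex of a dart; vertices are exactly the sigma-orbits.
   Faces are the orbits of the face permutation phi = sigma \o alpha. *)
Definition face_perm (D : finType) (alpha sigma : D -> D) : D -> D :=
  fun d => sigma (alpha d).

Definition adj (V D : finType) (alpha : D -> D) (vert : D -> V) : rel V :=
  fun u v => [exists d, (vert d == u) && (vert (alpha d) == v)].

(* A (connected, simple) plane graph: a combinatorial map of genus 0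
   (Euler's formula 2|V| + 2|F| = |D| + 4, i.e. |V| - |E| + |F| = 2)
   whose underlying graph is simple. *)
Definition plane_graph (V D : finType) (alpha sigma : D -> D) (vert : D -> V) : Prop :=
  [/\ [/\ forall d, alpha (alpha d) = d, forall d, alpha d != d & injective sigma],
      (forall d d', (vert d == vert d') = fconnect sigma d d')
        /\ (forall v, exists d, vert d = v),
      (forall d d', connect (fun x y => (y == sigma x) || (y == alpha x)) d d'),
      (forall d, vert (alpha d) != vert d)
        /\ (forall d d', vert d = vert d' -> vert (alpha d) = vert (alpha d') -> d = d')
    & (#|V| + fcard (face_perm alpha sigma) D).*2 = #|D| + 4].

Definition on_face (V D : finType) (alpha sigma : D -> D) (vert : D -> V)
    (o : D) (x : V) : bool :=
  [exists d, (vert d == x) && fconnect (face_perm alpha sigma) o d].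

Definition three_connected (W : finType) (e : rel W) : Prop :=
  3 < #|W| /\
  forall S : {set W}, #|S| <= 2 ->
    forall x y, x \notin S -> y \notin S ->
      connect (fun a b => [&& e a b, a \notin S & b \notin S]) x y.

(* The graph obtained from the suspension by joining the three half-edges at
   r1, r2, r3 to a new vertex (None) in the outer face. *)
Definition susp_adj (V D : finType) (alpha : D -> D) (vert : D -> V)
    (r1 r2 r3 : V) : rel (option V) :=
  fun a b => match a, b with
  | Some u, Some v => adj alpha vert u v
  | None, Some v => (v == r1) || (v == r2) || (v == r3)
  | Some u, None => (u == r1) || (u == r2) || (u == r3)
  | None, None => false
  end.

Definition internally_3_connected (V D : finType) (alpha : D -> D) (vert : D -> V)
    (r1 r2 r3 : V) : Prop :=
  three_connected (susp_adj alpha vert r1 r2 r3).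

Definition edge_set (D : finType) (alpha : D -> D) (T : {set D}) : Prop :=
  forall d, (alpha d \in T) = (d \in T).

Definition sub_adj (V D : finType) (alpha : D -> D) (vert : D -> V) (T : {set D}) : rel V :=
  fun u v => [exists d in T, (vert d == u) && (vert (alpha d) == v)].

(* T is a spanning tree: spanning and connected, and acyclic
   (every edge of T is a bridge of T, i.e. lies on no cycle of T). *)
Definition spanning_tree (V D : finType) (alpha : D -> D) (vert : D -> V)
    (T : {set D}) : Prop :=
  [/\ edge_set alpha T,
      (forall u v, connect (sub_adj alpha vert T) u v)
    & (forall d, d \in T ->
         ~~ connect (sub_adj alpha vert (T :\ d :\ alpha d)) (vert d) (vert (alpha d)))].

Definition tree_deg (V D : finType) (vert : D -> V) (T : {set D}) (v : V) : nat :=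
  #|[set d in T | vert d == v]|.

(* Degree in the co-tree (the dual edges of E(G)\E(T)) of the dual vertex
   corresponding to the face containing dart f: the number of darts on that
   face whose edge is not in T (dual loops count twice, as usual). *)
Definition cotree_deg (D : finType) (alpha sigma : D -> D) (T : {set D}) (f : D) : nat :=
  #|[set d | fconnect (face_perm alpha sigma) f d & d \notin T]|.

(* Main.v *)
(* Join a new vertex z in the outer face to r1, r2 and r3: this gives a 3-connected plane map in which
   z has degree 3. A canonical ordering builds it up from z by groups, each of which is either a
   single vertex or a path along one face. The ordering induces a Schnyder-like labelling of the
   corners by 1, 2, 3, in which every label occupies one interval around each vertex other than z and
   around each face avoiding z; uniqueness of these intervals comes from counting label changes with
   Euler's formula. Every group is attached to the earlier ones by few tree edges, chosen among its two
   extreme edges by a rule that reads off the labels nearby, and five tree edges never meet at a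
   vertex. Labels and rules are self-dual: exchanging vertices with faces, the labels 1 and 2, and the
   tree with its complement preserves all properties used, so that the same bound controls the
   co-tree. The edge set obtained is connected and too small to contain a cycle. *)
Require Import Defs.
From mathcomp Require Import all_boot zify.
Set Implicit Arguments. Unset Strict Implicit. Unset Printing Implicit Defensive.

(** * Euler's formula for edge subsets *)

(** Planarity enters only through Euler's formula. Its form [cut_excess] (contract connected parts
    and count the cut darts on each face) takes the place of the Jordan curve theorem, and the
    formula itself makes the count of label changes tight.

    The constant 4 arises as follows. A tree dart is classified by the labels of the corners before
    and after it, and only 33, 32, 13, 22, 11 and 21 occur. Each class has at most one tree dart at
    a vertex. A dart of class 33 excludes 32 and 13, and the classes 32, 13, 22, 11 are never all
    occupied, so four darts remain.

    The obstacle is that the classes 22 and 11 consist of legs of later groups: keeping such a leg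
    must be decided by its own group but is felt at its lower end. In the worst case the decision
    depends on the mode of another group, which may be earlier or later, so that a separate rank is
    needed to define the modes.

    It gives the ordering its start and its last vertex, and the three faces around it, which merge
    into the outer face of the given graph, carry almost no co-tree edges. *)

Section Classes.
Variable T : finType.
Implicit Types (r : rel T) (x y a b : T).

Definition cclass r x := [set y | connect r x y].
Definition nclass r := #|[set cclass r x | x : T]|.

Lemma cclass_eq r x y : symmetric r -> (cclass r x == cclass r y) = connect r x y.
Proof.
move=> /sym_connect_sym rS; apply/eqP/idP => [/setP/(_ y)|cxy]; first by rewrite !inE connect0.
by apply/setP => z; rewrite !inE; apply: same_connect.
Qed.

Lemma nclass_connect r r' : connect r =2 connect r' -> nclass r = nclass r'.
Proof.
by move=> e; congr (#|pred_of_set _|); apply: eq_imset => x; apply/setP => y; rewrite !inE e.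
Qed.

(** A walk that avoids the new edge stays in its old class; one that uses it has both ends in the
    class of [a] or of [b]. *)
Lemma connect_add r r' a b x y :
    symmetric r ->
    (forall u v, r' u v -> [\/ r u v, u = a /\ v = b | u = b /\ v = a]) ->
  connect r' x y ->
  connect r x y \/ ((connect r a x \/ connect r b x) /\ (connect r a y \/ connect r b y)).
Proof.
move=> /sym_connect_sym rS rr' /connectP[p pth ->] {y}.
elim: p x pth => [|z p IH] x /=; first by left; rewrite connect0.
case/andP=> /rr' rxz /IH{IH}; set y := last z p => zy.
case: rxz => [rxz|[-> zb]|[-> za]].
- have xz := connect1 rxz; case: zy => [zy|[zab yab]]; first by left; apply: connect_trans zy.
  by right; split=> //; case: zab => zab; [left|right]; rewrite rS (connect_trans xz) // rS.
- subst z; right; split; first by left; rewrite connect0.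
  by case: zy => [->|[]]; [right|].
- subst z; right; split; first by right; rewrite connect0.
  by case: zy => [->|[]]; [left|].
Qed.

(** Away from the class of [a], distinct classes stay distinct, so at most one class is lost. *)
Lemma nclass_add r r' a b :
    symmetric r -> symmetric r' -> subrel r r' ->
    (forall u v, r' u v -> [\/ r u v, u = a /\ v = b | u = b /\ v = a]) ->
  nclass r <= (nclass r').+1.
Proof.
move=> rS rS' rsub rr'; rewrite /nclass (cardsD1 (cclass r a)).
set P := (_ :\ _); suff: #|P| <= #|[set cclass r' x | x : T]| by case: (_ \in _); lia.
pose h (A : {set T}) := [set y | [exists x in A, connect r' x y]].
have hE x : h (cclass r x) = cclass r' x.
  apply/setP => y; rewrite !inE; apply/existsP/idP => [[z]|xy].
    rewrite inE => /andP[xz]; apply: connect_trans; move: xz.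
    by apply: connect_sub => u v /rsub; apply: connect1.
  by exists x; rewrite inE connect0.
have injh : {in P &, injective h}.
  move=> A B; rewrite !in_setD1 => /andP[Aa /imsetP[x _ Ax]] /andP[Ba /imsetP[y _ By]].
  move: Aa Ba; rewrite {}Ax {}By !hE !cclass_eq // => xa ya /eqP.
  rewrite cclass_eq // => /(connect_add rS rr').
  have cS := sym_connect_sym rS.
  case=> [xy|]; first by apply/eqP; rewrite cclass_eq.
  rewrite !(cS a) (negbTE xa) (negbTE ya) => -[[//|bx] [//|by_]].
  by apply/eqP; rewrite cclass_eq // (connect_trans _ by_) // cS.
rewrite -(card_in_imset injh); apply: subset_leq_card.
apply/subsetP => _ /imsetP[A /setD1P[_ /imsetP[x _ ->]] ->].
by rewrite hE imset_f.
Qed.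

End Classes.

Section Euler.
Variables (D : finType) (al si : D -> D).
Hypotheses (alK : involutive al) (al_neq : forall d, al d != d) (si_inj : injective si).
Let ph := face_perm al si.

(** With [p := si] the classes are the components of the subgraph with edge set [A], and with
    [p := ph] those of the dual subgraph with the same edges. *)
Definition orel (p : D -> D) (A : {set D}) : rel D :=
  [rel x y | [|| p x == y, p y == x | (x \in A) && (al x == y)]].

Lemma orel_sym p A : edge_set al A -> symmetric (orel p A).
Proof.
move=> Acl x y; rewrite /orel /= orbCA; congr [|| _, _ | _].
apply/andP/andP => -[xA /eqP <-]; rewrite ?alK ?Acl //.
Qed.

Lemma orel_class_closed p A x d : injective p -> edge_set al A ->
  (p d \in cclass (orel p A) x) = (d \in cclass (orel p A) x).
Proof.
move=> pI Acl; rewrite !inE; apply/idP/idP => h; apply: connect_trans h _; apply: connect1;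
by rewrite /orel /= eqxx ?orbT.
Qed.

Lemma orel_class_edge p A x d :
  edge_set al A -> d \in A -> (al d \in cclass (orel p A) x) = (d \in cclass (orel p A) x).
Proof.
move=> Acl dA; rewrite !inE; apply/idP/idP => h; apply: connect_trans h _; apply: connect1;
by rewrite /orel /= ?alK eqxx ?Acl ?dA ?orbT.
Qed.

Lemma ph_inj : injective ph.
Proof. by move=> x y /si_inj /(inv_inj alK). Qed.

(** [ph] permutes the darts of [F], and [ph d] lies in [K] exactly when [al d] does; hence tails in
    [K] and heads in [K] are equally many. *)
Lemma face_in_out (F K : {set D}) :
    (forall d, (ph d \in F) = (d \in F)) -> (forall d, (si d \in K) = (d \in K)) ->
  #|[set d in F | (d \in K) && (al d \notin K)]| =
  #|[set d in F | (d \notin K) && (al d \in K)]|.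
Proof.
move=> Fcl Kcl.
have E : #|[set d in F | d \in K]| = #|[set d in F | al d \in K]|.
  rewrite -[RHS](card_imset _ ph_inj); apply: eq_card => d; apply/idP/imsetP => [|[e]].
    rewrite !inE => /andP[dF dK]; exists (finv ph d); rewrite ?(f_finv ph_inj) //.
    have e : ph (finv ph d) = d by apply: (f_finv ph_inj).
    by rewrite inE -Fcl -(Kcl (al _)) e dF; move: e; rewrite /ph /face_perm => ->.
  by rewrite !inE => /andP[eF eK] ->; rewrite Fcl eF Kcl.
move: E; rewrite -(cardsID [set d | al d \in K]) -[RHS](cardsID K).
set A := _ :&: _; set B := _ :\: _; set A' := _ :&: _; set B' := _ :\: _.
have <-: A = A' by apply/setP => d; rewrite !inE -!andbA [_ && (al _ \in _)]andbC.
have -> : B = [set d in F | (d \in K) && (al d \notin K)].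
  by apply/setP => d; rewrite !inE; do !case: (_ \in _).
have -> : B' = [set d in F | (d \notin K) && (al d \in K)].
  by apply/setP => d; rewrite !inE; do !case: (_ \in _).
lia.
Qed.

Lemma edge_setC (A : {set D}) : edge_set al A -> edge_set al (~: A).
Proof. by move=> Acl d; rewrite !inE Acl. Qed.

Lemma edge_setD2 (A : {set D}) e : edge_set al A -> edge_set al (A :\ e :\ al e).
Proof.
move=> Acl d; rewrite !inE Acl (inj_eq (inv_inj alK)) (inv_eq alK).
by rewrite andbCA.
Qed.

(* The edges leaving the component of one end of [e] form an even dual subgraph, in which [e]
   cannot be a bridge. *)
Lemma bridge_dual_connect (A : {set D}) e :
    edge_set al A -> e \in A ->
    ~~ connect (orel si (A :\ e :\ al e)) e (al e) ->
  connect (orel ph (~: A)) e (al e).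
Proof.
move=> Acl eA; set A' := _ :\ _; have A'cl : edge_set al A' by apply: edge_setD2.
have ACcl := edge_setC Acl.
pose K := cclass (orel si A') e; pose F := cclass (orel ph (~: A)) e.
have eK : e \in K by rewrite inE connect0.
have eF : e \in F by rewrite inE connect0.
move=> aeK; apply/idPn => aeF.
have {}aeK : al e \notin K by rewrite inE.
have {}aeF : al e \notin F by rewrite inE.
have := @face_in_out F K (fun d => orel_class_closed e d ph_inj ACcl)
  (fun d => orel_class_closed e d si_inj A'cl).
set Out := [set _ in _ | _]; set In := [set _ in _ | _].
have eOut : e \in Out by rewrite inE eF eK aeK.
have cross d : d \in F -> (d \in K) != (al d \in K) -> d != e -> (al d \in F).
  move=> dF dK de; rewrite orel_class_edge // inE; apply: contraNT dK; rewrite inE negbK => dA.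
  have dA' : d \in A' by rewrite !inE dA de !andbT; apply: contraNneq aeF => <-.
  by rewrite (orel_class_edge si e A'cl dA') inE.
(* Reversal matches the outgoing darts other than [e] with the ingoing ones, so [e] alone spoils the
   balance. *)
suff -> : #|Out| = #|In|.+1 by lia.
rewrite (cardsD1 e) eOut -(card_imset (mem In) (inv_inj alK)); congr _.+1.
apply: eq_card => d; apply/idP/imsetP => [|[c]].
  rewrite in_setD1 inE => /andP[de /and3P[dF dK adK]].
  by exists (al d); rewrite ?alK // inE alK (cross d) ?dK ?adK //= (negbTE adK).
rewrite inE => /and3P[cF cK acK] ->.
have ce : c != e by apply: contraNneq cK => ->.
have cae : c != al e by apply: contraNneq aeF => <-.
rewrite in_setD1 inE (inv_eq alK) alK acK cK cae (cross c) //.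
by rewrite (negbTE cK) acK.
Qed.

(** Moving [e] from [A] to the dual side changes at most one of the two counts: if [e] is a bridge
    of [A], its two faces are already joined in the dual. *)
Lemma euler_step (A : {set D}) e : edge_set al A -> e \in A ->
  nclass (orel si (A :\ e :\ al e)) + nclass (orel ph (~: A)) <=
  nclass (orel si A) + nclass (orel ph (~: (A :\ e :\ al e))) + 1.
Proof.
move=> Acl eA; have A'cl := edge_setD2 e Acl; have ACcl := edge_setC Acl.
have A'Ccl := edge_setC A'cl; set A' := A :\ e :\ al e in A'cl A'Ccl *.
have adds : nclass (orel si A') <= (nclass (orel si A)).+1.
  apply: (@nclass_add _ _ _ e (al e)); try exact: orel_sym.
    by move=> u v /=; rewrite /orel /= !inE => /or3P[->|->|/andP[/and3P[_ _ ->] ->]]; rewrite ?orbT.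
  move=> u v; rewrite /orel /= !inE => /or3P[h|h|/andP[uA /eqP <-]].
  - by apply: Or31; rewrite h.
  - by apply: Or31; rewrite h orbT.
  case: (u =P e) => [->|ue]; first by apply: Or32.
  case: (u =P al e) => [->|uae]; first by apply: Or33; rewrite alK.
  by apply: Or31; rewrite uA eqxx !orbT.
have addp : nclass (orel ph (~: A)) <= (nclass (orel ph (~: A'))).+1.
  apply: (@nclass_add _ _ _ e (al e)); try exact: orel_sym.
    move=> u v /=; rewrite /orel /= !inE => /or3P[->|->|/andP[/negbTE-> ->]]; rewrite ?orbT //.
    by rewrite !andbF /= !orbT.
  move=> u v; rewrite /orel /= !inE => /or3P[h|h|/andP[uA /eqP <-]].
  - by apply: Or31; rewrite h.
  - by apply: Or31; rewrite h orbT.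
  case: (u =P e) uA => [->|ue]; first by move=> _; apply: Or32.
  case: (u =P al e) => [->|uae]; first by move=> _; apply: Or33; rewrite alK.
  by move=> uA; apply: Or31; rewrite eqxx andbT; move: uA => /= ->; rewrite !orbT.
have [con|ncon] := boolP (connect (orel si A') e (al e)).
  have -> : nclass (orel si A') = nclass (orel si A); last by rewrite -addnA leq_add2l addn1.
  apply: nclass_connect => x y; apply/idP/idP; apply: connect_sub => u v.
    move=> h; apply: connect1; move: h; rewrite /orel /= !inE.
    by case/or3P=> [->|->|/andP[/and3P[_ _ ->] ->]]; rewrite ?orbT.
  rewrite {1}/orel /= => /or3P[h|h|/andP[uA /eqP <-]].
  - by apply: connect1; rewrite /orel /= h.
  - by apply: connect1; rewrite /orel /= h orbT.
  case: (u =P e) => [->|/eqP ue] //.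
  case: (u =P al e) => [->|/eqP uae]; first by rewrite alK (sym_connect_sym (orel_sym si A'cl)).
  by apply: connect1; rewrite /orel /= !inE uA ue uae eqxx !orbT.
suff -> : nclass (orel ph (~: A)) = nclass (orel ph (~: A')) by lia.
have dcon := bridge_dual_connect Acl eA ncon.
apply: nclass_connect => x y; apply/idP/idP; apply: connect_sub => u v.
  move=> h; apply: connect1; move: h; rewrite /orel /= !inE.
  by case/or3P=> [->|->|/andP[/negbTE-> ->]]; rewrite ?andbF /= ?orbT.
rewrite {1}/orel /= => /or3P[h|h|/andP[uA /eqP <-]].
- by apply: connect1; rewrite /orel /= h.
- by apply: connect1; rewrite /orel /= h orbT.
case: (u =P e) => [->|/eqP ue] //.
case: (u =P al e) => [->|/eqP uae]; first by rewrite alK (sym_connect_sym (orel_sym ph ACcl)).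
by apply: connect1; move: uA; rewrite /orel /= !inE ue uae /= => ->; rewrite eqxx !orbT.
Qed.

(** Induction from the empty set, where both sides agree. The bound holds for every map, so it also
    serves for the map with the apex before that map is known to be plane. *)
Lemma euler_subset (A : {set D}) : edge_set al A ->
  (nclass (orel ph (~: A)) + nclass (orel si set0)).*2 <=
  #|A| + (nclass (orel si A) + nclass (orel ph setT)).*2.
Proof.
have [n] := ubnP #|A|; elim: n A => // n IH A An Acl.
have [->|[e eA]] := set_0Vmem A; first by rewrite setC0 cards0; lia.
have aeA : al e \in A :\ e by rewrite !inE Acl eA al_neq.
have := euler_step Acl eA; have := IH _ _ (edge_setD2 e Acl).
move: An; rewrite (cardsD1 e A) eA (cardsD1 (al e)) aeA.
set A' := _ :\ al e => /=; lia.
Qed.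

End Euler.

Section ClassCount.
Variables (T K : finType) (r : rel T).
Hypothesis rS : symmetric r.

Lemma nclass_le (f : T -> K) :
  (forall x y, f x = f y -> connect r x y) -> nclass r <= #|K|.
Proof.
move=> fr; pose g k := if [pick x | f x == k] is Some x then cclass r x else set0.
apply: leq_trans (leq_imset_card g _); apply/subset_leq_card/subsetP => _ /imsetP[x _ ->].
apply/imsetP; exists (f x) => //; rewrite /g.
case: pickP => [y /eqP fy|/(_ x)]; last by rewrite eqxx.
by apply/eqP; rewrite cclass_eq // fr.
Qed.

Lemma nclass_ge (f : T -> K) : (forall k, exists x, f x = k) ->
  (forall x y, connect r x y -> f x = f y) -> #|K| <= nclass r.
Proof.
move=> fsurj fr; pose g k := [set y | f y == k].
have fex k : exists x, f x == k by have [x <-] := fsurj k; exists x.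
pose h k := cclass r (xchoose (fex k)).
have hI : injective h.
  move=> k k' /eqP; rewrite cclass_eq // => /fr.
  by rewrite (eqP (xchooseP (fex k))) (eqP (xchooseP (fex k'))).
rewrite -(card_imset _ hI); apply/subset_leq_card/subsetP => _ /imsetP[k _ ->].
exact: imset_f.
Qed.

Lemma nclass_ncomp (r' : rel T) :
  connect r =2 connect r' -> nclass r = n_comp r' predT.
Proof.
move=> rr'; have cS : connect_sym r' by move=> x y; rewrite -!rr' sym_connect_sym.
rewrite /nclass /n_comp_mem.
have -> : [set cclass r x | x : T] = [set cclass r x | x in roots r'].
  apply/setP => A; apply/imsetP/imsetP => -[x _ ->]; last by exists x.
  exists (fingraph.root r' x); first exact: roots_root.
  by apply/eqP; rewrite cclass_eq // rr' connect_root.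
rewrite card_in_imset; first by apply: eq_card => x; rewrite !inE andbT.
move=> x y /eqP xr /eqP yr /eqP; rewrite cclass_eq // rr' => /(rootP cS).
by rewrite xr yr.
Qed.

End ClassCount.

(** * Cuts of a plane map into connected parts *)

Section PlaneMap.
Variables (V D : finType) (al si : D -> D) (vert : D -> V).
Hypothesis pg : plane_graph al si vert.
Let ph := face_perm al si.

Lemma alK : involutive al. Proof. by case: pg => -[]. Qed.
Lemma al_neq d : al d != d. Proof. by move: d; case: pg => -[]. Qed.
Lemma si_inj : injective si. Proof. by case: pg => -[]. Qed.
Lemma al_inj : injective al. Proof. exact: inv_inj alK. Qed.
Lemma face_perm_inj : injective ph. Proof. exact: ph_inj alK si_inj. Qed.
Lemma vertE d d' : (vert d == vert d') = fconnect si d d'.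
Proof. by move: d d'; case: pg => _ []. Qed.
Lemma vert_surj v : exists d, vert d = v. Proof. by move: v; case: pg => _ []. Qed.
Lemma vert_al d : vert (al d) != vert d. Proof. by move: d; case: pg => _ _ _ []. Qed.
Lemma simple_map d d' : vert d = vert d' -> vert (al d) = vert (al d') -> d = d'.
Proof. by case: pg => _ _ _ [_ h] _; apply: h. Qed.

Lemma vert_si d : vert (si d) = vert d.
Proof. by apply/eqP; rewrite eq_sym vertE fconnect1. Qed.

Lemma vert_ph d : vert (ph d) = vert (al d).
Proof. exact: vert_si. Qed.

Definition face_of d := [set d' | fconnect ph d d'].
Local Notation face := face_of.

Lemma connect_orel0 p : injective p -> connect (orel al p set0) =2 fconnect p.
Proof.
move=> pI x y; have cS := fconnect_sym pI.
apply/idP/idP; apply: connect_sub => u v; rewrite /orel /= ?inE ?andFb ?orbF.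
  by case/orP => /eqP <-; [|rewrite cS]; apply: fconnect1.
by move=> uv; apply: connect1; rewrite /= uv.
Qed.

Lemma orel0_sym p : symmetric (orel al p set0).
Proof. by apply: (orel_sym alK) => d; rewrite !inE. Qed.

Lemma face_cclass d : face d = cclass (orel al ph set0) d.
Proof. by apply/setP => d'; rewrite !inE connect_orel0 //; apply: face_perm_inj. Qed.

Lemma face_eq d d' : (face d == face d') = fconnect ph d d'.
Proof. by rewrite !face_cclass cclass_eq ?connect_orel0 //; [apply: face_perm_inj | apply: orel0_sym]. Qed.

Lemma face_ph d : face (ph d) = face d.
Proof. by apply/esym/eqP; rewrite face_eq fconnect1. Qed.

Lemma mem_face d : d \in face d. Proof. by rewrite inE connect0. Qed.

Lemma in_face d d' : (d' \in face d) = (face d == face d').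
Proof. by rewrite inE face_eq. Qed.

Lemma ph_in_face d d' : (ph d' \in face d) = (d' \in face d).
Proof. by rewrite !in_face face_ph. Qed.

Lemma vertex_count : nclass (orel al si set0) = #|V|.
Proof.
have sc : forall x y, vert x = vert y <-> connect (orel al si set0) x y.
  by move=> x y; rewrite connect_orel0 -?vertE; [split=> /eqP | apply: si_inj].
apply/eqP; rewrite eqn_leq; apply/andP; split.
  by apply: (@nclass_le _ _ _ (orel0_sym si) vert) => x y /sc.
by apply: (@nclass_ge _ _ _ (orel0_sym si) vert); [apply: vert_surj | move=> x y /sc].
Qed.

Lemma face_count : nclass (orel al ph set0) = fcard ph D.
Proof. by apply: nclass_ncomp; [apply: orel0_sym | apply: connect_orel0 face_perm_inj]. Qed.

Lemma dual_connected : nclass (orel al ph setT) <= 1.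
Proof.
have setTcl : edge_set al setT by move=> d; rewrite !inE.
rewrite -card_unit; apply: (@nclass_le _ _ _ (orel_sym alK ph setTcl) (fun=> tt)) => x y _.
case: pg => _ _ /(_ x y) + _ _; apply: connect_sub => u v.
have e1 w : connect (orel al ph setT) w (al w) by apply: connect1; rewrite /orel /= !inE eqxx !orbT.
case/orP => /eqP ->; last exact: e1.
apply: connect_trans (e1 u) _; apply: connect1.
by rewrite /orel /= /ph /face_perm alK eqxx.
Qed.

Lemma connect_lift (A : {set D}) x y : edge_set al A ->
  connect (sub_adj al vert A) (vert x) (vert y) -> connect (orel al si A) x y.
Proof.
move=> Acl; have sc d d' : vert d = vert d' -> connect (orel al si A) d d'.
  move=> /eqP; rewrite vertE; apply: connect_sub => u v uv.
  by apply: connect1; rewrite /orel; move: uv => /= ->.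
case/connectP=> p; move xu: (vert x) => u.
elim: p u x xu => [|v p IH] u x xu /=; first by move=> _ yu; apply: sc; rewrite yu.
case/andP=> /exists_inP[d dA /andP[/eqP du /eqP dv]] pth e.
apply: connect_trans (IH v (al d) dv pth e).
apply: connect_trans (sc x d _) _; first by rewrite du.
by apply: connect1; rewrite /orel /= dA eqxx !orbT.
Qed.

Section Parts.
Variables (K : finType) (part : V -> K).
Hypothesis part_conn : forall u v, part u = part v ->
  connect (fun a b => adj al vert a b && (part a == part b)) u v.

Definition cut := [set d | part (vert d) != part (vert (al d))].

Lemma cut_al d : (al d \in cut) = (d \in cut).
Proof. by rewrite !inE alK eq_sym. Qed.

(** Euler's formula after contracting the parts. The complement of the cut has at most [#|K|]
    components, and in the dual of the cut each face off the cut is a class of its own, while the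
    faces on the cut give at least one more. *)
Lemma cut_faces c : c \in cut -> #|cut| + 4 <= (#|K| + #|face @: cut|).*2.
Proof.
move=> cC; have Ccl : edge_set al cut by exact: cut_al.
have Acl := edge_setC Ccl.
have cA : nclass (orel al si (~: cut)) <= #|K|.
  apply: (@nclass_le _ _ _ (orel_sym alK si Acl) (part \o vert)) => x y /part_conn xy.
  apply: connect_lift => //; apply: connect_sub xy => u v /= /andP[/existsP[d /andP[/eqP du /eqP dv]] uv].
  apply: connect1; apply/exists_inP; exists d; last by rewrite du dv !eqxx.
  by rewrite !inE du dv uv.
have FC : fcard ph D + 1 <= nclass (orel al ph cut) + #|face @: cut|.
  pose Fs := [set face d | d : D].
  have -> : fcard ph D = #|Fs|.
    rewrite -face_count /nclass; congr (#|pred_of_set _|).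
    by apply: eq_imset => d; rewrite face_cclass.
  have sub : face @: cut \subset Fs by apply/subsetP => _ /imsetP[d _ ->]; apply: imset_f.
  have -> : #|Fs| = #|Fs :\: face @: cut| + #|face @: cut|.
    by rewrite cardsDS // subnK ?subset_leq_card.
  rewrite addnAC leq_add2r.
  have sub2 : Fs :\: face @: cut \subset [set cclass (orel al ph cut) d | d : D] :\ cclass (orel al ph cut) c.
    apply/subsetP => _ /setDP[/imsetP[d _ ->] dC].
    have out x : x \in face d -> x \notin cut.
      rewrite in_face => /eqP dx; apply: contra dC => xC.
      by rewrite dx imset_f.
    have E : face d = cclass (orel al ph cut) d.
      apply/setP => y; rewrite face_cclass !inE; apply/idP/idP.
        apply: connect_sub => u v uv; apply: connect1; move: uv.
        by rewrite /orel /= !inE andFb orbF => /orP[->|->]; rewrite ?orbT.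
      case/connectP => p pth ->; move: (mem_face d) pth; move: {1 3 4 5}d => x.
      elim: p x => [|z p IH] x xd /=; first by rewrite connect0.
      rewrite {1}/orel /= (negbTE (out x xd)) orbF => /andP[xz].
      have xz' : connect (orel al ph set0) x z.
        by apply: connect1; rewrite /orel /= inE orbF.
      have zd : z \in face d.
        by move: xz xd => /orP[/eqP <-|/eqP <-]; rewrite ph_in_face.
      by move=> /(IH _ zd); apply: connect_trans.
    rewrite in_setD1 E imset_f // andbT; rewrite -E; apply: contraTneq cC => e.
    by apply: out; rewrite e inE connect0.
  have cin : cclass (orel al ph cut) c \in [set cclass (orel al ph cut) d | d : D] by apply: imset_f.
  by rewrite /nclass [X in _ <= X](cardsD1 (cclass (orel al ph cut) c)) cin addnC leq_add2l subset_leq_card.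
have := euler_subset alK al_neq si_inj Acl.
rewrite setCK vertex_count -/ph; have := dual_connected; have := cardsC cut.
case: pg => _ _ _ _; rewrite -/ph; set F := fcard _ _ in FC *; lia.
Qed.

Definition face_cut d := [set c in cut | face c == face d].

(** In [cut_faces] each face pays for two of its cut darts; only [2 * #|K| - 4] further ones are
    possible. [E] marks darts whose presence forces such a surplus: none for two parts, at most two
    for three. *)
Lemma cut_excess (E : {set D}) c : c \in cut ->
    (forall d, d \in E -> exists2 c, c \in cut & face c = face d) ->
    (forall d, d \in cut -> 2 + #|[set e in E | face e == face d]| <= #|face_cut d|) ->
  #|E| + 4 <= (#|K|).*2.
Proof.
move=> cC EC deg; have := cut_faces cC.
have -> : #|cut| = \sum_(F in face @: cut) #|[set d in cut | face d == F]|.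
  rewrite -sum1_card (partition_big_imset face); apply: eq_bigr => F _.
  by rewrite -sum1_card; apply: eq_bigl => d; rewrite inE.
have -> : #|E| = \sum_(F in face @: cut) #|[set d in E | face d == F]|.
  rewrite -sum1_card (partition_big face [in face @: cut]) /=.
    by apply: eq_bigr => F _; rewrite -sum1_card; apply: eq_bigl => d; rewrite inE.
  by move=> d /EC[c' c'C <-]; apply: imset_f.
have : \sum_(F in face @: cut) (2 + #|[set e in E | face e == F]|) <=
       \sum_(F in face @: cut) #|[set d in cut | face d == F]|.
  by apply: leq_sum => _ /imsetP[d dC ->]; apply: deg.
rewrite big_split /= sum_nat_const.
set a := \sum_(i in _) #|[set e in E | _]|; set b := \sum_(F in _) _.
by move: a b #|face @: cut| #|K| => a b c1 k; lia.
Qed.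

End Parts.
End PlaneMap.

(** * Connected vertex sets and faces *)

Section Connected.
Variables (V : finType) (e : rel V).
Hypothesis eS : symmetric e.
Implicit Types (S A M N W : {set V}).

Definition induced S : rel V := [rel a b | [&& e a b, a \in S & b \in S]].
Definition conn S := forall x y, x \in S -> y \in S -> connect (induced S) x y.
Definition component S x := [set y | connect (induced S) x y].

Lemma induced_sym S : symmetric (induced S).
Proof. by move=> x y; rewrite /induced /= eS; congr (_ && _); rewrite andbC. Qed.

Lemma induced_connect_sym S : connect_sym (induced S).
Proof. exact/sym_connect_sym/induced_sym. Qed.

Lemma connect_subset S W x y : S \subset W -> connect (induced S) x y -> connect (induced W) x y.
Proof.
move=> /subsetP SW; apply: connect_sub => u v /and3P[uv uS vS].
by apply: connect1; rewrite /induced /= uv !SW.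
Qed.

Lemma connect_closed S A x y :
    (forall a b, a \in A -> b \in S -> e a b -> b \in A) -> x \in A ->
  connect (induced S) x y -> y \in A.
Proof.
move=> Acl xA /connectP[p pth ->]; elim: p x xA pth => //= z p IH x xA.
by case/andP => /and3P[xz xS zS]; apply: IH; apply: Acl xz.
Qed.

Lemma conn_edge S A x y : conn S -> x \in S -> x \in A -> y \in S -> y \notin A ->
  exists a b, [/\ a \in S, a \in A, b \in S, b \notin A & e a b].
Proof.
move=> cS xS xA yS yA.
have [/existsP[a /existsP[b /and5P[? ? ? ? ?]]]|h] :=
  boolP [exists a, exists b, [&& a \in S, a \in A, b \in S, b \notin A & e a b]].
  by exists a, b.
suff : y \in A :&: S by rewrite inE (negbTE yA).
apply: (@connect_closed S _ x) (cS _ _ xS yS); last by rewrite inE xA.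
move=> a b /setIP[aA aS] bS ab; rewrite inE bS andbT.
by apply: contraNT h => bA; apply/existsP; exists a; apply/existsP; exists b; rewrite aS aA bS bA.
Qed.

Lemma conn1 x : conn [set x].
Proof. by move=> a b /set1P-> /set1P->; apply: connect0. Qed.

Lemma connU S W x y : conn S -> conn W -> x \in S -> y \in W -> (x == y) || e x y ->
  conn (S :|: W).
Proof.
move=> cS cW xS yW xy.
have toy z : z \in S :|: W -> connect (induced (S :|: W)) z y.
  case/setUP => [zS|zW]; last exact: connect_subset (subsetUr _ _) (cW _ _ zW yW).
  apply: connect_trans (connect_subset (subsetUl _ _) (cS _ _ zS xS)) _.
  case/orP: xy => [/eqP->|xy]; first exact: connect0.
  by apply: connect1; rewrite /induced /= xy !inE xS yW orbT.
by move=> u v /toy uy /toy vy; apply: connect_trans uy _; rewrite induced_connect_sym.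
Qed.

Lemma connU1 S x y : conn S -> y \in S -> e x y -> conn (x |: S).
Proof. by move=> cS yS xy; apply: connU (@conn1 x) cS (set11 x) yS _; rewrite xy orbT. Qed.

Lemma component_id S x : x \in component S x.
Proof. by rewrite inE connect0. Qed.

Lemma component_sub S x : x \in S -> component S x \subset S.
Proof. by move=> xS; apply/subsetP => z; rewrite inE => /connect_closed; apply. Qed.

Lemma component_closed S x a b : x \in S -> a \in component S x -> b \in S -> e a b -> b \in component S x.
Proof.
move=> xS aC bS ab; have aS := subsetP (component_sub xS) _ aC.
by move: aC; rewrite !inE => xa; apply: connect_trans xa _; apply: connect1; rewrite /induced /= ab aS.
Qed.

Lemma component_conn S x : x \in S -> conn (component S x).
Proof.
move=> xS; suff tox y : y \in component S x -> connect (induced (component S x)) x y.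
  by move=> u v /tox xu /tox; apply: connect_trans; rewrite induced_connect_sym.
rewrite {1}inE => /connectP[p pth ->]; move: (component_id S x) pth.
move: {1 3 5 6}x => u; elim: p u => [|z p IH] u uC /=; first by rewrite connect0.
case/andP=> /and3P[uz uS zS] pth; have zC := component_closed xS uC zS uz.
by apply: connect_trans (IH z zC pth); apply: connect1; rewrite /induced /= uz uC.
Qed.

(** Every other component of [W :\: M] touches [M], since [W] is connected, and keeps this contact
    when the component of [x] is removed. *)
Lemma component_compl W M x : conn W -> M \subset W -> conn M -> M != set0 -> x \in W :\: M ->
  conn (W :\: component (W :\: M) x).
Proof.
move=> cW MW cM /set0Pn[m mM] xWM; set K := component _ x.
have MK : M \subset W :\: K.
  apply/subsetP => a aM; rewrite inE (subsetP MW) // andbT; apply: contraL aM.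
  by move/(subsetP (component_sub xWM)); rewrite inE => /andP[].
suff tom y : y \in W :\: K -> connect (induced (W :\: K)) y m.
  by move=> u v /tom um /tom vm; apply: connect_trans um _; rewrite induced_connect_sym.
move=> yWK; have [yM|yM] := boolP (y \in M).
  exact: connect_subset MK (cM _ _ yM mM).
have yWM : y \in W :\: M by move: yWK; rewrite !inE yM => /andP[].
set K' := component (W :\: M) y.
have K'K : K' \subset W :\: K.
  apply/subsetP => a aK'; have := subsetP (component_sub yWM) _ aK'; rewrite !inE => /andP[aM aW].
  rewrite aW andbT; move: yWK; rewrite !inE => /andP[+ _]; apply: contra => xa.
  by apply: connect_trans xa _; rewrite induced_connect_sym; move: aK'; rewrite inE.
have yW : y \in W by case/setDP: yWM.
have mK' : m \notin K' by apply: contraL mM => /(subsetP (component_sub yWM)); rewrite inE => /andP[].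
have [a [b [aW aK' bW bK' ab]]] := conn_edge cW yW (component_id _ _) (subsetP MW _ mM) mK'.
have bM : b \in M.
  by apply: contraNT bK' => bM; apply: component_closed ab => //; rewrite inE bM.
apply: connect_trans (connect_subset K'K (component_conn yWM (component_id _ _) aK')) _.
apply: connect_trans (connect_subset MK (cM _ _ bM mM)).
by apply: connect1; rewrite /induced /= ab (subsetP K'K) ?(subsetP MK).
Qed.

End Connected.

(** * Substitutes for the Jordan curve theorem *)

Section Jordan.
Variables (V D : finType) (al si : D -> D) (vert : D -> V).
Hypothesis pg : plane_graph al si vert.
Local Notation ph := (face_perm al si).
Local Notation e := (adj al vert).
Local Notation face := (face_of al si).
Implicit Types (S A M N W : {set V}).

Lemma adj_sym : symmetric e.
Proof.
move=> u v; apply/existsP/existsP => -[d /andP[du dv]]; exists (al d);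
by rewrite (alK pg) du dv.
Qed.

Lemma adj_dart d : e (vert d) (vert (al d)).
Proof. by apply/existsP; exists d; rewrite !eqxx. Qed.

Lemma adjP u v : reflect (exists2 d, vert d = u & vert (al d) = v) (e u v).
Proof.
apply: (iffP existsP) => [[d /andP[/eqP <- /eqP <-]]|[d <- <-]]; first by exists d.
by exists d; rewrite !eqxx.
Qed.

Lemma conn_setT : conn e setT.
Proof.
move=> u v _ _; have [x <-] := vert_surj pg u; have [y <-] := vert_surj pg v.
case: (pg) => _ _ /(_ x y) + _ _ => /connectP[p pth ->]; elim: p x pth => //= z p IH x /andP[xz pth].
apply: connect_trans (IH z pth); case/orP: xz => /eqP ->; first by rewrite (vert_si pg).
by apply: connect1; rewrite /induced /= adj_dart !inE.
Qed.

Lemma face_out_in A d : vert d \in A -> vert (al d) \notin A ->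
  exists d', [/\ d' \in face d, vert d' \notin A & vert (al d') \in A].
Proof.
move=> dA adA; have Fcl : forall c, (ph c \in face d) = (c \in face d) := ph_in_face pg d.
have Kcl c : (si c \in [set c | vert c \in A]) = (c \in [set c | vert c \in A]).
  by rewrite !inE (vert_si pg).
have := face_in_out (alK pg) (si_inj pg) Fcl Kcl.
rewrite (cardsD1 d) in_set (mem_face al si d) !in_set dA adA => E.
have /card_gt0P[d'] : 0 < #|[set d0 in face d | (d0 \notin [set c | vert c \in A])
    && (al d0 \in [set c | vert c \in A])]| by rewrite -E.
by rewrite in_set !inE => /and3P[d'd d'A ad'A]; exists d'; rewrite inE.
Qed.

Lemma part_connP (K : finType) (part : V -> K) :
    (forall k, conn e [set v | part v == k]) ->
  forall u v, part u = part v -> connect (fun a b => e a b && (part a == part b)) u v.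
Proof.
move=> h u v uv; have := h (part v) u v; rewrite !inE uv eqxx => /(_ isT isT).
apply: connect_sub => a b /= /and3P[ab]; rewrite !inE => /eqP av /eqP bv.
by apply: connect1; rewrite ab av bv eqxx.
Qed.

Section Parts.
Variables (K : finType) (part : V -> K).
Let C := cut al vert part.

Lemma face_cut_ge2 d : d \in C -> 2 <= #|face_cut al si vert part d|.
Proof.
rewrite inE => dC; pose A := [set v | part v == part (vert d)].
have dA : vert d \in A by rewrite inE.
have adA : vert (al d) \notin A by rewrite inE eq_sym.
have [d' [d'd vd' avd']] := face_out_in dA adA.
have dd' : d' != d by apply: contraNneq vd' => ->.
have dF : d \in face_cut al si vert part d by rewrite !in_set dC eqxx.
have d'F : d' \in face_cut al si vert part d.
  rewrite in_set; move: d'd; rewrite (in_face pg) eq_sym => ->; rewrite andbT inE.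
  by move: vd' avd'; rewrite !inE => /negbTE vd' /eqP ->; rewrite vd'.
by rewrite (cardsD1 d) dF (cardsD1 d') in_setD1 dd' d'F.
Qed.

End Parts.

(* Both sides of a bond being connected, the bond is a simple cycle in the dual. *)
Lemma bond_face A d d' : conn e A -> conn e (~: A) -> face d = face d' ->
  vert d \in A -> vert (al d) \notin A -> vert d' \in A -> vert (al d') \notin A -> d = d'.
Proof.
move=> cA cCA dd' dA adA d'A ad'A; apply/eqP/idPn => ndd'.
pose part v := v \in A.
have part_c : forall k, conn e [set v | part v == k].
  case; [rewrite (_ : [set _ | _] = A) | rewrite (_ : [set _ | _] = ~: A)] => //;
  by apply/setP => v; rewrite !inE ?eqb_id ?eqbF_neg.
have dC : d \in cut al vert part by rewrite inE /part dA (negbTE adA).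
have d'C : d' \in cut al vert part by rewrite inE /part d'A (negbTE ad'A).
(* Two parts allow no surplus, but the common face of [d] and [d'] would have a third cut dart, the
   one coming back to [A]. *)
have := @cut_excess _ _ _ _ _ pg _ part (part_connP part_c) [set d] d dC.
rewrite cards1 card_bool => H; suff: 1 + 4 <= 4 by [].
apply: H => [c /set1P->|c cC]; first by exists d.
have [cd|cd] := eqVneq (face c) (face d); last first.
  rewrite [X in 2 + X](_ : _ = 0) ?addn0; first exact: face_cut_ge2.
  apply/eqP; rewrite cards_eq0; apply/eqP/setP => x; rewrite !inE.
  by apply/andP => -[/eqP->]; rewrite eq_sym; apply/negP.
rewrite [X in 2 + X](_ : _ = 1); last first.
  apply/eqP/cards1P; exists d; apply/setP => x; rewrite !inE.
  by case: eqP => // ->; rewrite cd eqxx.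
have [x [xd xA axA]] := face_out_in dA adA.
have xC : x \in cut al vert part by rewrite inE /part axA (negbTE xA).
have xnd : x != d by apply: contraNneq xA => ->.
have xnd' : x != d' by apply: contraNneq xA => ->.
have [dF d'F xF] : [/\ d \in face_cut al si vert part c, d' \in face_cut al si vert part c
    & x \in face_cut al si vert part c].
  move: xd; rewrite (in_face pg) => /eqP xd.
  by split; rewrite in_set; apply/andP; split; rewrite // -?xd -?dd' cd.
rewrite (cardsD1 d) dF (cardsD1 d') in_setD1 d'F eq_sym ndd' (cardsD1 x).
by rewrite !in_setD1 xF xnd' xnd.
Qed.

Lemma enters_between A d p q : p <= q -> vert (iter p ph d) \notin A -> vert (iter q ph d) \in A ->
  exists a, [/\ p <= a < q, vert (iter a ph d) \notin A & vert (al (iter a ph d)) \in A].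
Proof.
move=> + pA; elim: q => [|q IH] pq qA.
  by move: pq qA; rewrite leqn0 => /eqP p0; rewrite p0 in pA; rewrite (negbTE pA).
have pq' : p <= q by rewrite -ltnS ltn_neqAle pq andbT; apply: contraNneq pA => ->.
have [qA'|qA'] := boolP (vert (iter q ph d) \in A).
  by have [a [/andP[pa aq] ? ?]] := IH pq' qA'; exists a; rewrite pa ltnW.
by exists q; rewrite pq' ltnS leqnn; split=> //; rewrite -(vert_ph pg).
Qed.

Lemma iter_ph_inj d p q : p < order ph d -> q < order ph d -> iter p ph d = iter q ph d -> p = q.
Proof.
move=> pd qd pq; rewrite -(findex_iter pd) -(findex_iter qd); congr findex; exact: pq.
Qed.

Lemma face_iter p d : face (iter p ph d) = face d.
Proof. by elim: p => //= p <-; apply: face_ph pg _. Qed.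

(** Disjoint connected sets cannot alternate around a face: the component containing [N] after
    deleting [M] is one side of a bond, and the face would cross this bond twice in the same
    direction, against [bond_face]. The value [order ph d] for [p3] is the return to position 0. *)
Lemma face_crossing M N d p0 p1 p2 p3 : conn e M -> conn e N -> [disjoint M & N] ->
    p0 < p1 -> p1 < p2 -> p2 < p3 -> p3 <= order ph d ->
    vert (iter p0 ph d) \in N -> vert (iter p1 ph d) \in M ->
    vert (iter p2 ph d) \in N -> vert (iter p3 ph d) \in M -> False.
Proof.
move=> cM cN dMN p01 p12 p23 p3d v0 v1 v2 v3.
have eS := adj_sym.
have n0M : vert (iter p0 ph d) \in setT :\: M.
  by rewrite !inE andbT; move: dMN; rewrite disjoint_sym => /disjointFr ->.
pose K := component e (setT :\: M) (vert (iter p0 ph d)).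
have KN : N \subset K.
  apply/subsetP => y yN; rewrite inE; apply: connect_subset (cN _ _ v0 yN).
  by apply/subsetP => a aN; rewrite !inE andbT; move: dMN; rewrite disjoint_sym => /disjointFr ->.
have KM a : a \in M -> a \in ~: K.
  by move=> aM; rewrite inE; apply/negP => /(subsetP (component_sub e n0M)); rewrite !inE aM.
have cK : conn e K := component_conn eS n0M.
have cCK : conn e (~: K).
  rewrite -setTD; apply: component_compl => //; first exact: conn_setT.
  by apply/set0Pn; exists (vert (iter p1 ph d)).
have notCK a : a \in N -> a \notin ~: K by rewrite inE negbK => /(subsetP KN).
have [a [/andP[p0a ap1] aK aaK]] := enters_between (ltnW p01) (notCK _ v0) (KM _ v1).
have [b [/andP[p2b bp3] bK abK]] := enters_between (ltnW p23) (notCK _ v2) (KM _ v3).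
rewrite !in_setC ?negbK in aK aaK bK abK.
have : iter a ph d = iter b ph d.
  by apply: (@bond_face K) => //; rewrite !face_iter.
have bo : b < order ph d := leq_trans bp3 p3d.
have ab : a < b := leq_trans ap1 (leq_trans (ltnW p12) p2b).
by move/(iter_ph_inj (ltn_trans ab bo) bo) => abE; rewrite abE ltnn in ab.
Qed.

End Jordan.

(** * Faces and rotations under 3-connectivity *)

Section ThreeConnected.
Variables (V D : finType) (al si : D -> D) (vert : D -> V).
Hypothesis pg : plane_graph al si vert.
Local Notation ph := (face_perm al si).
Local Notation e := (adj al vert).
Local Notation face := (face_of al si).
Local Notation hd d := (vert (al d)).
Hypothesis tc : three_connected e.
Implicit Types (S A M N W K X U : {set V}).

Let phI : injective ph := face_perm_inj pg.

Lemma conn_delete2 a b : conn e (~: [set a; b]).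
Proof.
case: tc => _ h x y; rewrite !in_setC => xS yS.
have S2 : #|[set a; b]| <= 2 by rewrite cards2; case: (_ != _).
have := h _ S2 x y xS yS; apply: connect_sub => u v uv; apply: connect1; move: uv.
by rewrite /induced /= !in_setC.
Qed.

Lemma conn_delete1 a : conn e (~: [set a]).
Proof. by have := @conn_delete2 a a; rewrite setUid. Qed.

Lemma neighbour3 K a b x y : x \in K -> x \notin [set a; b] -> y \notin K -> y \notin [set a; b] ->
  exists u v, [/\ u \in K, u \notin [set a; b], v \notin K, v \notin [set a; b] & e u v].
Proof.
move=> xK xab yK yab.
have := @conn_edge _ e _ K x y (@conn_delete2 a b); rewrite !in_setC.
by move=> /(_ xab xK yab yK) [u [v []]]; rewrite !in_setC => *; exists u, v.
Qed.

Lemma third_neighbour x a b : a != x -> b != x -> exists v, [/\ e x v, v != a & v != b].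
Proof.
move=> ax bx; have [y yS] : exists y, y \notin [set x; a; b].
  apply/existsP; rewrite -negb_forall; apply/negP => /forallP h; case: tc => V4 _.
  have : #|V| <= #|[set x; a; b]| by rewrite -cardsT; apply/subset_leq_card/subsetP.
  by rewrite -!setUA cardsU1 cards2; move: V4; case: (_ \notin _); case: (_ != _) => /=; lia.
move: yS; rewrite !inE !negb_or -andbA => /and3P[yx ya yb].
have [|||| u [v [/set1P-> _ vx + xv]]] := @neighbour3 [set x] a b x y; rewrite !inE ?negb_or //.
- by rewrite eq_sym ax eq_sym.
- by rewrite ya.
by case/andP => va vb; exists v.
Qed.

(** Deleting one vertex leaves a connected graph, so the edges at a vertex form a bond, which a face
    leaves only once. *)
Lemma face_visit_inj d d' : face d = face d' -> vert d = vert d' -> d = d'.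
Proof.
move=> fd vd; apply: (bond_face pg (A := [set vert d])) => //; rewrite ?in_set1 ?vd //.
- exact: conn1.
- exact: conn_delete1.
- by rewrite -vd (vert_al pg).
- by rewrite (vert_al pg).
Qed.

Lemma face_leaves A d d' : face d' = face d -> vert d \in A -> vert d' \notin A ->
  exists o, [/\ face o = face d, vert o \in A & hd o \notin A].
Proof.
move=> /esym/eqP; rewrite (face_eq pg) => /iter_findex <- dA d'A.
have dA' : vert (iter 0 ph d) \notin ~: A by rewrite in_setC negbK.
rewrite -in_setC in d'A.
have [a [_ aA haA]] := enters_between pg (leq0n _) dA' d'A.
by exists (iter a ph d); rewrite (face_iter pg) -in_setC haA; move: aA; rewrite in_setC negbK.
Qed.

Lemma face_returns A d : vert d \in A -> hd d \notin A ->
  exists i, [/\ face i = face d, vert i \notin A & hd i \in A].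
Proof. by move=> dA adA; have [i [+ iA aiA]] := face_out_in pg dA adA; rewrite (in_face pg) => /eqP; exists i. Qed.

Lemma face_prev c : [/\ face (finv ph c) = face c, hd (finv ph c) = vert c & al (finv ph c) = finv si c].
Proof.
have E : ph (finv ph c) = c by apply: f_finv.
split; first by rewrite -{2}E (face_ph pg).
  by rewrite -(vert_ph pg) E.
by apply: (si_inj pg); rewrite (f_finv (si_inj pg)).
Qed.

(** A dart [c] stands for the corner before it in the rotation; [vert (finv ph c)] is the neighbour
    on the other side of that corner. *)
Definition turns x M := [set c | (vert c == x) && ((vert (finv ph c) \in M) != (hd c \in M))].

(** The parts are [[set x]], [M] and [N]. A face with a turn at [x] has two cut darts at [x] and a
    further one between [M] and [N], and three parts allow a surplus of two. So the neighbours in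
    [M] form an interval around [x]. *)
Lemma card_turns x M N : conn e M -> conn e N -> M :|: N = ~: [set x] -> [disjoint M & N] ->
  #|turns x M| <= 2.
Proof.
move=> cM cN MNx dMN.
have MNxE v : (v \in N) = (v != x) && (v \notin M).
  have := MNx => /setP/(_ v); rewrite !inE; have [vM|vM] := boolP (v \in M) => /=.
    by rewrite andbF (disjointFr dMN vM).
  by rewrite andbT => ->.
have xM : x \notin M by have := MNx => /setP/(_ x); rewrite !inE eqxx; case: (_ \in M).
pose part v := if v == x then None else Some (v \in M).
have part_c k : conn e [set v | part v == k].
  case: k => [[]|].
  - rewrite (_ : [set _ | _] = M) //; apply/setP => v; rewrite inE /part.
    by have [->|_] := eqVneq v x; rewrite ?(negbTE xM) //; case: (_ \in _).
  - rewrite (_ : [set _ | _] = N) //; apply/setP => v; rewrite inE /part MNxE.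
    by have [->|_] := eqVneq v x => //=; case: (_ \in _).
  - rewrite (_ : [set _ | _] = [set x]); first exact: conn1.
    by apply/setP => v; rewrite !inE /part; case: (v == x).
have cutP d : (d \in cut al vert part) = (part (vert d) != part (hd d)) by rewrite inE.
have turn_cut c : c \in turns x M -> c \in cut al vert part.
  rewrite inE cutP /part => /andP[/eqP <- _]; rewrite eqxx eq_sym.
  by rewrite (negbTE (vert_al pg c)).
have [->|[c0 c0E]] := set_0Vmem (turns x M); first by rewrite cards0.
have := @cut_excess _ _ _ _ _ pg _ part (part_connP part_c) (turns x M) c0 (turn_cut _ c0E).
rewrite card_option card_bool => H; suff: #|turns x M| + 4 <= 6.
  by rewrite (leq_add2r 4 _ 2).
apply: H => [c cE|c cC]; first by exists c => //; apply: turn_cut.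
have [->|[d]] := set_0Vmem [set c' in turns x M | face c' == face c].
  by rewrite cards0 addn0; apply: face_cut_ge2.
rewrite inE => /andP[dE /eqP dc].
rewrite (_ : [set _ in _ | _] = [set d]); last first.
  apply/setP => c'; rewrite [LHS]in_set [RHS]in_set1; apply/andP/eqP => [[c'E /eqP c'c]|->]; last by rewrite dE dc.
  apply: face_visit_inj; first by rewrite c'c.
  move: c'E dE; rewrite /turns !in_set. by move=> /andP[/eqP-> _] /andP[/eqP-> _].
rewrite cards1; have := turn_cut _ dE.
move: dE; rewrite /turns in_set => /andP[/eqP dx dM] dC.
have [pf hp _] := face_prev d; set p := finv ph d in pf hp dM.
have px : vert p != x by rewrite -dx -hp eq_sym (vert_al pg).
have pC : p \in cut al vert part by rewrite cutP /part (negbTE px) hp dx eqxx.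
have pd : p != d by apply: contraNneq px => ->; rewrite dx.
have mem_fc q : face q = face d -> q \in cut al vert part -> q \in face_cut al si vert part c.
  by move=> qd qC; rewrite in_set qC qd dc eqxx.
suff [q [qd qC qnd qnp]] : exists q, [/\ face q = face d, q \in cut al vert part, q != d & q != p].
  rewrite (cardsD1 d) mem_fc // (cardsD1 p) in_setD1 pd mem_fc // (cardsD1 q) !in_setD1.
  by rewrite qnp qnd mem_fc.
have Mcut q : (vert q \in M) != (hd q \in M) -> q \in cut al vert part.
  by move=> qM; rewrite cutP /part; apply: contraNneq qM; do 2!case: eqP => [->|_]; rewrite ?(negbTE xM) // => -[->].
have [pM|pM] := boolP (vert p \in M).
  have hpM : hd p \notin M by rewrite hp dx.
  have hdM : hd d \notin M by move: dM; rewrite pM; case: (_ \in _).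
  have [q [qp qM hqM]] := face_returns pM hpM; exists q; split; first by rewrite qp.
  - by apply: Mcut; rewrite hqM (negbTE qM).
  - by apply: contraTneq hqM => ->.
  - by apply: contraNneq qM => ->.
have hdM : hd d \in M by move: dM; rewrite (negbTE pM); case: (_ \in _).
have [||q [qp]] := @face_returns (~: M) d; rewrite ?in_setC ?dx ?negbK // => qM hqM.
exists q; split=> //.
- by apply: Mcut; rewrite qM (negbTE hqM).
- by apply: contraTneq qM => ->; rewrite dx.
- by apply: contraTneq qM => ->.
Qed.

(** The corners on both sides of [d] are already two turns; another dart with its head outside [M]
    would add a third. *)
Lemma turns_isolated x M N d d' : conn e M -> conn e N -> M :|: N = ~: [set x] ->
    [disjoint M & N] -> vert d = x -> vert d' = x ->
    hd d \notin M -> hd (si d) \in M -> hd (finv si d) \in M -> hd d' \notin M -> d' = d.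
Proof.
move=> cM cN MNx dMN dx d'x dM sdM fdM d'M; apply/eqP/idPn => nd'd.
have siI := si_inj pg.
have := card_turns cM cN MNx dMN; apply/negP; rewrite -ltnNge.
have turnE c : vert c = x -> (c \in turns x M) = ((hd (finv si c) \in M) != (hd c \in M)).
  move=> cx; rewrite inE cx eqxx; have [_ _ <-] := face_prev c.
  by rewrite (alK pg).
have : fconnect si d d' by rewrite -(vertE pg) dx d'x.
move/iter_findex; set j := findex si d d' => dj.
have jo : j < order si d by rewrite findex_max // -(vertE pg) dx d'x.
have vi i : vert (iter i si d) = x by elim: i => //= i; rewrite (vert_si pg).
have j1 : 1 < j.
  rewrite ltnNge; apply/negP; case: j dj {jo} => [|[|//]] /= dj _.
    by move: nd'd; rewrite dj eqxx.
  by move: d'M; rewrite -dj sdM.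
have [i [i1 ij iM iM']] : exists i, [/\ 1 <= i, i < j, hd (iter i si d) \in M & hd (iter i.+1 si d) \notin M].
  rewrite -dj in d'M; elim: j j1 d'M {dj jo} => // j IH j1 jM.
  have [hM|hM] := boolP (hd (iter j si d) \in M); first by exists j.
  have j1' : 1 < j by rewrite ltn_neqAle -ltnS j1 andbT; apply: contraNneq hM => <-.
  by have [i [? ? ? ?]] := IH j1' hM; exists i; split=> //; apply: leqW.
have iter_inj p q : p < order si d -> q < order si d -> iter p si d = iter q si d -> p = q.
  by move=> pd qd pq; rewrite -(findex_iter pd) -(findex_iter qd) pq.
have io : i.+1 < order si d by apply: leq_ltn_trans jo.
set c := iter i.+1 si d.
have cE : c \in turns x M.
  by rewrite turnE ?vi // (negbTE iM') /= (finv_f siI) iM.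
have dE : d \in turns x M by rewrite turnE // fdM (negbTE dM).
have sdE : si d \in turns x M by rewrite turnE ?(vert_si pg) // (finv_f siI) sdM (negbTE dM).
have o1 : 1 < order si d by rewrite (leq_ltn_trans _ io) // ltnS (leq_trans i1).
have cd : c != d by apply/eqP => /(iter_inj i.+1 0 io (ltnW o1)).
have csd : c != si d by apply/eqP => /(iter_inj i.+1 1 io o1) [i0]; rewrite i0 in i1.
have dsd : si d != d.
  by apply: contraNneq dM => <-.
by rewrite (cardsD1 d) dE (cardsD1 (si d)) in_setD1 dsd sdE (cardsD1 c) !in_setD1 cd csd cE.
Qed.

Lemma turn_in x M d d' : vert d = x -> vert d' = x -> hd d \in M -> hd d' \notin M ->
  exists c, [/\ vert c = x, vert (finv ph c) \notin M & hd c \in M].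
Proof.
move=> dx d'x dM d'M; have siI := si_inj pg.
have : fconnect si d' d by rewrite -(vertE pg) dx d'x.
move/iter_findex; set j := findex si d' d => d'd.
have vi i : vert (iter i si d') = x by elim: i => //= i; rewrite (vert_si pg).
move: dM; rewrite -d'd; elim: (j) => [|i IH] /= hM; first by rewrite hM in d'M.
have [/IH//|hM'] := boolP (hd (iter i si d') \in M).
exists (si (iter i si d')); rewrite (vert_si pg) vi hM; split=> //.
have [_ _ E] := face_prev (si (iter i si d')).
by rewrite -[finv ph _](alK pg) E (finv_f siI).
Qed.

Lemma turn_out x M d d' : vert d = x -> vert d' = x -> hd d \in M -> hd d' \notin M ->
  exists c, [/\ vert c = x, vert (finv ph c) \in M & hd c \notin M].
Proof.
move=> dx d'x dM d'M; have [||||c []] := @turn_in x (~: M) d' d; rewrite ?in_setC ?negbK //.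
move=> cx cM hcM; exists c; split=> //; by rewrite ?negbK in cM *.
Qed.

(* Contracting the connected sets [S], [X] and [U] leaves at most two faces meeting all three, so
   the edges between [S] and [X] at two different vertices of [S] cannot all border such faces. *)
Lemma two_part_face S X U a b : conn e S -> conn e X -> conn e U ->
    [disjoint S & X] -> [disjoint S & U] -> [disjoint X & U] -> S :|: X :|: U = setT ->
    vert a \in S -> hd a \in X -> vert b \in S -> hd b \in X -> vert a != vert b ->
  exists L R, [/\ vert L \in S, hd L \in X, vert R \in X, hd R \in S & hd R != vert L] /\
    face R = face L /\ (forall d, face d = face L -> vert d \notin U).
Proof.
move=> cS cX cU dSX dSU dXU SXU aS aX bS bX ab.
have notX v : v \in S -> v \notin X by move=> vS; rewrite (disjointFr dSX vS).
have notS v : v \in X -> v \notin S by move=> vX; rewrite (disjointFl dSX vX).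
have notXU v : v \in X -> v \notin U by move=> vX; rewrite (disjointFr dXU vX).
have notSU v : v \in S -> v \notin U by move=> vS; rewrite (disjointFr dSU vS).
have UE v : (v \in U) = (v \notin S) && (v \notin X).
  have := SXU => /setP/(_ v); rewrite !inE.
  have [vS|vS] := boolP (v \in S); first by rewrite (negbTE (notSU _ vS)).
  by have [vX|vX] /= := boolP (v \in X); [rewrite (negbTE (notXU _ vX)) | move=> ->].
have [/existsP[L /existsP[R /and5P[LS LX RX RS /and3P[RL /eqP fR /forallP h]]]]|nogood] :=
  boolP [exists L, exists R, [&& vert L \in S, hd L \in X, vert R \in X, hd R \in S
     & [&& hd R != vert L, face R == face L & [forall d, (face d == face L) ==> (vert d \notin U)]]]].
  by exists L, R; split=> //; split=> // d /eqP dL; have := h d; rewrite dL.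
have {nogood}good L R : vert L \in S -> hd L \in X -> vert R \in X -> hd R \in S ->
    hd R != vert L -> face R = face L -> exists2 d, face d = face L & vert d \in U.
  move=> LS LX RX RS RL fR; have [/existsP[d /andP[/eqP]]|h] :=
    boolP [exists d, (face d == face L) && (vert d \in U)]; first by exists d.
  case/negP: nogood; apply/existsP; exists L; apply/existsP; exists R.
  rewrite LS LX RX RS RL fR eqxx /=; apply/forallP => d; apply/implyP => dL.
  by apply: contra h => dU; apply/existsP; exists d; rewrite dL.
pose part v := if v \in S then None else Some (v \in X).
have part_c k : conn e [set v | part v == k].
  case: k => [[]|].
  - rewrite (_ : [set _ | _] = X) //; apply/setP => v; rewrite inE /part.
    by have [vS|vS] := boolP (v \in S); rewrite ?(negbTE (notX _ vS)) //; case: (_ \in _).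
  - rewrite (_ : [set _ | _] = U) //; apply/setP => v; rewrite inE /part UE.
    by case: (v \in S) => //=; case: (_ \in _).
  - rewrite (_ : [set _ | _] = S) //; apply/setP => v; rewrite inE /part.
    by case: (v \in S).
have cutP d : (d \in cut al vert part) = (part (vert d) != part (hd d)) by rewrite inE.
pose SX d := (vert d \in S) && (hd d \in X) || (vert d \in X) && (hd d \in S).
pose E := [set d | SX d && [exists d', (face d' == face d) && (vert d' \in U)]].
have Ecut d : d \in E -> d \in cut al vert part.
  rewrite cutP inE => /andP[+ _]; rewrite /SX /part => /orP[] /andP[h1 h2].
    by rewrite h1 (negbTE (notS _ h2)).
  by rewrite h2 (negbTE (notS _ h1)).
(* each end of an [S]-[X] edge in [S] contributes two incidences with three-part faces *)
have corner s d : vert d = s -> s \in S -> hd d \in X ->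
    exists c c', [/\ c \in E, c' \in E, vert c = s, vert c' \in X & hd c' = s].
  move=> ds sS dX.
  have [d' d's d'X] : exists2 d', vert d' = s & hd d' \notin X.
    have [s' s'S ss'] : exists2 s', s' \in S & s' != s.
      by have [sa|sa] := eqVneq (vert a) s; [exists (vert b) | exists (vert a)]; rewrite // -sa eq_sym.
    have [|u [v [uS /set1P us vS vs]]] := @conn_edge _ e S [set s] s s' cS sS (set11 s) s'S.
      by rewrite inE.
    by rewrite us => /adjP[f fs fv]; exists f; rewrite // fv notX.
  have [c [cs pX hcX]] := turn_in ds d's dX d'X.
  have [q [qs qX hqX]] := turn_out ds d's dX d'X.
  have [fq hq _] := face_prev q.
  have cE : SX c by rewrite /SX cs sS hcX.
  have qE : SX (finv ph q) by rewrite /SX qX hq qs sS orbT.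
  exists c, (finv ph q); split=> //; last by rewrite hq.
    rewrite inE cE /=.
    have [||R [fR RS hRS]] := @face_returns S c; rewrite ?cs ?sS ?(notS _ hcX) //.
    have [RU|RU] := boolP (vert R \in U); first by apply/existsP; exists R; rewrite fR eqxx.
    have RX : vert R \in X by move: RU; rewrite UE RS /= negbK.
    have Rs : hd R != vert c.
      apply: contraNneq pX => Rs.
      have E1 : ph R = c by apply: face_visit_inj; rewrite ?(face_ph pg) // (vert_ph pg).
      by rewrite -E1 (finv_f phI).
    have cS' : vert c \in S by rewrite cs.
    have [f fc fU] := good c R cS' hcX RX hRS Rs fR.
    by apply/existsP; exists f; rewrite fc eqxx.
  rewrite inE qE /=; set p := finv ph q in fq hq qE *.
  have [||L [fL LS hLS]] := @face_returns (~: S) p; rewrite ?in_setC ?negbK ?notS ?hq ?qs //.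
  rewrite !in_setC ?negbK in LS hLS.
  have [LU|LU] := boolP (hd L \in U).
    by apply/existsP; exists (ph L); rewrite (face_ph pg) fL eqxx (vert_ph pg).
  have LX : hd L \in X by move: LU; rewrite UE hLS /= negbK.
  have Ls : hd p != vert L.
    rewrite hq; apply: contraNneq hqX => qL.
    by rewrite (_ : q = L) //; apply: face_visit_inj; rewrite ?fL ?fq.
  have hpS : hd p \in S by rewrite hq qs.
  have [f fc fU] := good L p LS LX qX hpS Ls (esym fL).
  by apply/existsP; exists f; rewrite fc fL eqxx.
have [c1 [c1' [c1E c1'E c1a c1'X hc1']]] := corner _ a erefl aS aX.
have [c2 [c2' [c2E c2'E c2a c2'X hc2']]] := corner _ b erefl bS bX.
have E4 : 4 <= #|E|.
  have n1 : c1' != c1 by apply: contraTneq c1'X => ->; rewrite c1a notX.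
  have n2 : c2 != c1 by apply: contraNneq ab => h; rewrite -c1a -c2a h.
  have n3 : c2 != c1' by apply: contraTneq c1'X => <-; rewrite c2a notX.
  have n4 : c2' != c1 by apply: contraTneq c2'X => ->; rewrite c1a notX.
  have n5 : c2' != c1' by apply: contraNneq ab => h; rewrite -hc1' -hc2' h.
  have n6 : c2' != c2 by apply: contraTneq c2'X => ->; rewrite c2a notX.
  rewrite (cardsD1 c1) c1E (cardsD1 c1') in_setD1 n1 c1'E (cardsD1 c2) !in_setD1 n2 n3 c2E.
  by rewrite (cardsD1 c2') !in_setD1 n4 n5 n6 c2'E.
have := @cut_excess _ _ _ _ _ pg _ part (part_connP part_c) E c1 (Ecut _ c1E).
rewrite card_option card_bool => H; suff: #|E| + 4 <= 6.
  by rewrite (leq_add2r 4 _ 2) => /(leq_trans E4).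
apply: H => [c cE|c cC]; first by exists c => //; apply: Ecut.
have [->|[d dF]] := set_0Vmem [set c' in E | face c' == face c].
  by rewrite cards0 addn0; apply: face_cut_ge2.
have /andP[dE /eqP dc] : (d \in E) && (face d == face c) by move: dF; rewrite in_set.
have [d' fd' [d'U dSX']] : exists2 d', face d' = face d & vert d' \in U /\ SX d.
  by move: dE; rewrite inE => /andP[? /existsP[d' /andP[/eqP ? ?]]]; exists d'.
have dU : vert d \notin U by case/orP: dSX' => /andP[h _]; [apply: notSU | apply: notXU].
(* A face that meets all three parts has a dart leaving [U] and one entering it, in addition to its
   darts in [E]. *)
have [o [fo oU hoU]] := face_leaves (esym fd') d'U dU.
have [i [fi iU hiU]] := face_returns oU hoU.
have UC q : (vert q \in U) != (hd q \in U) -> q \in cut al vert part.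
  move=> qU; rewrite cutP; apply: contraNneq qU; rewrite /part !UE.
  by case: (vert q \in S); case: (hd q \in S) => //= -[->].
have UE' q : q \in E -> (vert q \notin U) && (hd q \notin U).
  rewrite inE => /andP[+ _]; rewrite /SX => /orP[] /andP[h1 h2].
    by rewrite notSU // notXU.
  by rewrite notXU // notSU.
set B := [set _ in _ | _].
have oB : o \notin B by rewrite in_set; apply/andP => -[/UE']; rewrite oU.
have iB : i \notin o |: B.
  rewrite in_setU1 negb_or; apply/andP; split; first by apply: contraNneq iU => ->.
  by rewrite in_set; apply/andP => -[/UE']; rewrite hiU andbF.
suff : i |: (o |: B) \subset face_cut al si vert part c.
  by move/subset_leq_card; rewrite cardsU1 iB cardsU1 oB.
apply/subsetP => q; rewrite !in_setU1 [in X in _ -> X]in_set => /or3P[/eqP->|/eqP->|].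
- by rewrite UC ?(negbTE iU) ?hiU // fi fo fd' dc eqxx.
- by rewrite UC ?(negbTE hoU) ?oU // fo fd' dc eqxx.
by rewrite in_set => /andP[/Ecut-> ->].
Qed.

End ThreeConnected.

(** * Canonical orderings *)

Ltac nlia :=
  repeat match goal with
  | H : ?T |- _ =>
    lazymatch type of T with
    | Prop =>
      lazymatch T with
      | is_true (leq _ _) => fail
      | is_true (andb (leq _ _) (leq _ _)) => fail
      | is_true (negb (@eq_op _ _ _)) => fail
      | @eq nat _ _ => fail
      | or (is_true (leq _ _)) (is_true (leq _ _)) => fail
      | _ => clear H
      end
    end
  end; lia.

Section Ordering.
Variables (V D : finType) (al si : D -> D) (vert : D -> V).
Hypothesis pg : plane_graph al si vert.
Local Notation ph := (face_perm al si).
Local Notation e := (adj al vert).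
Local Notation hd d := (vert (al d)).
Hypothesis tc : three_connected e.
Implicit Types (S A M N W K X Y U P Q : {set V}).

Let eS : symmetric e := adj_sym pg.

Lemma adj_neq u v : e u v -> u != v.
Proof. by case/adjP => d <- <-; rewrite eq_sym (vert_al pg). Qed.

Definition face_pos (L : D) i := vert (iter i ph L).
Definition face_seg L a b := [set v in [seq face_pos L k | k <- iota a (b.+1 - a)]].

Lemma fsegP L a b v : reflect (exists2 k, a <= k <= b & v = face_pos L k) (v \in face_seg L a b).
Proof.
rewrite inE; apply: (iffP mapP) => -[k kr ->]; exists k => //; move: kr; rewrite mem_iota; nlia.
Qed.

Lemma fpos_adj L i : e (face_pos L i) (face_pos L i.+1).
Proof. by rewrite /face_pos /= (vert_ph pg); apply: adj_dart. Qed.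

Lemma fpos_inj L i j : i < order ph L -> j < order ph L -> face_pos L i = face_pos L j -> i = j.
Proof.
move=> iL jL ij; apply: (iter_ph_inj iL jL); apply: (face_visit_inj pg tc) => //.
by rewrite !(face_iter pg).
Qed.

Lemma fseg_conn L a b : conn e (face_seg L a b).
Proof.
elim: b => [|b IH].
  move=> u v /fsegP[i i0 ->] /fsegP[j j0 ->].
  by have [-> ->] : i = 0 /\ j = 0 by lia. 
have [ab|ba] := leqP a b.
  rewrite (_ : face_seg _ _ _ = face_pos L b.+1 |: face_seg L a b).
    have bI : face_pos L b \in face_seg L a b by apply/fsegP; exists b => //; nlia.
    by apply: (connU1 eS IH bI); rewrite eS fpos_adj.
  apply/setP => v; rewrite in_setU1; apply/fsegP/orP => [[k kr ->]|[/eqP->|/fsegP[k kr ->]]].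
  - have [->|kb] := eqVneq k b.+1; first by left.
    by right; apply/fsegP; exists k => //; nlia.
  - by exists b.+1 => //; nlia.
  - by exists k => //; nlia.
move=> u v /fsegP[i i0 ->] /fsegP[j j0 ->].
by have -> : i = j by nlia.
Qed.

(** Otherwise [u1] and [u2] would separate [K] from [w]. The sets [C] and [u1 |: (u2 |: K)] come out
    connected and disjoint, ready for [face_crossing]. *)
Lemma third_attachment K u1 u2 w : conn e K -> K != set0 -> w \notin K -> w \notin [set u1; u2] ->
    u1 \notin K -> u2 \notin K ->
    (exists2 k, k \in K & e u1 k) -> (exists2 k, k \in K & e u2 k) ->
  exists c C, [/\ c \notin K :|: [set u1; u2], exists2 k, k \in K & e c k,
    conn e C, c \in C & w \in C] /\ [disjoint C & u1 |: (u2 |: K)] /\ conn e (u1 |: (u2 |: K)).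
Proof.
move=> cK /set0Pn[k0 k0K] wK wu u1K u2K [k1 k1K u1k] [k2 k2K u2k].
have k0u : k0 \notin [set u1; u2].
  by rewrite !inE negb_or; apply/andP; split; [apply: contraNneq u1K | apply: contraNneq u2K] => <-.
pose W0 := ~: [set u1; u2]; have wW : w \in W0 :\: K by rewrite inE wK inE.
pose C := component e (W0 :\: K) w.
have CW : C \subset W0 :\: K by apply: component_sub.
have kC : k0 \notin C by apply/negP => /(subsetP CW); rewrite inE k0K.
have k0W : k0 \in W0 by rewrite inE.
have wW0 : w \in W0 by rewrite inE.
have [u [v [uW uC vW vC uv]]] := conn_edge (@conn_delete2 _ _ _ _ tc u1 u2) wW0 (component_id e _ _) k0W kC.
have vK : v \in K.
  by apply: contraNT vC => vK; apply: (component_closed wW uC) uv; rewrite inE vK.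
exists u, C; split; [split | split].
- by rewrite inE negb_or; have := subsetP CW _ uC; rewrite inE => /andP[-> ]; rewrite inE.
- by exists v.
- exact: component_conn.
- exact: uC.
- exact: component_id.
- rewrite disjoint_sym; apply/pred0P => x /=; apply/negP => /andP[xu /(subsetP CW)].
  by move: xu; rewrite /W0 !inE => /or3P[] -> /=; rewrite ?orbT ?andbF.
- apply: (connU1 eS) u1k; last by rewrite inE k1K orbT.
  exact: (connU1 eS) u2k.
Qed.

Section Chain.
Variables (S : {set V}) (L : D) (m : nat).
Hypotheses (LS : vert L \in S) (mL : m < order ph L).
Let U := ~: S.
Let x i := face_pos L i.
Let P := face_seg L 1 m.
Hypotheses (cU : conn e U) (m0 : 0 < m).
Hypothesis xU : forall i, 0 < i <= m -> x i \notin S.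

Let inP i : 0 < i <= m -> x i \in P. Proof. by move=> im; apply/fsegP; exists i. Qed.

Lemma chain_attach K : K \subset U :\: P -> K != set0 ->
    (forall a b, a \in K -> b \in U :\: P -> e a b -> b \in K) ->
  exists a b, [/\ 0 < a, a <= b, b <= m, exists2 k, k \in K & e (x a) k
     & (exists2 k, k \in K & e (x b) k)] /\
    forall c, 0 < c <= m -> (exists2 k, k \in K & e (x c) k) -> a <= c <= b.
Proof.
move=> KU /set0Pn[k kK] Kcl.
pose att c := (0 < c <= m) && [exists k in K, e (x c) k].
have attP c : reflect (0 < c <= m /\ exists2 k, k \in K & e (x c) k) (att c).
  by apply: (iffP andP) => -[? /exists_inP].
have KUs v : v \in K -> v \in U by move=> /(subsetP KU)/setDP[].
have exatt : exists c, att c.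
  have x1U : x 1 \in U by rewrite inE xU // m0.
  have x1K : x 1 \notin K by apply/negP => /(subsetP KU)/setDP[_]; rewrite inP // m0.
  have [u [v [uU uK vU vK uv]]] := conn_edge cU (KUs _ kK) kK x1U x1K.
  have : v \in P by apply: contraNT vK => vP; apply: Kcl uv; rewrite // inE vP.
  case/fsegP => c cm vE; exists c; apply/attP; split=> //.
  by exists u; rewrite // eS /x -vE.
have attm c : att c -> c <= m by case/attP => /andP[].
have [a aatt amin] := ex_minnP exatt; have [b batt bmax] := ex_maxnP exatt attm.
exists a, b; split; last by move=> c cm ck; rewrite amin ?bmax //; apply/attP.
move/attP: aatt => [/andP[a0 am] ak]; move/attP: (batt) => [/andP[b0 bm] bk].
by split=> //; apply: amin.
Qed.

(** If [K] saw only the chain, a third attachment would lie strictly between the extreme ones [a]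
    and [b] and reach [vert L] off [K]; this set and [K] with [x a], [x b] would alternate around
    the face. *)
Lemma chain_no_pocket K : K \subset U :\: P -> K != set0 -> conn e K ->
    (forall a b, a \in K -> b \in U :\: P -> e a b -> b \in K) ->
  exists2 s, s \in S & exists2 k, k \in K & e s k.
Proof.
move=> KU K0 cK Kcl.
have [/existsP[s /andP[sS /exists_inP ks]]|noS] := boolP [exists s, (s \in S) && [exists k in K, e s k]].
  by exists s.
have [a [b [[a0 ab bm ak bk] ext]]] := chain_attach KU K0 Kcl.
have KUs v : v \in K -> (v \notin P) && (v \notin S).
  by move=> /(subsetP KU); rewrite !inE.
have sK : vert L \notin K by apply/negP => /KUs; rewrite LS andbF.
have xK i : 0 < i <= m -> x i \notin K by move=> im; apply/negP => /KUs; rewrite inP.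
have xs i : 0 < i <= m -> vert L != x i.
  by move=> im; apply: contraTneq LS => ->; apply: xU.
have am : 0 < a <= m by nlia.
have bm' : 0 < b <= m by nlia.
have sx : vert L \notin [set x a; x b] by rewrite !inE negb_or !xs.
have [c [C [[cK' [k kK ck] cC cinC sC] [dC cM]]]] :=
  third_attachment cK K0 sK sx (xK _ am) (xK _ bm') ak bk.
have cP : c \in P.
  apply: contraNT noS => cP; apply/existsP; exists c.
  have cS : c \in S.
    apply: contraNT cK' => cS; rewrite inE; apply/orP; left.
    by apply: (Kcl k) => //; [rewrite in_setD cP in_setC cS | rewrite eS].
  by rewrite cS; apply/exists_inP; exists k.
case/fsegP: cP => i im cE.
have := ext i im; rewrite -/(x i) in cE; rewrite -cE => /(_ (ex_intro2 _ _ k kK ck)) iab.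
have [ia ib] : i != a /\ i != b.
  by split; apply: contraNneq cK' => h; rewrite cE h !inE eqxx ?orbT.
case: (@face_crossing _ _ _ _ _ pg (x a |: (x b |: K)) C L 0 a i b); rewrite // -?/(face_pos L _) -?/(x _) ?inE ?eqxx ?orbT //.
- by rewrite disjoint_sym.
- nlia.
- nlia.
- nlia.
- by rewrite -cE.
Qed.

(** The two ends of a chord and the rest of the graph, which is connected by 3-connectivity, would
    alternate around the face. *)
Lemma chain_no_chord p q : 0 < p -> p.+1 < q -> q <= m -> ~~ e (x p) (x q).
Proof.
move=> p0 pq qm; apply/negP => xpq.
have xneq i j : i <= m -> j <= m -> i != j -> x i != x j.
  by move=> im jm; apply: contraNneq => ij; apply/eqP/(fpos_inj _ _ ij); apply: leq_ltn_trans mL.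
have cM : conn e (x p |: [set x q]) by apply: (connU1 eS (@conn1 _ _ _)) xpq; rewrite inE.
have [h0 h1] : vert L \in ~: (x p |: [set x q]) /\ x p.+1 \in ~: (x p |: [set x q]).
  by split; rewrite !inE negb_or -?[vert L]/(x 0) !xneq //; nlia.
case: (@face_crossing _ _ _ _ _ pg (x p |: [set x q]) (~: (x p |: [set x q])) L 0 p p.+1 q) => //.
- exact: conn_delete2.
- by rewrite -setI_eq0 setICr.
- exact: leq_trans (ltnW mL).
- by rewrite !inE eqxx.
- by rewrite !inE eqxx orbT.
Qed.

Lemma chain_edge i d : 0 < i <= m -> vert d = x i -> hd d \in P ->
  d = iter i ph L \/ d = al (iter i.-1 ph L).
Proof.
move=> /andP[i0 im] dx /fsegP[j /andP[j0 jm] hdx].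
have xe : e (x i) (x j) by rewrite -dx /x -hdx; apply: adj_dart.
have hiter k : hd (iter k ph L) = x k.+1 by rewrite /x /face_pos /= (vert_ph pg).
have [iltj|jlti|ij] := ltngtP i j.
- have [ji|ji] := eqVneq j i.+1.
    by left; apply: (simple_map pg); rewrite // hiter -ji.
  by have := @chain_no_chord i j i0; rewrite xe ltn_neqAle eq_sym ji iltj => /(_ isT jm).
- have [ji|ji] := eqVneq i j.+1.
    by right; move: dx; rewrite ji => dx; apply: (simple_map pg); rewrite ?(alK pg) /= ?hiter.
  by have := @chain_no_chord j i j0; rewrite eS xe ltn_neqAle eq_sym ji jlti => /(_ isT im).
by move: xe; rewrite ij => /adj_neq; rewrite eqxx.
Qed.

(** The degree is at least three, and at most two edges go to [S] or along the chain. *)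
Lemma chain_up i : 0 < i <= m ->
    (forall d, vert d = x i -> hd d \in S -> d = iter i ph L \/ d = al (iter i.-1 ph L)) ->
  exists2 w, w \notin S :|: P & e (x i) w.
Proof.
move=> im h; have [i0 _] := andP im.
have e1 : e (x i.-1) (x i) by rewrite -{2}(prednK i0); apply: fpos_adj.
have e2 : e (x i) (x i.+1) by apply: fpos_adj.
have n2 : x i.+1 != x i by rewrite eq_sym; apply: adj_neq.
have [w [xw w1 w2]] := third_neighbour tc (adj_neq e1) n2.
exists w => //; case/adjP: xw => d dx dw; rewrite -dw in w1 w2 *.
have nd : d <> iter i ph L /\ d <> al (iter i.-1 ph L).
  split=> dE; first by move: w2; rewrite dE -(vert_ph pg) eqxx.
  by move: w1; rewrite dE (alK pg) eqxx.
rewrite in_setU negb_or; apply/andP; split; apply/negP.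
  by move/(h d dx); case: nd => ? ? [].
by move/(chain_edge im dx); case: nd => ? ? [].
Qed.

End Chain.

(** The chain closes the face of [L], which enters it from [S] and returns to [S] after
    [iter m ph L]. The last clause makes the path induced and leaves only its two ends attached to
    [S]. *)
Definition chain_group S P L m :=
  [/\ [/\ 1 < m, m < order ph L, vert L \in S, face_pos L m.+1 \in S & P = face_seg L 1 m],
      forall i, 0 < i <= m -> face_pos L i \notin S
    & forall i d, 0 < i <= m -> vert d = face_pos L i -> hd d \in S :|: P ->
        d = iter i ph L \/ d = al (iter i.-1 ph L)].

Definition single_group S P x :=
  [/\ P = [set x], x \notin S & exists a b, [/\ a \in S, b \in S, a != b, e x a & e x b]].

Definition has_up S P v := exists2 w, w \notin S :|: P & e v w.

(** * Existence of the next group *)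

Section Step.
Variables (S : {set V}) (z t : V).
Let U := ~: S.
Hypotheses (cS : conn e S) (cU : conn e U) (zS : z \in S) (tU : t \in U) (zt : e z t).
Hypothesis S2 : 1 < #|S|.

Definition below X := [set s in S | [exists x in X, e s x]].

Lemma belowP X s : reflect (s \in S /\ exists2 x, x \in X & e s x) (s \in below X).
Proof. by rewrite inE; apply: (iffP andP) => -[? /exists_inP]. Qed.

(** With a single earlier neighbour [s], the vertices [x] and [s] would separate the component from
    the rest of [S]. *)
Lemma below_component x y : x \in U -> y \in U :\ x -> 1 < #|below (component e (U :\ x) y)|.
Proof.
move=> xU yUx; set K := component _ _ _; rewrite ltnNge; apply/negP => K1.
have KU : K \subset U :\ x by apply: component_sub.
have [s sS bs] : exists2 s, s \in S & forall s', s' \in below K -> s' = s.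
  have [b0|[s sb]] := set_0Vmem (below K).
    by exists z => // s'; rewrite b0 inE.
  exists s => [|s' s'b]; first by case/belowP: sb.
  by apply/eqP; move/card_le1P: K1 => /(_ s sb s'); rewrite s'b => /esym; rewrite inE.
have [w wS ws] : exists2 w, w \in S & w != s.
  have : 0 < #|S :\ s| by move: S2; rewrite (cardsD1 s) sS.
  by case/card_gt0P => w /setD1P[ws wS]; exists w.
have yx : y != x by case/setD1P: yUx.
have yK : y \in K by apply: component_id.
have yU : y \in U by case/setD1P: yUx.
have wK : w \notin K by apply/negP => /(subsetP KU)/setD1P[_]; rewrite inE wS.
have wx : w != x by apply: contraTneq wS => ->; move: xU; rewrite inE.
have ys : y != s by apply: contraTneq sS => <-; move: yU; rewrite inE.
have [||u [v [uK _ vK]]] := @neighbour3 _ _ _ _ tc K x s y w yK _ wK.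
- by rewrite !inE negb_or yx ys.
- by rewrite !inE negb_or wx ws.
rewrite !inE negb_or => /andP[vx vs] uv.
have [vS|vS] := boolP (v \in S).
  by case/eqP: vs; apply: bs; apply/belowP; split=> //; exists u => //; rewrite eS.
case/negP: vK; apply: (component_closed yUx uK) uv.
by rewrite in_setD1 vx inE.
Qed.

Lemma below_subset X Y : X \subset Y -> #|below X| <= #|below Y|.
Proof.
move=> /subsetP XY; apply/subset_leq_card/subsetP => s /belowP[sS [x xX sx]].
by apply/belowP; split=> //; exists x; rewrite // XY.
Qed.

(** A piece of the unplaced part whose removal keeps the rest connected around [t]; the next group
    is found inside a candidate that cannot be made smaller. *)
Definition candidate X :=
  [/\ X \subset U, t \notin X, X != set0, conn e X & conn e (U :\: X) /\ 1 < #|below X|].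

(** Removing [Q] may cut further pieces off from [t]; adding these to [Q] gives the new candidate,
    and [x] witnesses that it is still smaller than [X]. *)
Lemma candidate_shrink X Q x : candidate X -> Q \subset X -> Q != set0 -> conn e Q ->
    1 < #|below Q| -> x \in X -> x \in component e (U :\: Q) t ->
  exists X', candidate X' /\ #|X'| < #|X|.
Proof.
move=> [XU tX X0 cX [cUX bX]] QX Q0 cQ bQ xX xG.
have tQ : t \in U :\: Q by rewrite in_setD tU andbT; apply: contra tX; apply: (subsetP QX).
set G := component _ _ _ in xG; have GU : G \subset U :\: Q by apply: component_sub.
have QU : Q \subset U := subset_trans QX XU.
have QX' : Q \subset U :\: G.
  apply/subsetP => v vQ; rewrite in_setD (subsetP QU) // andbT.
  by apply/negP => /(subsetP GU); rewrite in_setD vQ.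
have UG : U :\: (U :\: G) = G.
  apply/setP => v; rewrite !in_setD; have [vG|_] := boolP (v \in G); last by rewrite andbC /=; case: (v \in U).
  by have /setDP[-> _] := subsetP GU _ vG.
exists (U :\: G); split; first split.
- exact: subsetDl.
- by rewrite in_setD component_id.
- by apply: contraNneq Q0 => X'0; rewrite -subset0 -X'0.
- exact: component_compl.
- split; first by rewrite UG; apply: component_conn.
  exact: leq_trans bQ (below_subset QX').
apply: proper_card; apply/properP; split; last by exists x; rewrite // in_setD xG.
apply/subsetP => v /setDP[vU]; apply: contraNT => vX.
rewrite inE; apply: connect_subset (cUX t v _ _); rewrite ?in_setD ?tX ?tU ?vX //.
exact: setDS.
Qed.

(** Descent on candidates. When no reduction applies, either a vertex of [X] has two earlier
    neighbours, or every vertex has at most one and [two_part_face] supplies a face along which a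
    chain runs from [S] through [X] back to [S]. *)
Lemma next_group_from X : candidate X ->
  exists P, [/\ P \subset U, t \notin P, P != set0, conn e (~: (S :|: P)) & forall v, v \in P -> has_up S P v]
    /\ ((exists x, single_group S P x) \/
        (exists L m, chain_group S P L m /\ face_pos L m.+1 != vert L)).
Proof.
have [n] := ubnP #|X|; elim: n X => // n IH X Xn candX.
have smaller Q x : Q \subset X -> Q != set0 -> conn e Q -> 1 < #|below Q| -> x \in X ->
    x \in component e (U :\: Q) t ->
  exists P, [/\ P \subset U, t \notin P, P != set0, conn e (~: (S :|: P)) & forall v, v \in P -> has_up S P v]
    /\ ((exists x, single_group S P x) \/
        (exists L m, chain_group S P L m /\ face_pos L m.+1 != vert L)).
  move=> QX Q0 cQ bQ xX xG; have [X' [cX' X'X]] := candidate_shrink candX QX Q0 cQ bQ xX xG.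
  by apply: IH cX'; apply: leq_trans X'X _; rewrite -ltnS.
have [XU tX X0 cX [cUX bX]] := candX.
have tUX : t \in U :\: X by rewrite in_setD tX tU.
have SPU P : ~: (S :|: P) = U :\: P by rewrite setCU setDE.
(* If [x] disconnects the unplaced part, a component separated from [t] leads to a smaller
   candidate. *)
have [/existsP[x /existsP[y /and3P[xX yUx yG]]]|] :=
  boolP [exists x, exists y, [&& x \in X, y \in U :\ x & y \notin component e (U :\ x) t]].
  have xU := subsetP XU _ xX.
  have tUx : t \in U :\ x by rewrite in_setD1 tU andbT; apply: contraNneq tX => ->.
  pose K := component e (U :\ x) y.
  have KU : K \subset U :\ x by apply: component_sub.
  have x1U : [set x] \subset U by rewrite sub1set.
  have KG v : v \in K -> v \notin component e (U :\ x) t.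
    rewrite !inE => yv; apply: contra yG => tv; rewrite inE.
    by apply: connect_trans tv _; rewrite (induced_connect_sym eS).
  have KX : K \subset X.
    apply/subsetP => v vK; apply: contraTT (vK) => vX; have := KG v; rewrite vK => /(_ isT) vG.
    have /setD1P[vx vU] := subsetP KU _ vK.
    case/negP: vG; rewrite inE; apply: connect_subset (cUX t v tUX _); last by rewrite in_setD vX.
    by apply: setDS; rewrite sub1set.
  have xK : x \notin K by apply/negP => /(subsetP KU); rewrite !inE eqxx.
  apply: (smaller K x) => //.
  - by apply/set0Pn; exists y; apply: component_id.
  - exact: component_conn.
  - exact: below_component.
  have cUK : conn e (U :\: K).
    apply: component_compl => //; first exact: conn1.
    by apply/set0Pn; exists x; rewrite inE.
  have xUK : x \in U :\: K by rewrite in_setD xK.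
  have tUK : t \in U :\: K.
    by rewrite in_setD tU andbT; apply: contra tX; apply: (subsetP KX).
  by rewrite inE; apply: cUK.
move=> nosep; have {nosep}cUx x : x \in X -> conn e (U :\ x).
  move=> xX; have tUx : t \in U :\ x by rewrite in_setD1 tU andbT; apply: contraNneq tX => ->.
  have toT y : y \in U :\ x -> connect (induced e (U :\ x)) t y.
    move=> yU; apply: contraNT nosep => ty; apply/existsP; exists x; apply/existsP; exists y.
    by rewrite xX yU inE.
  move=> u v /toT tu /toT; apply: connect_trans.
  by rewrite (induced_connect_sym eS).
have [/existsP[x /andP[xX bx]]|nosingle] := boolP [exists x in X, 1 < #|below [set x]|].
  have xU := subsetP XU _ xX; have tx : t != x by apply: contraNneq tX => ->.
  exists [set x]; split; first split.
  - by rewrite sub1set.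
  - by rewrite inE.
  - by apply/set0Pn; exists x; rewrite inE.
  - by rewrite SPU; apply: cUx.
  - move=> v /set1P->; have [|u [v' [uU /set1P-> vU' vx' uv]]] := conn_edge cU xU (set11 x) tU.
      by rewrite inE.
    exists v' => //; rewrite in_setU negb_or vx' andbT.
    by move: vU'; rewrite in_setC.
  left; exists x; split=> //; first by move: xU; rewrite in_setC.
  case/card_gt1P: bx => a [b [/belowP[aS [? /set1P-> ax]] /belowP[bS [? /set1P-> bx]] ab]].
  by exists a, b; rewrite eS ax eS bx.
have {nosingle}below1 x s s' : x \in X -> s \in S -> s' \in S -> e s x -> e s' x -> s = s'.
  move=> xX sS s'S sx s'x; apply/eqP; apply: contraNT nosingle => ss'.
  apply/existsP; exists x; rewrite xX; apply/card_gt1P; exists s, s'.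
  by split=> //; apply/belowP; split=> //; exists x; rewrite ?inE.
have [s [s' [/belowP[sS [x xX /adjP[a as_ ax]]] /belowP[s'S [x' x'X /adjP[b bs bx]]] ss']]] := card_gt1P bX.
have dSX : [disjoint S & X].
  by rewrite disjoint_sym disjoints_subset.
have dSU : [disjoint S & U :\: X].
  by rewrite disjoint_sym disjoints_subset; apply: subsetDl.
have dXU : [disjoint X & U :\: X] by rewrite disjoint_sym disjoints_subset setDE subsetIr.
have SXU : S :|: X :|: (U :\: X) = setT.
  by apply/setP => v; rewrite !inE; case: (v \in S); case: (v \in X).
have [|||||L [R [[LS LX RX RS RL] [fRL fU]]]] :=
  two_part_face pg tc cS cX cUX dSX dSU dXU SXU (a := a) (b := b);
  rewrite ?as_ ?bs ?ax ?bx //.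
have [m mR mL] : exists2 m, R = iter m ph L & m < order ph L.
  have fLR : fconnect ph L R by rewrite -(face_eq pg) fRL eqxx.
  by exists (findex ph L R); rewrite ?iter_findex ?findex_max.
have m1 : face_pos L m.+1 = hd R by rewrite mR -(vert_ph pg).
have cCS : conn e (~: S) by [].
have XS v : v \in X -> v \notin S by move=> /(subsetP XU); rewrite in_setC.
have m0 : 0 < m.
  by rewrite lt0n; apply: contraTneq RX => m0; rewrite mR m0 /=; apply: contraL LS => /XS.
have xX' i : 0 < i <= m -> face_pos L i \in X.
  move=> /andP[i0 im]; have iS : face_pos L i \notin S.
    apply/negP => iS; have iC : vert (iter i ph L) \notin ~: S by rewrite in_setC negbK.
    have mC : vert (iter m ph L) \in ~: S by rewrite in_setC -mR XS.
    have [k [/andP[ik km] kS hkS]] := enters_between pg im iC mC.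
    rewrite !in_setC ?negbK in kS hkS.
    have Lk : iter 0 ph L = iter k ph L.
      by apply: (bond_face pg cS cCS); rewrite ?(face_iter pg) //= XS.
    have := iter_ph_inj (leq_ltn_trans (leq0n m) mL) (ltn_trans km mL) Lk.
    by move=> k0; rewrite -k0 leqNgt i0 in ik.
  have := fU (iter i ph L); rewrite (face_iter pg) => /(_ erefl); rewrite in_setD in_setC.
  by rewrite iS andbT negbK.
have xS i : 0 < i <= m -> face_pos L i \notin S by move=> /xX' /XS.
have hdi i : hd (iter i ph L) = face_pos L i.+1 by rewrite /face_pos /= (vert_ph pg).
(* A chain of one vertex would have two earlier neighbours, which [below1] excludes. *)
have m2 : 1 < m.
  rewrite ltn_neqAle m0 andbT; apply: contraNneq RL => m1'; apply/eqP.
  apply: (below1 (vert R)); rewrite // ?[e (hd R) _]eS ?adj_dart //.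
  by rewrite mR -m1' /= (vert_ph pg) adj_dart.
have Sdart i d : 0 < i <= m -> vert d = face_pos L i -> hd d \in S ->
    d = iter i ph L \/ d = al (iter i.-1 ph L).
  move=> im dx hdS; have ed : e (hd d) (face_pos L i) by rewrite -dx eS adj_dart.
  have [i1|i1] := eqVneq i 1.
    right; apply: (simple_map pg); rewrite ?(alK pg) i1 /=; first by rewrite dx i1 -(hdi 0).
    by apply: (below1 (face_pos L i)) => //; [apply: xX' | rewrite i1 -(hdi 0) adj_dart].
  have [im'|im'] := eqVneq i m.
    left; apply: (simple_map pg) => //; rewrite im' hdi m1.
    apply: (below1 (face_pos L i)) => //; first exact: xX'.
    by rewrite im' /face_pos -mR eS adj_dart.
  (* An inner chain vertex with an earlier neighbour forms a connected set with [S], which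
     alternates with the remaining unplaced vertices around the face. *)
  case: (@face_crossing _ _ _ _ _ pg (face_pos L i |: S) (U :\ face_pos L i) L 1 i m m.+1) => //.
  - by apply: (connU1 eS cS hdS); rewrite eS.
  - by apply: cUx; apply: xX'.
  - apply/pred0P => v /=; rewrite !inE; by case: (v == _); case: (v \in S).
  - by nlia.
  - by nlia.
  - rewrite in_setD1 in_setC xS ?m0 // andbT; apply: contraNneq i1 => E.
    by apply/eqP/(fpos_inj _ _ (esym E)); nlia.
  - by rewrite inE in_set1 eqxx.
  - rewrite in_setD1 in_setC xS ?m0 ?leqnn // andbT; apply: contraNneq im' => E.
    by apply/eqP/(fpos_inj _ _ (esym E)); nlia.
  - by rewrite in_setU -[vert _]/(face_pos L m.+1) m1 RS orbT.
pose P := face_seg L 1 m; have PX : P \subset X by apply/subsetP => v /fsegP[i im ->]; apply: xX'.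
have PU := subset_trans PX XU.
have tP : t \notin P by apply: contra tX; apply: (subsetP PX).
have tUP : t \in U :\: P by rewrite in_setD tP.
have P0 : P != set0 by apply/set0Pn; exists (face_pos L 1); apply/fsegP; exists 1.
(* Suppose the chain cuts a component [K] off from [t]. Unless [K] already gives a smaller
   candidate, it has exactly one earlier neighbour [q]. If [q] is an end of the face path, there is
   a crossing; otherwise [K] with a part of the chain gives a smaller candidate. *)
have [/existsP[y /andP[yUP yG]]|nosep] :=
  boolP [exists y, (y \in U :\: P) && (y \notin component e (U :\: P) t)].
  pose W := component e (U :\: P) t; pose K := component e (U :\: P) y.
  have KUP : K \subset U :\: P by apply: component_sub.
  have WUP : W \subset U :\: P by apply: component_sub.
  have K0 : K != set0 by apply/set0Pn; exists y; apply: component_id.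
  have cK : conn e K by apply: component_conn.
  have cW : conn e W by apply: component_conn.
  have KW v : v \in K -> v \notin W.
    rewrite !inE => yv; apply: contra yG => tv; rewrite inE.
    by apply: connect_trans tv _; rewrite (induced_connect_sym eS).
  have Kcl c d : c \in K -> d \in U :\: P -> e c d -> d \in K by apply: component_closed.
  have UW v : v \in U -> v \notin X -> v \in W.
    move=> vU vX; rewrite inE; apply: connect_subset (cUX t v tUX _); last by rewrite in_setD vX.
    exact: setDS.
  have KX : K \subset X.
    apply/subsetP => v vK; apply: contraTT (vK) => vX; have /setDP[vU _] := subsetP KUP _ vK.
    by move/KW: (vK); rewrite UW.
  have KP v : v \in K -> v \notin P by move/(subsetP KUP)/setDP => [].
  have KS v : v \in K -> v \notin S by move/(subsetP KX)/XS.
  have [w [c [wW cP' wc]]] : exists w c, [/\ w \in W, c \in P & e w c].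
    have x1P : face_pos L 1 \in P by apply/fsegP; exists 1.
    have x1W : face_pos L 1 \notin W by apply/negP => /(subsetP WUP)/setDP[_]; rewrite x1P.
    have [w [c [wU wW cU' cW' wc]]] :=
      conn_edge cU tU (component_id e _ t) (subsetP PU _ x1P) x1W.
    exists w, c; split=> //; apply: contraNT cW' => cP'; apply: (component_closed tUP wW) wc.
    by rewrite in_setD cP'.
  have WG Q : Q \subset K :|: P -> c \notin Q -> [disjoint W & Q] -> c \in component e (U :\: Q) t.
    move=> QKP cQ dWQ; have WUQ : W \subset U :\: Q.
      apply/subsetP => v vW; have /setDP[vU _] := subsetP WUP _ vW.
      by rewrite in_setD vU (disjointFr dWQ vW).
    have wG : w \in component e (U :\: Q) t.
      by rewrite inE; apply: connect_subset WUQ (cW _ _ (component_id e _ t) wW).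
    apply: component_closed wG _ wc; first by apply: (subsetP WUQ); apply: component_id.
    by rewrite in_setD cQ (subsetP PU).
  have dW Q : Q \subset K :|: P -> [disjoint W & Q].
    move=> QKP; apply/pred0P => v /=; apply/negP => /andP[vW /(subsetP QKP)].
    rewrite in_setU => /orP[/KW|vP]; first by rewrite vW.
    by have /setDP[_] := subsetP WUP _ vW; rewrite vP.
  have KKP : K \subset K :|: P by apply: subsetUl.
  have [bK|bK] := ltnP 1 #|below K|.
    apply: (smaller K c) => //; first exact: (subsetP PX).
    by apply: WG => //; [apply/negP => /KP; rewrite cP' | apply: dW].
  have [a1 [b1 [[a0 ab bm [ka kaK xka] [kb kbK xkb]] ext]]] :=
    chain_attach (S := S) cU m0 xS KUP K0 Kcl.
  have [q qS [k kK qk]] := chain_no_pocket LS mL cU m0 xS KUP K0 cK Kcl.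
  have qb : q \in below K by apply/belowP; split=> //; exists k.
  have bE q' k' : q' \in S -> k' \in K -> e q' k' -> q' = q.
    move=> q'S k'K q'k; have q'b : q' \in below K by apply/belowP; split=> //; exists k'.
    by apply/eqP; move/card_le1P: bK => /(_ q qb q'); rewrite q'b => /esym; rewrite inE.
  have notK i : 0 < i <= m -> face_pos L i \notin K.
    by move=> im; apply/negP => /KP; apply/negP; rewrite negbK; apply/fsegP; exists i.
  have am : 0 < a1 <= m by nlia.
  have bm' : 0 < b1 <= m by nlia.
  have SK v : v \in S -> v \notin K by move=> vS; apply/negP => /KS; rewrite vS.
  (* an attachment of [K] outside its neighbour [q] below lies on the chain *)
  have attP v : v \notin K -> v != q -> (exists2 k, k \in K & e v k) ->
      exists2 i, 0 < i <= m & v = face_pos L i.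
    move=> vK vq [k' k'K vk']; apply/fsegP; apply: contraNT vK => vP.
    apply: (Kcl k'); rewrite // 1?eS // in_setD vP in_setC /=.
    by apply: contra vq => vS; apply/eqP; apply: (bE v k').
  have hRL : face_pos L m.+1 != vert L by rewrite m1.
  have [qR|qR] := eqVneq q (face_pos L m.+1).
    have L_out : vert L \notin [set face_pos L a1; q].
      by rewrite !inE negb_or qR [vert L == face_pos L m.+1]eq_sym hRL andbT; apply: contraTneq LS => ->; rewrite xS.
    have [v [C [[vM vK cC vC LC] [dC cM]]]] := third_attachment cK K0 (SK _ LS) L_out (notK _ am) (SK _ qS)
      (ex_intro2 _ _ ka kaK xka) (ex_intro2 _ _ k kK qk).
    move: vM; rewrite in_setU in_set2 !negb_or => /and3P[vK' va vq].
    have [i im vi] := attP v vK' vq vK.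
    have iab := ext i im; rewrite -vi in iab; have {}iab := iab vK.
    have ia : i != a1 by apply: contraNneq va => <-; rewrite vi.
    case: (@face_crossing _ _ _ _ _ pg (face_pos L a1 |: (q |: K)) C L 0 a1 i m.+1) => //.
    - by rewrite disjoint_sym.
    - by nlia.
    - by nlia.
    - by rewrite in_setU1 eqxx.
    - by rewrite -[vert _]/(face_pos L i) -vi.
    - by rewrite -[vert _]/(face_pos L m.+1) -qR !in_setU1 eqxx orbT.
  have [qL|qL] := eqVneq q (vert L).
    have R_out : face_pos L m.+1 \notin [set face_pos L b1; q].
      by rewrite !inE negb_or qL hRL andbT; apply: contraTneq RS => E; rewrite -m1 E xS.
    have mSK : face_pos L m.+1 \notin K by rewrite m1 SK.
    have [v [C [[vM vK cC vC RC] [dC cM]]]] := third_attachment cK K0 mSK R_out (notK _ bm') (SK _ qS)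
      (ex_intro2 _ _ kb kbK xkb) (ex_intro2 _ _ k kK qk).
    move: vM; rewrite in_setU in_set2 !negb_or => /and3P[vK' vb vq].
    have [i im vi] := attP v vK' vq vK.
    have iab := ext i im; rewrite -vi in iab; have {}iab := iab vK.
    have ib : i != b1 by apply: contraNneq vb => <-; rewrite vi.
    case: (@face_crossing _ _ _ _ _ pg C (face_pos L b1 |: (q |: K)) L 0 i b1 m.+1) => //.
    - by nlia.
    - by nlia.
    - by rewrite -[vert _]/(vert L) -qL !in_setU1 eqxx orbT.
    - by rewrite -[vert _]/(face_pos L i) -vi.
    - by rewrite in_setU1 eqxx.
  (* cutting the chain at the attachment [c] of [W] gives a smaller candidate *)
  case/fsegP: (cP') => ic icm cE.
  have a1b1 : a1 < b1.
    have kaq : k \notin [set face_pos L a1; q].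
      by rewrite !inE negb_or; apply/andP; split; apply: contraTneq kK => ->; [apply: notK | apply: SK].
    have L_out : vert L \notin [set face_pos L a1; q].
      by rewrite !inE negb_or [vert L == q]eq_sym qL andbT; apply: contraTneq LS => ->; rewrite xS.
    have [u [v [uK _ vK + uv]]] := neighbour3 tc kK kaq (SK _ LS) L_out.
    rewrite !inE negb_or => /andP[va vq].
    have vk : exists2 k, k \in K & e v k by exists u; rewrite // eS.
    have [i im vi] := attP v vK vq vk.
    have iab := ext i im; rewrite -vi in iab; have {}iab := iab vk.
    have ia : i != a1 by apply: contraNneq va => <-; rewrite vi.
    by nlia.
  have cQ Q p0 p1 : Q = K :|: face_seg L p0 p1 -> 0 < p0 -> p1 <= m ->
      (exists2 i, p0 <= i <= p1 & exists2 k, k \in K & e (face_pos L i) k) ->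
      ic < p0 \/ p1 < ic ->
      (exists i, [/\ p0 <= i <= p1 & exists2 q', q' \in S & e q' (face_pos L i) /\ q' != q]) ->
    exists P, [/\ P \subset U, t \notin P, P != set0, conn e (~: (S :|: P)) & forall v, v \in P -> has_up S P v]
      /\ ((exists x, single_group S P x) \/
          (exists L m, chain_group S P L m /\ face_pos L m.+1 != vert L)).
    move=> QE p00 p1m [i ip [k' k'K xik']] icp [i' [i'p [q' q'S [q'x q'q]]]].
    have QKP : Q \subset K :|: P.
      rewrite QE; apply: setUS; apply/subsetP => v /fsegP[j jp ->]; apply/fsegP; exists j => //.
      by nlia.
    have KQ : K \subset Q by rewrite QE subsetUl.
    apply: (smaller Q c).
    - by apply: subset_trans QKP _; rewrite subUset KX.
    - by apply: contraNneq K0 => Q0; rewrite -subset0 -Q0.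
    - have iseg : face_pos L i \in face_seg L p0 p1 by apply/fsegP; exists i.
      rewrite QE setUC; apply: (connU eS (@fseg_conn L p0 p1) cK iseg k'K).
      by rewrite xik' orbT.
    - apply/card_gt1P; exists q', q; split=> //.
        apply/belowP; split=> //; exists (face_pos L i') => //.
        by rewrite QE in_setU; apply/orP; right; apply/fsegP; exists i'.
      by apply/belowP; split=> //; exists k => //; apply: (subsetP KQ).
    - exact: (subsetP PX).
    - apply: WG => //; last exact: dW.
      rewrite QE in_setU negb_or cE notK //=; apply/negP => /fsegP[j jp E].
      have jm : j < order ph L by nlia.
      have icL : ic < order ph L by nlia.
      by have := fpos_inj icL jm E; nlia.
  have [cb|bc] := ltnP ic b1.
    apply: (cQ (K :|: face_seg L ic.+1 m) ic.+1 m) => //.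
    - by exists b1; [nlia | exists kb].
    - by left.
    exists m; split; first by nlia.
    exists (face_pos L m.+1); first by rewrite m1.
    by split; [rewrite eS fpos_adj | rewrite eq_sym].
  apply: (cQ (K :|: face_seg L 1 ic.-1) 1 ic.-1) => //.
  - by nlia.
  - by exists a1; [nlia | exists ka].
  - by right; nlia.
  exists 1; split; first by nlia.
  by exists (vert L) => //; split; [apply: (fpos_adj L 0) | rewrite eq_sym].
exists P; split; last first.
  right; exists L, m; split; last by rewrite m1.
  split=> //; first by split=> //; rewrite m1.
  move=> i d im dx; rewrite in_setU => /orP[/(Sdart i d im dx)//|dP].
  by apply: (chain_edge mL) dP.
split=> //.
  rewrite SPU => u v; have toT w : w \in U :\: P -> connect (induced e (U :\: P)) t w.
    move=> wU; apply: contraNT nosep => tw; apply/existsP; exists w.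
    by rewrite wU inE.
  by move=> /toT tu /toT; apply: connect_trans; rewrite (induced_connect_sym eS).
move=> v /fsegP[i im ->].
by apply: (chain_up mL) => // d; apply: Sdart.
Qed.

End Step.
End Ordering.

(** * The ordering as a level function *)

Section Levels.
Variables (V D : finType) (al si : D -> D) (vert : D -> V).
Hypothesis pg : plane_graph al si vert.
Local Notation e := (adj al vert).
Hypothesis tc : three_connected e.
Implicit Types (S A M N W K X Y U P Q : {set V}).
Variables (z t : V).
Hypothesis zt : e z t.
Let eS : symmetric e := adj_sym pg.

(* [S] is the union of the earlier groups, [P] the next group and [t] the last vertex. *)
Definition group_at S P :=
  [/\ [/\ conn e S, conn e (~: S) & conn e (~: (S :|: P))],
      forall v, v \in P -> v != t -> has_up al vert S P v,
      t \in P -> P = [set t] /\ S :|: P = setT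
    & (exists x, single_group al vert S P x) \/
      (exists L m, chain_group al si vert S P L m /\
                   (face_pos al si vert L m.+1 != vert L \/ vert L = z))].

Lemma group_conn S P : group_at S P -> conn e (S :|: P).
Proof.
case=> -[cS _ _] _ _ [[x [-> _ [a [b [aS _ _ xa _]]]]]|[L [m [[[m1 _ LS _ ->] _ _] _]]]].
  by rewrite setUC; apply: (connU1 eS cS aS).
have x1 : face_pos al si vert L 1 \in face_seg al si vert L 1 m by apply/fsegP; exists 1 => //; rewrite /= ltnW.
apply: (connU eS cS (@fseg_conn _ _ _ _ _ pg L 1 m) LS x1).
by rewrite (fpos_adj pg L 0) orbT.
Qed.

(** As long as more than [t] is left, any component of the rest without [t] is an initial candidate;
    in the end [t] is a group by itself. *)
Lemma next_group S : conn e S -> conn e (~: S) -> z \in S -> t \notin S -> 1 < #|S| ->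
  exists2 P, P != set0 /\ [disjoint S & P] & group_at S P.
Proof.
move=> cS cU zS tS S2; pose U := ~: S; have tU : t \in U by rewrite inE.
have [Ut|[x xUt]] := set_0Vmem (U :\ t).
  have UE : U = [set t] by rewrite -(setD1K tU) Ut setU0.
  exists [set t]; first split.
  - by apply/set0Pn; exists t; rewrite inE.
  - by rewrite disjoint_sym disjoints1.
  have St : S :|: [set t] = setT by rewrite -UE setUCr.
  split=> //.
  - by split=> //; rewrite St setCT => u v; rewrite inE.
  - by move=> v /set1P->; rewrite eqxx.
  left; exists t; split=> //.
  have zt' := adj_neq pg zt.
  have [w [tw wz _]] := third_neighbour tc zt' zt'.
  exists z, w; split=> //; last by rewrite eS.
    have : w \in S :|: [set t] by rewrite St inE.
    by rewrite in_setU1 || rewrite in_setU in_set1 => /orP[//|/eqP wt]; have := adj_neq pg tw; rewrite wt eqxx.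
  by rewrite eq_sym.
have [xt xU] := setD1P xUt.
pose X := component e (U :\ t) x; have XU : X \subset U :\ t by apply: component_sub.
have cand : candidate al vert S t X.
  split; last split.
  - by apply: subset_trans XU (subD1set _ _).
  - by apply/negP => /(subsetP XU); rewrite !inE eqxx.
  - by apply/set0Pn; exists x; apply: component_id.
  - exact: component_conn.
  - apply: component_compl => //; [by rewrite sub1set | exact: conn1 |].
    by apply/set0Pn; exists t; rewrite inE.
  - exact: (below_component pg tc zS S2).
have [P [[PU tP P0 cSP up] grp]] := next_group_from pg tc cS cU zS tU S2 cand.
exists P; first by split=> //; rewrite disjoint_sym disjoints_subset.
split=> //; first by move=> v /up.
  by move/negP: tP.
by case: grp => [?|[L [m [? ?]]]]; [left | right; exists L, m; split=> //; left].
Qed.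

Definition levels_from S (g : V -> nat) :=
  (forall v, (v \in S) = (g v == 0)) /\
  forall v, v \notin S -> group_at [set u | g u < g v] [set u | g u == g v].

Lemma levels_extend S P g : [disjoint S & P] -> group_at S P -> levels_from (S :|: P) g ->
  levels_from S (fun v => if v \in S then 0 else (g v).+1).
Proof.
move=> dSP gP [g0 gk]; split; first by move=> v; case: (v \in S).
move=> v vS; rewrite (negbTE vS).
have [vP|vP] := boolP (v \in P).
  have gv0 : g v = 0 by apply/eqP; rewrite -g0 in_setU vP orbT.
  rewrite gv0 (_ : [set u | _ < _] = S); last by apply/setP => u; rewrite inE; case: (u \in S).
  rewrite (_ : [set u | _ == _] = P) //; apply/setP => u; rewrite inE.
  have [uS|uS] := boolP (u \in S); first by rewrite (disjointFr dSP uS).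
  by rewrite eqSS -g0 in_setU (negbTE uS).
have vSP : v \notin S :|: P by rewrite in_setU negb_or vS.
have gv : 0 < g v by rewrite lt0n -g0.
have := gk v vSP; congr group_at; apply/setP => u; rewrite !inE.
  by have [uS|//] := boolP (u \in S); have /eqP -> : g u == 0 by rewrite -g0 in_setU uS.
have [uS|//] := boolP (u \in S); have /eqP -> : g u == 0 by rewrite -g0 in_setU uS.
by rewrite eq_sym -[0 == _]eq_sym; case: (g v) gv.
Qed.

Lemma exists_levels_from S : conn e S -> conn e (~: S) -> z \in S -> t \notin S -> 1 < #|S| ->
  exists g, levels_from S g.
Proof.
have [n] := ubnP #|~: S|; elim: n S => // n IH S Sn cS cU zS tS S2.
have [P [P0 dSP] gP] := next_group cS cU zS tS S2.
have [[_ _ cUP] up tP grp] := gP.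
have PE v : v \in P -> v \notin S by move=> vP; rewrite (disjointFl dSP vP).
have [SPT|/set0Pn[u0 u0SP]] := eqVneq (~: (S :|: P)) set0.
  have PC v : (v \in P) = (v \notin S).
    have : v \notin ~: (S :|: P) by rewrite SPT inE.
    by rewrite in_setC negbK in_setU; have [vS|_] := boolP (v \in S); [rewrite (disjointFr dSP vS) | ].
  exists (fun v => v \notin S); split; first by move=> v; case: (v \in S).
  move=> v vS; rewrite vS.
  rewrite (_ : [set u | _ < _] = S); last by apply/setP => u; rewrite inE; case: (u \in S).
  rewrite (_ : [set u | _ == _] = P) //; apply/setP => u; rewrite inE PC; by case: (u \in S).
have tSP : t \notin S :|: P.
  rewrite in_setU negb_or tS /=; apply/negP => /tP[_ SPT].
  by move: u0SP; rewrite SPT setCT inE.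
have cSP : conn e (S :|: P).
  exact: group_conn gP.
have [|||||| g [g0 gk]] := IH (S :|: P) => //.
- apply: leq_trans (_ : #|~: (S :|: P)| < #|~: S|) _; last by rewrite -ltnS.
  apply: proper_card; apply/properP; split; first by rewrite setCS subsetUl.
  by have [p pP] := set0Pn _ P0; exists p; rewrite !inE ?pP ?orbT // PE.
- by rewrite in_setU zS.
- by apply: leq_trans S2 (subset_leq_card (subsetUl _ _)).
by exists (fun v => if v \in S then 0 else (g v).+1); apply: levels_extend gP _.
Qed.

End Levels.

(** * The first group around the apex *)

Section FirstGroup.
Variables (V D : finType) (al si : D -> D) (vert : D -> V).
Hypothesis pg : plane_graph al si vert.
Local Notation ph := (face_perm al si).
Local Notation e := (adj al vert).
Local Notation hd d := (vert (al d)).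
Hypothesis tc : three_connected e.
Variable L : D.
Hypothesis L3 : order si L = 3.
(** Of the three edges [L], [si L], [finv si L] at the apex, the outer two bound the face that
    becomes the first group, and the middle one leads to the last vertex [t]. *)
Let z := vert L.
Let t := hd (si L).
Let m := (order ph L).-1.
Let P := face_seg al si vert L 1 m.
Let eS : symmetric e := adj_sym pg.
Local Notation fpos := (face_pos al si vert).

Lemma apex_darts d : vert d = z -> [\/ d = L, d = si L | d = finv si L].
Proof.
move=> dz; have : fconnect si L d by rewrite -(vertE pg) dz.
have finvE : finv si L = si (si L) by rewrite /finv L3.
move=> Ld; rewrite -(iter_findex Ld) finvE; have := findex_max Ld; rewrite L3.
by case: (findex si L d) => [|[|[|//]]] _; [apply: Or31 | apply: Or32 | apply: Or33].
Qed.

Lemma apex_next : e z t.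
Proof. by rewrite /z -(vert_si pg) adj_dart. Qed.

Let si_neq : [/\ si L != L, si L != finv si L & finv si L != L].
Proof.
have siI := si_inj pg; have finvE : finv si L = si (si L) by rewrite /finv L3.
have n1 : si L != L.
  apply/eqP => E; have : iter 1 si L = iter 0 si L by [].
  by move/(congr1 (findex si L)); rewrite !findex_iter ?L3.
split=> //; first by rewrite finvE eq_sym (inj_eq siI).
apply/eqP => E; have : iter 2 si L = iter 0 si L by rewrite /= -finvE.
by move/(congr1 (findex si L)); rewrite !findex_iter ?L3.
Qed.

Let m1 : m.+1 = order ph L. Proof. by rewrite /m prednK // order_gt0. Qed.

Let iter_m : iter m ph L = finv ph L.
Proof. by []. Qed.

Let hd_m : hd (iter m ph L) = z.
Proof. by rewrite -(vert_ph pg) -iterS m1 iter_order //; apply: face_perm_inj pg. Qed.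

Let m2 : 1 < m.
Proof.
have [pf hp _] := face_prev pg L; rewrite -iter_m in pf hp.
have m0 : m != 0 by apply: contraTneq (vert_al pg L) => mz; move: hp; rewrite mz /= => ->; rewrite eqxx.
rewrite ltn_neqAle lt0n m0 andbT; apply/eqP => mE; move: hp; rewrite -mE /= => hp.
have E : ph L = al L by apply: (simple_map pg); rewrite ?(alK pg) // (vert_ph pg).
have zx : z != hd L by rewrite eq_sym (vert_al pg).
have [w [xw wz _]] := third_neighbour tc zx zx.
case/adjP: xw => d dx dw; case/eqP: wz; rewrite -dw.
suff -> : d = al L by rewrite (alK pg).
have : fconnect si (al L) d by rewrite -(vertE pg) dx.
by move/iter_findex <-; elim: findex => //= k ->; rewrite -[RHS]E.
Qed.

(** Otherwise the adjacent vertices [z] and [t] would separate the two pieces of the face boundary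
    between them. *)
Let tP : t \notin P.
Proof.
have siI := si_inj pg; have [n1 n2 n3] := si_neq.
apply/negP => /fsegP[i /andP[i0 im] ti].
have zt := apex_next; have cM : conn e (z |: [set t]).
  by apply: (connU1 eS (@conn1 _ _ _)) zt; rewrite inE.
have zx j : 0 < j <= m -> fpos L j != z.
  move=> jm; apply: contraTneq (jm) => /(@fpos_inj _ _ _ _ _ pg tc L j 0); rewrite order_gt0 -m1.
  by move=> E; rewrite E // -?m1 ?ltnS; case/andP: jm.
have n_t j : 0 < j <= m -> j != i -> fpos L j != t.
  move=> jm; apply: contraNneq; rewrite ti => /(@fpos_inj _ _ _ _ _ pg tc L j i) ->//; rewrite -m1 ltnS //.
  by case/andP: jm.
have r1 : fpos L 1 = hd L by rewrite /face_pos /= (vert_ph pg).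
have i1 : i != 1.
  apply: contraNneq n1 => i1; apply/eqP; apply: (simple_map pg); rewrite ?(vert_si pg) // -/t.
  by rewrite ti i1 r1.
have im' : i != m.
  apply: contraNneq n2 => im'; apply/eqP; apply: (simple_map pg).
    by have [_ _ <-] := face_prev pg L; rewrite -iter_m hd_m (vert_si pg).
  by have [_ _ <-] := face_prev pg L; rewrite -iter_m (alK pg) -/t ti im'.
have i2 : 1 < i by rewrite ltn_neqAle eq_sym i1.
have m_1 : 0 < 1 <= m := ltnW m2.
have m_m : 0 < m <= m by rewrite leqnn (ltnW m2).
have imm : i < m by rewrite ltn_neqAle im'.
case: (@face_crossing _ _ _ _ _ pg (z |: [set t]) (~: (z |: [set t])) L 1 i m m.+1) => //.
- exact: conn_delete2.
- by rewrite -setI_eq0 setICr.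
- by rewrite m1.
- by rewrite -[vert _]/(fpos L 1) in_setC in_setU1 in_set1 negb_or (zx 1 m_1) (n_t 1 m_1) // eq_sym.
- by rewrite -[vert _]/(fpos L i) -ti !inE eqxx orbT.
- by rewrite -[vert _]/(fpos L m) in_setC in_setU1 in_set1 negb_or (zx m m_m) (n_t m m_m) // eq_sym.
- by rewrite /= (vert_ph pg) hd_m in_setU1 eqxx.
Qed.

Lemma first_group : chain_group al si vert [set z] P L m.
Proof.
have zx i : 0 < i <= m -> fpos L i \notin [set z].
  move=> /andP[i0 im]; rewrite in_set1; apply/negP => /eqP /(@fpos_inj _ _ _ _ _ pg tc L i 0).
  by rewrite order_gt0 -m1 ltnS => /(_ im isT) E; rewrite E in i0.
have mL : m < order ph L by rewrite -m1.
split=> //.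
  by split=> //; [rewrite inE | rewrite inE /face_pos /= (vert_ph pg) hd_m].
move=> i d im dx; rewrite in_setU => /orP[/set1P dz|]; last exact: (chain_edge pg tc mL (ltnW m2) im dx).
have [n1 n2 n3] := si_neq; have [i0 im'] := andP im.
have iL : i < order ph L by apply: leq_ltn_trans mL.
have dP : vert d \in P by rewrite dx; apply/fsegP; exists i.
have [adL|adL|adL] := apex_darts dz.
- right; have i1 : i = 1.
    apply: (@fpos_inj _ _ _ _ _ pg tc L i 1 iL); first by rewrite -m1 ltnS ltnW.
    by rewrite -dx -[d](alK pg) adL /face_pos /= (vert_ph pg).
  by rewrite i1 /= -adL (alK pg).
- by case/negP: tP; rewrite /t -adL (alK pg).
left; have [_ _ E] := face_prev pg L.
have dm : d = iter m ph L by rewrite -[d](alK pg) adL -E (alK pg).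
suff -> : i = m by [].
by apply: (@fpos_inj _ _ _ _ _ pg tc L i m iL mL); rewrite -dx dm.
Qed.

(** A component cut off from [t] would be adjacent to [z] by [chain_no_pocket], but the edges of [z]
    other than the one to [t] end on the chain. *)
Lemma first_group_at : group_at al si vert z t [set z] P.
Proof.
have [_ xS Pd] := first_group; have mL : m < order ph L by rewrite -m1.
have [n1 n2 n3] := si_neq.
have zS : vert L \in [set z] by rewrite inE.
have cU : conn e (~: [set z]) by apply: conn_delete1.
have m0 : 0 < m by apply: ltnW.
have zt : z != t := adj_neq pg apex_next.
split; last by right; exists L, m; split; [exact: first_group | right].
- split=> //; first exact: conn1.
  have SPU : ~: ([set z] :|: P) = ~: [set z] :\: P by rewrite setCU setDE.
  rewrite SPU; set W := _ :\: P; have tW : t \in W by rewrite in_setD tP in_setC in_set1 eq_sym zt.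
  suff toT y : y \in W -> connect (induced e W) t y.
    move=> u v /toT tu /toT; apply: connect_trans.
    by rewrite (induced_connect_sym eS).
  move=> yW; have [//|ty] := boolP (connect _ _ _).
  pose K := component e W y; have KW : K \subset W by apply: component_sub.
  have [||q /set1P-> [k kK zk]] := chain_no_pocket pg tc zS mL cU m0 xS KW _ (component_conn eS yW).
  - by apply/set0Pn; exists y; apply: component_id.
  - by move=> a b aK bW ab; apply: component_closed ab.
  have kW : k \in W := subsetP KW _ kK.
  have kt : k != t.
    by apply: contraNneq ty => <-; rewrite (induced_connect_sym eS); move: kK; rewrite inE.
  case/adjP: zk => d dz dk; have [dL|dL|dL] := apex_darts dz; case/setDP: kW => _ /negP[].
  - by rewrite -dk dL; apply/fsegP; exists 1; rewrite ?m0 // /face_pos /= (vert_ph pg).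
  - by move: kt; rewrite -dk dL eqxx.
  have [_ _ E] := face_prev pg L; rewrite -dk dL -E (alK pg).
  by apply/fsegP; exists m; rewrite ?m0 ?leqnn.
- move=> v /fsegP[i im ->] _; apply: (chain_up pg tc mL) => // d dx dz.
  by apply: Pd => //; rewrite in_setU dz.
by move/negP: tP.
Qed.

Lemma exists_levels : exists g, levels_from al si vert z t [set z] g /\ [set v | g v == 1] = P.
Proof.
have P0 : fpos L 1 \in P by apply/fsegP; exists 1 => //=; exact: ltnW m2.
have [_ xS _] := first_group.
have dzP : [disjoint [set z] & P].
  by rewrite disjoints1; apply/negP => /fsegP[i im E]; have := xS i im; rewrite -E inE eqxx.
have zt : z != t := adj_neq pg apex_next.
have [[_ _ cSP] _ _ _] := first_group_at.
have [|||g [g0 gk]] := exists_levels_from pg tc apex_next (group_conn pg first_group_at) cSP.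
- by rewrite in_setU inE eqxx.
- by rewrite in_setU inE eq_sym negb_or zt tP.
- by rewrite cardsU1 (disjointFr dzP) ?inE // add1n ltnS; apply/card_gt0P; exists (fpos L 1).
exists (fun v => if v \in [set z] then 0 else (g v).+1); split.
  exact: levels_extend first_group_at _.
apply/setP => v; rewrite inE; have [vz|vz] := boolP (v \in [set z]); first by rewrite (disjointFr dzP vz).
by rewrite eqSS -g0 in_setU (negbTE vz).
Qed.

End FirstGroup.

(** * Corner labels *)

Section Local.
Variables (V D : finType) (al si : D -> D) (vert : D -> V).
Hypothesis pg : plane_graph al si vert.
Local Notation ph := (face_perm al si).
Local Notation e := (adj al vert).
Local Notation hd d := (vert (al d)).
Local Notation fpos := (face_pos al si vert).
Local Notation fseg := (face_seg al si vert).
Local Notation isi := (finv si).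
Hypothesis tc : three_connected e.
Variable L : D.
Hypothesis L3 : order si L = 3.
Let z := vert L.
Let t := hd (si L).
Variable g : V -> nat.
Hypothesis glev : levels_from al si vert z t [set z] g.
Hypothesis glev1 : [set v | g v == 1] = fseg L 1 (order ph L).-1.
Let siI : injective si := si_inj pg.

(* The edge from the last vertex to the apex counts as going up, the other two edges at the apex as
   going down. *)
Definition upward d := (vert d != z) &&
  ((hd d != z) && (g (vert d) < g (hd d)) || (vert d == t) && (hd d == z)).

Lemma g_eq0 v : (g v == 0) = (v == z).
Proof. by case: glev => <- _; rewrite inE. Qed.

Lemma g_gt0 v : (0 < g v) = (v != z).
Proof. by rewrite lt0n g_eq0. Qed.

Lemma zt_neq : z != t.
Proof. exact: (adj_neq pg (apex_next pg L)). Qed.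

Lemma group_of v : v != z ->
  group_at al si vert z t [set u | g u < g v] [set u | g u == g v].
Proof. by move=> vz; case: glev => _; apply; rewrite inE. Qed.

Lemma top_max v : g v <= g t.
Proof.
have tz : t != z by rewrite eq_sym zt_neq.
have [_ _ + _] := group_of tz; rewrite inE eqxx => /(_ isT)[_ /setP/(_ v)].
by rewrite !inE => /orP[/ltnW|/eqP->].
Qed.

Lemma upE d : vert d != z -> vert d != t -> upward d = (g (vert d) < g (hd d)).
Proof.
move=> dz dt; rewrite /upward dz (negbTE dt) /= orbF andb_idl // => /(leq_ltn_trans (leq0n _)).
by rewrite g_gt0.
Qed.

Lemma up_top d : vert d = t -> upward d = (hd d == z).
Proof.
move=> dt; rewrite /upward dt eqxx eq_sym zt_neq /= ltnNge top_max /= andbF.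
by [].
Qed.

Lemma si_vert d : vert (si d) = vert d. Proof. exact: vert_si pg d. Qed.
Lemma isi_vert d : vert (isi d) = vert d.
Proof. by rewrite -[in RHS](f_finv siI d) si_vert. Qed.

Lemma exists_up v : v != z -> exists2 d, vert d = v & upward d.
Proof.
move=> vz; have [vt|vt] := eqVneq v t.
  have /adjP[d dz dt] := apex_next pg L; exists (al d); first by rewrite vt.
  by rewrite up_top ?(alK pg) ?dz.
have [_ + _ _] := group_of vz; rewrite -/z => /(_ v); rewrite inE eqxx => /(_ isT vt)[w].
rewrite !inE negb_or -leqNgt => /andP[w1 w2] /adjP[d dv dw].
by exists d; rewrite // upE dv // dw ltn_neqAle w1 eq_sym w2.
Qed.

Lemma up_gt d : upward d -> hd d != z -> g (vert d) < g (hd d).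
Proof. by case/andP => _ /orP[/andP[]|/andP[_ ->]]. Qed.

Section ChainDarts.
Variables (k : nat) (L' : D) (m : nat).
Hypothesis chg : chain_group al si vert [set u | g u < k] [set u | g u == k] L' m.
Hypothesis k0 : 0 < k.

Lemma chain_level i : 0 < i <= m -> g (fpos L' i) = k.
Proof.
case: chg => -[_ _ _ _ PE] _ _ im; have := PE => /setP/(_ (fpos L' i)).
by rewrite inE => E; apply/eqP; rewrite E; apply/fsegP; exists i.
Qed.

Lemma chain_level_le i : i <= m.+1 -> g (fpos L' i) <= k.
Proof.
case: chg => -[_ _ LS RS _] _ _; case: i => [_|i]; first by move: LS; rewrite inE => /ltnW.
rewrite leq_eqVlt => /orP[/eqP->|im]; first by move: RS; rewrite inE => /ltnW.
by rewrite chain_level.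
Qed.

Lemma chain_neqz i : 0 < i <= m -> fpos L' i != z.
Proof. by move=> im; rewrite -g_gt0 chain_level. Qed.

Lemma chain_neqt i : 0 < i <= m -> fpos L' i != t.
Proof.
case: chg => -[m1 mL _ _ _] _ _ im; apply/negP => /eqP it.
have tz : t != z by rewrite eq_sym zt_neq.
have kt : k = g t by rewrite -it chain_level.
have [_ _ + _] := group_of tz; rewrite inE eqxx => /(_ isT)[tE _].
have two j : 0 < j <= m -> fpos L' j = t.
  by move=> jm; apply/set1P; rewrite -tE inE chain_level // kt.
have := fpos_inj pg tc (leq_ltn_trans (ltnW m1) mL) (leq_ltn_trans m1 mL).
by rewrite (two 1) ?(two 2) ?(ltnW m1) // => /(_ erefl).
Qed.

Lemma chain_base i d : 0 < i <= m -> vert d = fpos L' i ->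
  (~~ upward d) = ((d == al (iter i.-1 ph L')) || (d == iter i ph L')).
Proof.
case: (chg) => -[m1 mL LS RS PE] xS base im dx.
rewrite upE ?dx ?chain_neqz ?chain_neqt // -leqNgt chain_level //.
have /andP[i0 im'] := im; apply/idP/orP => [hk|[/eqP->|/eqP->]].
- have [] := base i d im dx; last 2 first.
  + by move=> ->; right.
  + by move=> ->; left.
  by move: hk; rewrite leq_eqVlt !inE => /orP[->|->]; rewrite ?orbT.
- by rewrite (alK pg); apply: (@chain_level_le i.-1); rewrite (leq_trans (leq_pred _)) // ltnW.
by rewrite -(vert_ph pg); apply: (@chain_level_le i.+1); rewrite ltnS.
Qed.

Lemma chain_si i : 0 < i -> si (al (iter i.-1 ph L')) = iter i ph L'.
Proof. by case: i. Qed.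

Lemma chain_vert1 i : 0 < i -> vert (al (iter i.-1 ph L')) = fpos L' i.
Proof. by move=> i0; rewrite -si_vert chain_si. Qed.

Lemma chain_ups i : 0 < i <= m -> let b1 := al (iter i.-1 ph L') in let b2 := iter i ph L' in
  [/\ ~~ upward b1, ~~ upward b2, upward (isi b1), upward (si b2) & b1 != b2].
Proof.
move=> im b1 b2; have /andP[i0 im'] := im.
have b12 : si b1 = b2 by apply: chain_si.
have v1 : vert b1 = fpos L' i by apply: chain_vert1.
have v2 : vert b2 = fpos L' i by [].
have nb1 : ~~ upward b1 by rewrite (chain_base im) ?eqxx.
have nb2 : ~~ upward b2 by rewrite (chain_base im) ?eqxx ?orbT.
have [u uv uu] := exists_up (chain_neqz im).
have far d : fconnect si b1 d -> (si b2 == b1) -> d = b1 \/ d = b2.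
  move/iter_findex <- => /eqP E; elim: (findex _ _ _) => [|j [] IH] /=; first by left.
    by rewrite IH; right.
  by rewrite IH; left.
have uE d : vert d = fpos L' i -> ~~ upward d -> d = b1 \/ d = b2.
  by move=> dv; rewrite (chain_base im dv) => /orP[] /eqP; [left | right].
have noorb : si b2 != b1.
  apply/negP => E; have : fconnect si b1 u by rewrite -(vertE pg) v1 uv.
  by move/far => /(_ E)[] ue; move: uu; rewrite ue ?(negbTE nb1) ?(negbTE nb2).
have b1b2 : b1 != b2.
  by apply: contraNneq noorb => E; rewrite -{1}E b12 E.
split=> //.
  apply: contraT => /uE; rewrite isi_vert => /(_ v1)[] E.
    by move: b1b2; rewrite -b12 -[X in si X]E (f_finv siI) eqxx.
  by move: noorb; rewrite -E (f_finv siI) eqxx.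
apply: contraT => /uE; rewrite si_vert => /(_ v2)[] E; first by rewrite E eqxx in noorb.
by move: b1b2; rewrite -(inj_eq siI) b12 E eqxx.
Qed.

End ChainDarts.

Lemma group_kind v : v != z ->
  [set u | g u == g v] = [set v] \/
  exists L' m i, [/\ chain_group al si vert [set u | g u < g v] [set u | g u == g v] L' m,
    0 < i <= m, v = fpos L' i & fpos L' m.+1 != vert L' \/ vert L' = z].
Proof.
move=> vz; have vP : v \in [set u | g u == g v] by rewrite inE.
have [_ _ _ [[x [PE _ _]]|[L' [m [ch ends]]]]] := group_of vz.
  by left; rewrite PE; move: vP; rewrite PE => /set1P ->.
have [[_ _ _ _ PE] _ _] := ch.
have /fsegP[i im vi] : v \in fseg L' 1 m by rewrite -PE.
by right; exists L', m, i.
Qed.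

Lemma single_split v : v != z -> [set u | g u == g v] = [set v] ->
  exists M N, [/\ conn e M, conn e N, M :|: N = ~: [set v], [disjoint M & N]
    & forall d, vert d = v -> upward d = (hd d \in M)].
Proof.
move=> vz PE; have [vt|vt] := eqVneq v t.
  exists [set z], (~: [set z; t]); split.
  - exact: conn1.
  - exact: conn_delete2.
  - apply/setP => u; rewrite !inE negb_or vt.
    by have [->|] := eqVneq u z; rewrite ?zt_neq.
  - by rewrite disjoints1 !inE eqxx.
  by move=> d dv; rewrite up_top ?inE ?dv.
have [[cS _ cSP] _ _ _] := group_of vz; rewrite PE in cSP.
exists (~: ([set u | g u < g v] :|: [set v])), [set u | g u < g v]; split=> //.
- apply/setP => u; rewrite !inE negb_or -leqNgt.
  have [->|_] := eqVneq u v; first by rewrite andbF ltnn.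
  by rewrite andbT; case: leqP.
- by rewrite disjoint_sym disjoints_subset setCK subsetUl.
move=> d dv; rewrite upE ?dv // !inE negb_or -leqNgt ltn_neqAle eq_sym andbC; congr (_ && _).
by have /setP/(_ (hd d)) := PE; rewrite !inE => ->.
Qed.

Lemma two_base v : v != z -> [set u | g u == g v] = [set v] ->
  exists d d', [/\ vert d = v, vert d' = v, ~~ upward d, ~~ upward d' & d != d'].
Proof.
move=> vz PE; have [vt|vt] := eqVneq v t.
  have zv : z != v by rewrite eq_sym.
  have [a [va az _]] := third_neighbour tc zv zv.
  have av : a != v by rewrite eq_sym (adj_neq pg va).
  have [b [vb bz ba]] := third_neighbour tc zv av.
  case/adjP: va => d dv da; case/adjP: vb => d' d'v d'b.
  exists d, d'; rewrite !up_top ?dv ?d'v // da d'b az bz; split=> //.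
  by apply: contraNneq ba => dd'; rewrite -d'b -dd' da.
have [_ _ _ grp] := group_of vz; case: grp => [[x [PE' _ [a [b [aS bS ab xa xb]]]]]|].
  have xv : x = v by apply/esym/set1P; rewrite -PE' inE.
  rewrite xv in xa xb; case/adjP: xa => d dv da; case/adjP: xb => d' d'v d'b.
  rewrite !inE in aS bS; exists d, d'; rewrite !upE ?dv ?d'v // da d'b -!leqNgt (ltnW aS) (ltnW bS); split=> //.
  by apply: contraNneq ab => dd'; rewrite -da dd' d'b.
case=> L' [m [ch _]]; have [[m1 mL _ _ _] _ _] := ch.
have lev j : 0 < j <= m -> fpos L' j = v.
  by move=> jm; apply/set1P; rewrite -PE inE (chain_level ch jm).
have := fpos_inj pg tc (leq_ltn_trans (ltnW m1) mL) (leq_ltn_trans m1 mL).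
by rewrite (lev 1) ?(lev 2) ?(ltnW m1) // => /(_ erefl).
Qed.

Lemma exists_base v : v != z -> exists2 d, vert d = v & ~~ upward d.
Proof.
move=> vz; have [PE|[L' [m [i [ch im -> _]]]]] := group_kind vz.
  by have [d [_ [dv _ du _ _]]] := two_base vz PE; exists d.
have v0 : 0 < g v by rewrite g_gt0.
have [b1u b2u _ _ _] := chain_ups ch v0 im.
by exists (iter i ph L').
Qed.

(** At a single vertex an isolated lower edge would be the only one, by [turns_isolated], against
    [two_base]; at a chain vertex the two lower edges are consecutive. *)
Lemma base_not_isolated d : vert d != z -> ~~ upward d -> upward (isi d) -> ~~ upward (si d).
Proof.
move=> dz du id; have [PE|[L' [m [i [ch im vi _]]]]] := group_kind dz.
  have [M [N [cM cN MN dMN upM]]] := single_split dz PE.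
  have [a [b [av bv au bu ab]]] := two_base dz PE; apply: contraTN ab => sd; rewrite negbK.
  have iso d' : vert d' = vert d -> ~~ upward d' -> d' = d.
    move=> d'd; rewrite upM // => d'u.
    apply: (turns_isolated pg tc cM cN MN dMN) => //.
    - by rewrite -upM.
    - by rewrite -upM // si_vert.
    - by rewrite -upM // isi_vert.
  by rewrite (iso a av au) (iso b bv bu).
have v0 : 0 < g (vert d) by rewrite g_gt0.
have [b1u b2u ib1 sb2 _] := chain_ups ch v0 im; have /andP[i0 _] := im.
move: du; rewrite (chain_base ch v0 im vi) => /orP[/eqP ->|/eqP dE]; first by rewrite chain_si.
by move: id b1u; rewrite dE -(chain_si L' i0) (finv_f siI) => ->.
Qed.

Lemma up_step_neq d : upward d -> si d != d.
Proof.
move=> du; have dz : vert d != z by case/andP: du.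
have [u uv uu] := exists_base dz; apply: contraNneq uu => E.
have : fconnect si d u by rewrite -(vertE pg) uv.
move/iter_findex <-; have -> // : forall j, iter j si d = d.
by elim=> //= j ->.
Qed.

Lemma same_head d d' : vert d = vert d' -> hd d = hd d' -> d = d'.
Proof. exact: simple_map pg d d'. Qed.

(* Otherwise the face between the two edges would enter some final segment of the ordering twice. *)
Lemma consecutive_ups d : upward d -> upward (si d) -> upward (isi (al d)) || upward (ph (si d)).
Proof.
move=> du sdu; have xz : vert d != z by case/andP: du.
have xt : vert d != t.
  apply/negP => /eqP dt; case/eqP: (up_step_neq du).
  by apply: same_head; rewrite ?si_vert //; move: du sdu; rewrite !up_top ?si_vert // => /eqP-> /eqP.
have dy : g (vert d) < g (hd d) by rewrite -upE.
have dy' : g (vert d) < g (hd (si d)) by rewrite -[vert d]si_vert -upE ?si_vert.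
have yz : hd d != z by rewrite -g_gt0 (leq_ltn_trans _ dy).
have y'z : hd (si d) != z by rewrite -g_gt0 (leq_ltn_trans _ dy').
have yy' : hd d != hd (si d).
  by apply: contraNneq (up_step_neq du) => E; apply/eqP/same_head; rewrite ?si_vert.
have fs : face_of al si (si d) = face_of al si (al d).
  by rewrite -[in LHS](alK pg d); apply: face_ph pg (al d).
rewrite -[_ || _]negbK negb_or; apply/negP => /andP[nu1 nu2].
(* The cut is taken just before the lower of the two heads, so that both heads are on its later side
   and the face can cross it only once in each direction. *)
have [yley'|y'lty] := leqP (g (hd d)) (g (hd (si d))).
  have [[cS cU _] _ _ _] := group_of yz; set S := [set u | _] in cS cU.
  have xS : vert d \in S by rewrite inE.
  have yS : hd d \notin S by rewrite inE ltnn.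
  have y'S : hd (si d) \notin S by rewrite inE -leqNgt.
  set e1 := isi (al d) in nu1; have se1 : si e1 = al d by apply: f_finv.
  have v1 : vert e1 = hd d by rewrite isi_vert.
  have f1 : face_of al si (al e1) = face_of al si (al d).
    by rewrite -(face_ph pg (al e1)) /face_perm (alK pg) se1.
  have wS : hd e1 \notin S.
    apply/negP => wS; have E : al e1 = si d.
      by apply: (bond_face pg cS cU); rewrite ?f1 ?fs ?(alK pg) ?si_vert ?v1.
    by case/eqP: yy'; rewrite -v1 -E (alK pg).
  have e1g : g (hd e1) = g (hd d).
    apply/eqP; rewrite eqn_leq; move: wS; rewrite inE -leqNgt => wS; rewrite wS andbT.
    have wz : hd e1 != z by rewrite -g_gt0 (leq_trans _ wS) // g_gt0.
    by rewrite leqNgt -v1; apply: contra nu1 => lt; rewrite /upward v1 yz wz -{1}v1 lt.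
  have [PE|[L' [m [i [ch im yi ends]]]]] := group_kind yz.
    have : hd e1 \in [set hd d] by rewrite -PE inE e1g.
    by rewrite -v1 => /set1P E; have := vert_al pg e1; rewrite E eqxx.
  have k0 : 0 < g (hd d) by rewrite g_gt0.
  have [b1u b2u ib1 sb2 b12] := chain_ups ch k0 im; have /andP[i0 im'] := im.
  have adu : ~~ upward (al d) by rewrite /upward (alK pg) yz (negbTE xz) /= andbF orbF -leqNgt (ltnW dy).
  have := chain_base ch k0 im yi; rewrite adu => /esym/orP[/eqP adE|/eqP adE].
    by move: nu1; rewrite /e1 adE ib1.
  have mE : i = m.
    apply/eqP; rewrite eqn_leq im' leqNgt; apply/negP => im1.
    have := @chain_level _ _ _ ch i.+1 im1; rewrite /face_pos /= (vert_ph pg) -adE (alK pg) => E.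
    by rewrite E ltnn in dy.
  have [[_ _ LS RS _] xSi _] := ch.
  have LE : L' = si d.
    apply: (bond_face pg cS cU); rewrite ?fs ?si_vert // ?adE ?(face_iter pg) //.
    by have := xSi 1; rewrite /face_pos /= (vert_ph pg); apply; rewrite (leq_trans i0) // -mE.
  have xE : vert d = fpos L' m.+1 by rewrite /face_pos /= (vert_ph pg) -mE -adE (alK pg).
  case: ends => [/eqP|] []; first by rewrite -xE LE si_vert.
  by rewrite LE si_vert => E; rewrite E eqxx in xz.
have y'y := ltnW y'lty.
have [[cS cU _] _ _ _] := group_of y'z; set S := [set u | _] in cS cU.
have cCU : conn e (~: (~: S)) by rewrite setCK.
have xS : vert d \in S by rewrite inE.
have yS : hd d \notin S by rewrite inE -leqNgt.
have y'S : hd (si d) \notin S by rewrite inE ltnn.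
set e2 := ph (si d) in nu2; have v2 : vert e2 = hd (si d) by apply: vert_ph pg _.
have f2 : face_of al si e2 = face_of al si (al d) by rewrite (face_ph pg).
have wS : hd e2 \notin S.
  apply/negP => wS; have E : e2 = al d.
    by apply: (bond_face pg cU cCU); rewrite ?f2 // ?v2 ?(alK pg) !in_setC ?negbK.
  by case/eqP: yy'; rewrite -v2 -E.
have e2g : g (hd e2) = g (hd (si d)).
  apply/eqP; rewrite eqn_leq; move: wS; rewrite inE -leqNgt => wS; rewrite wS andbT.
  have wz : hd e2 != z by rewrite -g_gt0 (leq_trans _ wS) // g_gt0.
  by rewrite leqNgt -v2; apply: contra nu2 => lt; rewrite /upward v2 y'z wz -{1}v2 lt.
have [PE|[L' [m [i [ch im yi ends]]]]] := group_kind y'z.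
  have : hd e2 \in [set hd (si d)] by rewrite -PE inE e2g.
  by rewrite -v2 => /set1P E; have := vert_al pg e2; rewrite E eqxx.
have k0 : 0 < g (hd (si d)) by rewrite g_gt0.
have [b1u b2u ib1 sb2 b12] := chain_ups ch k0 im; have /andP[i0 im'] := im.
have adu : ~~ upward (al (si d)).
  by rewrite /upward (alK pg) si_vert y'z (negbTE xz) /= andbF orbF -leqNgt (ltnW dy').
have := chain_base ch k0 im yi; rewrite adu => /esym/orP[/eqP adE|/eqP adE]; last first.
  by move: nu2; rewrite /e2 /face_perm adE sb2.
have sdE : si d = iter i.-1 ph L' by rewrite -[si d](alK pg) adE (alK pg).
have i1 : i = 1.
  apply/eqP; rewrite eqn_leq i0 andbT leqNgt; apply/negP => i1.
  have := @chain_level _ _ _ ch i.-1; rewrite /face_pos -sdE si_vert => E.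
  by rewrite E ?ltnn // in dy'; rewrite (leq_trans (leq_pred _)) // andbT -ltnS prednK.
rewrite i1 /= in sdE; have [[_ _ LS RS _] xSi _] := ch.
have mm : 0 < m <= m by rewrite leqnn (leq_trans i0).
have LE : iter m ph L' = al d.
  apply: (bond_face pg cU cCU).
  - by rewrite (face_iter pg) -sdE.
  - by rewrite in_setC; apply: xSi.
  - by rewrite in_setC negbK -(vert_ph pg).
  - by rewrite in_setC.
  - by rewrite in_setC negbK (alK pg).
have xE : vert d = fpos L' m.+1 by rewrite /face_pos /= (vert_ph pg) LE (alK pg).
case: ends => [/eqP|] []; first by rewrite -xE -sdE si_vert.
by rewrite -sdE si_vert => E; rewrite E eqxx in xz.
Qed.

Definition hor d := (vert d != z) && (g (vert d) == g (hd d)).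

(* [d] joins a chain vertex to the next one. *)
Definition rightward d :=
  [&& upward (si d), ~~ upward (isi d), upward (isi (al d)), ~~ upward (si (al d)), upward (isi (isi d))
    & upward (si (si (al d)))].

Lemma hor_rightward d : hor d -> rightward d || rightward (al d).
Proof.
case/andP => dz /eqP dg; have [PE|[L' [m [i [ch im di _]]]]] := group_kind dz.
  have : hd d \in [set vert d] by rewrite -PE inE dg.
  by move/set1P => E; have := vert_al pg d; rewrite E eqxx.
have k0 : 0 < g (vert d) by rewrite g_gt0.
have right j : 0 < j -> j < m -> rightward (iter j ph L').
  move=> j0 jm; have jr : 0 < j <= m by rewrite j0 ltnW.
  have [b1u b2u ib1 sb2 b12] := chain_ups ch k0 jr.
  have [b1u' b2u' ib1' sb2' b12'] := @chain_ups _ _ _ ch k0 j.+1 jm.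
  have ii : isi (iter j ph L') = al (iter j.-1 ph L') by rewrite -(chain_si L' j0) (finv_f siI).
  have ss : si (al (iter j ph L')) = iter j.+1 ph L' by [].
  by rewrite /rightward ii ss sb2 b1u ib1 ib1' b2u' sb2'.
have du : ~~ upward d.
  have [dt|dt] := eqVneq (vert d) t; last by rewrite upE // dg ltnn.
  by case/eqP: (chain_neqt ch im); rewrite -di.
have [[_ _ LS RS _] _ _] := ch; rewrite !inE in LS RS.
have /andP[i0 im'] := im.
move: du; rewrite (chain_base ch k0 im di) => /orP[/eqP dE|/eqP dE].
  have i1 : 0 < i.-1.
    rewrite lt0n; apply/negP => /eqP i1; move: LS; rewrite dg dE i1 /= (alK pg) ltnn //.
  by rewrite dE (alK pg) right ?orbT // -ltnS prednK.
have im1 : i < m.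
  rewrite ltn_neqAle im' andbT; apply/negP => /eqP E; move: RS.
  by rewrite /face_pos /= (vert_ph pg) -E -dE dg ltnn.
by rewrite dE right.
Qed.

End Local.

(* The possible labels around an edge; the last six are the first six seen from the other end. *)
Definition quads : seq (nat * nat * nat * nat) :=
  [:: (1,3,2,2); (1,3,2,1); (3,2,1,1); (3,2,2,1); (3,3,2,1); (3,2,1,3);
      (2,2,1,3); (2,1,1,3); (1,1,3,2); (2,1,3,2); (2,1,3,3); (1,3,3,2)].

Definition up_quads : seq (nat * nat * nat * nat) :=
  [:: (2,2,1,3); (2,1,1,3); (1,1,3,2); (2,1,3,2); (2,1,3,3)].

Section Orbits.
Variables (D : finType) (p : D -> D).

Lemma orbit_step (q : pred D) x y : fconnect p y x -> q x -> ~~ q y ->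
  exists w, [/\ fconnect p y w, ~~ q w & q (p w)].
Proof.
move/iter_findex <-; elim: (findex p y x) => [/= ->//|j IH] /= qj qy.
have [qj'|qj'] := boolP (q (iter j p y)); first exact: IH.
by exists (iter j p y); split=> //; apply: fconnect_iter.
Qed.

(** If [a] is never left, it does not occur, since [f] is not constant. Then the label before [a] in
    the cyclic order cannot be left either, and only one label would remain. *)
Lemma orbit_three (f : D -> nat) (nx : nat -> nat) x : injective p ->
    (forall a, 0 < a <= 3 -> nx (nx (nx a)) = a /\
       forall b, 0 < b <= 3 -> [\/ b = a, b = nx a | b = nx (nx a)]) ->
    (forall w, fconnect p x w -> 0 < f w <= 3) ->
    (forall w, fconnect p x w -> f (p w) = f w \/ f (p w) = nx (f w)) ->
    (exists2 w, fconnect p x w & f w != f x) ->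
  forall a, 0 < a <= 3 -> exists w, [/\ fconnect p x w, f w = a & f (p w) != a].
Proof.
move=> pI nx3 fr fs [y xy fyx] a a3.
have all_or_none c : (forall w, fconnect p x w -> f w = c -> f (p w) = c) ->
    forall w, fconnect p x w -> f w != c.
  move=> cl w xw; apply: contra fyx => /eqP fw.
  have all u : fconnect p x u -> f u = c.
    move=> xu; have wu : fconnect p w u by apply: connect_trans xu; rewrite fconnect_sym.
    move/iter_findex: wu <-; elim: (findex p w u) => // j IH /=; apply: cl => //.
    by apply: connect_trans xw _; apply: fconnect_iter.
  by rewrite !all // connect0.
have [/existsP[w /and3P[xw /eqP fw fpw]]|no] := boolP [exists w, [&& fconnect p x w, f w == a & f (p w) != a]].
  by exists w.
have cla w : fconnect p x w -> f w = a -> f (p w) = a.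
  move=> xw fw; apply/eqP; apply: contraNT no => fpw; apply/existsP; exists w.
  by rewrite xw fw eqxx.
have na := all_or_none a cla; have [na3 nb] := nx3 a a3.
have pw w : fconnect p x w -> fconnect p x (p w).
  by move=> xw; apply: connect_trans xw (fconnect1 _ _).
have ncl w : fconnect p x w -> f w = nx (nx a) -> f (p w) = nx (nx a).
  move=> xw fw; have [->//|] := fs w xw; rewrite fw na3 => fpw.
  by have := na _ (pw _ xw); rewrite fpw eqxx.
have nc := all_or_none _ ncl.
have fb w : fconnect p x w -> f w = nx a.
  move=> xw; have [fw|//|fw] := nb _ (fr _ xw); first by have := na _ xw; rewrite fw eqxx.
  by have := nc _ xw; rewrite fw eqxx.
by move: fyx; rewrite !fb ?eqxx // connect0.
Qed.

Lemma orbit_no_descent (f : D -> nat) x : injective p ->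
  (forall w, fconnect p x w -> f (p w) < f w) -> False.
Proof.
move=> pI desc; have H j : f (iter j p x) + j <= f x.
  elim: j => [|j IH] /=; first by rewrite addn0.
  by apply: leq_trans IH; rewrite addnS ltn_add2r; apply/desc/fconnect_iter.
have := H (order p x); rewrite iter_order // -[X in _ <= X]addn0 leq_add2l leqNgt.
by rewrite order_gt0.
Qed.

End Orbits.

(** * Labels around edges, vertices and faces *)

Section Labels.
Variables (V D : finType) (al si : D -> D) (vert : D -> V).
Hypothesis pg : plane_graph al si vert.
Local Notation ph := (face_perm al si).
Local Notation e := (adj al vert).
Local Notation hd d := (vert (al d)).
Local Notation fseg := (face_seg al si vert).
Local Notation isi := (finv si).
Hypothesis tc : three_connected e.
Variable L : D.
Hypothesis L3 : order si L = 3.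
Local Notation z := (vert L).
Local Notation t := (hd (si L)).
Variable g : V -> nat.
Hypothesis glev : levels_from al si vert z t [set z] g.
Hypothesis glev1 : [set v | g v == 1] = fseg L 1 (order ph L).-1.
Let siI : injective si := si_inj pg.
Let phI : injective ph := face_perm_inj pg.
Local Notation up := (upward al si vert L g).

(* The label of the corner between [isi d] and [d]. As in a Schnyder wood each label occupies an
   interval around a vertex, and the label 3 is on the side of the earlier groups. *)
Definition corner_label d : nat :=
  if vert d == z then 0
  else if up (isi d) then if up d then if up (ph d) then 1 else 2 else 1
  else if up d then 2 else 3.

(** The corners before and after the edge at its tail, then before and after it at its head. *)
Definition edge_labels d := (corner_label d, corner_label (si d), corner_label (al d), corner_label (ph d)).

Lemma lam_eq0 d : (corner_label d == 0) = (vert d == z).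
Proof. by rewrite /corner_label; case: (vert d == z) => //; case: (up _); case: (up d) => //; case: (up _). Qed.

Lemma quad_al d : edge_labels (al d) = let: (a, b, c, d) := edge_labels d in (c, d, a, b).
Proof. by rewrite /edge_labels /face_perm (alK pg). Qed.

Let swap4 (q : nat * nat * nat * nat) := let: (a, b, c, d) := q in (c, d, a, b).

Lemma quads_swap q : (swap4 q \in quads) = (q \in quads).
Proof.
have sub q' : q' \in quads -> swap4 q' \in quads.
  by rewrite /quads !inE; do ![case/orP]=> /eqP->.
apply/idP/idP; last exact: sub.
by move/sub; case: q => [[[a b] c] d].
Qed.

(** [base_not_isolated] at the head and [consecutive_ups] at the tail exclude all other
    combinations. *)
Lemma quad_up d : up d -> hd d != z -> edge_labels d \in up_quads.
Proof.
move=> du hz; have dz : vert d != z by case/andP: du.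
have adu : ~~ up (al d).
  have := up_gt du hz; rewrite /upward (alK pg) hz (negbTE dz) /= andbF orbF.
  by rewrite -leqNgt => /ltnW.
have sz : vert (si d) != z by rewrite (vert_si pg).
have phz : vert (ph d) != z by rewrite (vert_ph pg).
have iphE : isi (ph d) = al d by rewrite /face_perm (finv_f siI).
have isE : isi (si d) = d by rewrite (finv_f siI).
have B := base_not_isolated pg tc glev hz adu; rewrite -/(ph d) in B.
have U2 := consecutive_ups pg tc glev du.
rewrite /edge_labels /corner_label (negbTE dz) (negbTE sz) (negbTE hz) (negbTE phz) isE iphE du (negbTE adu).
case: (up (isi (al d))) B U2 => [/(_ isT)/negbTE-> _|_ U2].
  by case: (up (si d)); case: (up (isi d)) => //; case: (up (ph (si d))).
have -> : (if up (si d) then if up (ph (si d)) then 1 else 2 else 1) = 1.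
  by case: (up (si d)) U2 => // /(_ isT) /= ->.
by case: (up (ph d)); case: (up (isi d)).
Qed.

Lemma quad_right d : vert d != z -> hd d != z -> ~~ up d -> ~~ up (al d) ->
  rightward al si vert L g d -> edge_labels d = (3, 2, 1, 3).
Proof.
move=> dz hz du adu /and5P[r1 r2 r3 r4 _].
have sz : vert (si d) != z by rewrite (vert_si pg).
have phz : vert (ph d) != z by rewrite (vert_ph pg).
rewrite /edge_labels /corner_label (negbTE dz) (negbTE sz) (negbTE hz) (negbTE phz).
by rewrite /face_perm !(finv_f siI) r1 (negbTE r2) r3 (negbTE r4) (negbTE du) (negbTE adu).
Qed.

Lemma base_down_or_hor d : vert d != z -> hd d != z -> ~~ up d -> up (al d) || hor al vert L g d.
Proof.
move=> dz hz; rewrite /upward /hor (alK pg) (negbTE dz) (negbTE hz) /= !andbF !orbF -leqNgt.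
by move=> h; rewrite orbC [g (vert d) == _]eq_sym -leq_eqVlt.
Qed.

Lemma quad_in d : vert d != z -> hd d != z -> edge_labels d \in quads.
Proof.
move=> dz hz; have uq q : q \in up_quads -> q \in quads by rewrite !inE; do ![case/orP]=> /eqP->.
have [du|du] := boolP (up d); first by apply/uq/quad_up.
have [adu|adu] := boolP (up (al d)).
  by rewrite -quads_swap -[swap4 _]quad_al uq // quad_up // (alK pg).
have := base_down_or_hor dz hz du; rewrite (negbTE adu) /= => /(hor_rightward pg tc glev).
case/orP => r; first by rewrite quad_right.
by rewrite -quads_swap -[swap4 _]quad_al quad_right // (alK pg).
Qed.

(* The three edges at the apex: the left leg of the first group, its right leg, and the edge above
   the last vertex. *)
Lemma apex_lam d : vert d != z -> hd d = z ->
  [\/ corner_label d = 1 /\ corner_label (si d) = 3, corner_label d = 3 /\ corner_label (si d) = 2 | corner_label d = 2 /\ corner_label (si d) = 1].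
Proof.
move=> dz hz; have ch := first_group pg tc L3.
have E0 : [set u | g u < 1] = [set z].
  by apply/setP => u; rewrite !inE ltnS leqn0 (g_eq0 glev).
rewrite -E0 -glev1 in ch.
have [[m1 mL _ _ _] _ _] := ch; set m := (order ph L).-1 in ch m1 mL.
have m0 : 0 < m by apply: ltnW.
have sz : vert (si d) != z by rewrite (vert_si pg).
have [adE|adE|adE] := apex_darts pg L3 hz.
- have [|b1u b2u ib1 sb2 _] := @chain_ups _ _ _ _ _ pg tc L g glev 1 L m ch isT 1; first by rewrite m0.
  have dE : d = al L by rewrite -[d](alK pg) adE.
  apply: Or31; rewrite /corner_label (negbTE dz) (negbTE sz) (finv_f siI) dE.
  by move: b1u b2u ib1 sb2; rewrite /= -/(ph L) => /negbTE-> /negbTE b2 -> _; rewrite /face_perm in b2; rewrite b2.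
- have dt : vert d = t by rewrite -adE (alK pg).
  have du : up d by rewrite (up_top pg glev dt) hz.
  have alone d' : vert d' = t -> d' != d -> ~~ up d'.
    move=> d't; apply: contra => u; apply/eqP/(simple_map pg); first by rewrite d't.
    by rewrite hz; apply/eqP; rewrite -(up_top pg glev d't).
  have ndsi := up_step_neq pg tc glev du.
  have nsi : ~~ up (si d) by apply: alone; rewrite ?(vert_si pg).
  have nis : ~~ up (isi d).
    apply: alone; rewrite ?(isi_vert pg) //; apply: contra ndsi => /eqP E.
    by rewrite -{1}E (f_finv siI).
  apply: Or33; rewrite /corner_label (negbTE dz) (negbTE sz) (finv_f siI) du (negbTE nsi) (negbTE nis).
  by [].
have [|b1u b2u ib1 sb2 _] := @chain_ups _ _ _ _ _ pg tc L g glev 1 L m ch isT m; first by rewrite m0 /=.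
have [_ _ E] := face_prev pg L.
have dE : d = iter m ph L by rewrite -[d](alK pg) adE -E (alK pg).
apply: Or32; rewrite /corner_label (negbTE dz) (negbTE sz) (finv_f siI) dE.
have -> : isi (iter m ph L) = al (iter m.-1 ph L) by rewrite -(chain_si al si L m0) (finv_f siI).
by rewrite (negbTE b1u) (negbTE b2u) sb2.
Qed.

(* The cyclic orders of the labels around a vertex and around a face. *)
Definition nxS a := if a == 3 then 2 else if a == 2 then 1 else 3.
Definition nxF a := if a == 3 then 1 else if a == 1 then 2 else 3.

Lemma three_cases a : 0 < a <= 3 -> [\/ a = 1, a = 2 | a = 3].
Proof. by case: a => [|[|[|[|a]]]] // _; [apply: Or31 | apply: Or32 | apply: Or33]. Qed.

Lemma nxS3 a : 0 < a <= 3 -> nxS (nxS (nxS a)) = a /\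
  forall b, 0 < b <= 3 -> [\/ b = a, b = nxS a | b = nxS (nxS a)].
Proof.
by case/three_cases=> ->; split=> // b /three_cases[] ->; (by apply: Or31) || (by apply: Or32) || apply: Or33.
Qed.

Lemma nxF3 a : 0 < a <= 3 -> nxF (nxF (nxF a)) = a /\
  forall b, 0 < b <= 3 -> [\/ b = a, b = nxF a | b = nxF (nxF a)].
Proof.
by case/three_cases=> ->; split=> // b /three_cases[] ->; (by apply: Or31) || (by apply: Or32) || apply: Or33.
Qed.

Lemma lam_le3 d : corner_label d <= 3.
Proof. by rewrite /corner_label; case: (_ == z) => //; case: (up _); case: (up d) => //; case: (up _). Qed.

Lemma lam_range d : vert d != z -> 0 < corner_label d <= 3.
Proof. by move=> dz; rewrite lam_le3 lt0n lam_eq0 dz. Qed.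

(** Read off the table [quads]. That every edge sees exactly three changes, counted around its ends
    and along its two sides, is what makes the later count tight. *)
Lemma quadsP d : vert d != z -> hd d != z ->
  [/\ corner_label (si d) = corner_label d \/ corner_label (si d) = nxS (corner_label d), corner_label (ph d) = corner_label d \/ corner_label (ph d) = nxF (corner_label d)
    & (corner_label d != corner_label (si d)) + (corner_label (al d) != corner_label (ph d)) +
      ((corner_label d != corner_label (ph d)) + (corner_label (al d) != corner_label (si d))) = 3].
Proof.
move=> dz hz; have := quad_in dz hz; rewrite /edge_labels /quads !inE.
by do ![case/orP]=> /eqP[-> -> -> ->]; split=> //; by [left | right].
Qed.

Lemma lam_si d : vert d != z -> corner_label (si d) = corner_label d \/ corner_label (si d) = nxS (corner_label d).
Proof.
move=> dz; have [hz|hz] := eqVneq (hd d) z; last by case: (quadsP dz hz).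
by have [[-> ->]|[-> ->]|[-> ->]] := apex_lam dz hz; right.
Qed.

(** Having both upper and lower edges, the vertex has a corner labelled 2 and one labelled 1, so
    [orbit_three] applies. *)
Lemma vertex_changes v a : v != z -> 0 < a <= 3 ->
  exists d, [/\ vert d = v, corner_label d = a & corner_label (si d) != a].
Proof.
move=> vz a3; have [u uv uu] := exists_up pg glev vz.
have [b bv bu] := exists_base pg tc glev vz.
have bu' : fconnect si b u by rewrite -(vertE pg) bv uv.
have ub' : fconnect si u b by rewrite -(vertE pg) bv uv.
have inv w : fconnect si u w -> vert w = v by rewrite -(vertE pg) uv => /eqP.
have inv' w : fconnect si b w -> vert w = v by rewrite -(vertE pg) bv => /eqP.
have uu' : ~~ ~~ up u by rewrite negbK.
have [w [/inv' wv nw swap12]] := orbit_step bu' uu bu.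
have [w' [/inv w'v nw' swap12']] := orbit_step (q := fun d => ~~ up d) ub' bu uu'.
have l2 : corner_label (si w) = 2.
  by rewrite /corner_label (vert_si pg) wv (negbTE vz) (finv_f siI) (negbTE nw) swap12.
have l1 : corner_label (si w') = 1.
  by rewrite /corner_label (vert_si pg) w'v (negbTE vz) (finv_f siI) (negbNE nw') (negbTE swap12').
have inw d : fconnect si (si w) d -> vert d = v by rewrite -(vertE pg) (vert_si pg) wv => /eqP.
suff [d [/inw dv da sda]] : exists d, [/\ fconnect si (si w) d, corner_label d = a & corner_label (si d) != a].
  by exists d.
apply: (orbit_three siI nxS3) a3 => [d /inw dv|d /inw dv|].
- by apply: lam_range; rewrite dv.
- by apply: lam_si; rewrite dv.
- exists (si w'); last by rewrite l1 l2.
  by rewrite -(vertE pg) !(vert_si pg) wv w'v.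
Qed.

(** The face below a chain descends at the end of the chain; this excludes a face all of whose
    corners have label 3. *)
Lemma rightward_chain d : hor al vert L g d -> rightward al si vert L g d ->
  exists j, 0 < j /\ g (hd (iter j ph d)) < g (vert (iter j ph d)) /\ vert (iter j ph d) != z.
Proof.
case/andP => dz /eqP dg r; have [PE|[L' [m [i [ch im di _]]]]] := group_kind glev dz.
  have : hd d \in [set vert d] by rewrite -PE inE dg.
  by move/set1P => E; have := vert_al pg d; rewrite E eqxx.
have k0 : 0 < g (vert d) by rewrite (g_gt0 glev).
have [b1u b2u ib1 sb2 b12] := chain_ups pg tc glev ch k0 im; have /andP[i0 im'] := im.
have du : ~~ up d.
  have dt : vert d != t by rewrite di; apply: (chain_neqt pg tc glev ch im).
  by rewrite (upE glev) // dg ltnn.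
have dE : d = iter i ph L'.
  have := chain_base pg tc glev ch k0 im di; rewrite du => /esym/orP[]/eqP dE //.
  by case/and5P: r; rewrite dE (chain_si al si L' i0) (negbTE b2u).
have [[_ _ _ RS _] _ _] := ch; rewrite inE in RS.
have im1 : i < m.
  rewrite ltn_neqAle im' andbT; apply/negP => /eqP E; move: RS.
  by rewrite /face_pos /= (vert_ph pg) -E -dE dg ltnn.
have iE : iter (m - i) ph d = iter m ph L' by rewrite dE -iterD subnK // ltnW.
have mm : 0 < m <= m by rewrite leqnn (leq_trans i0).
exists (m - i); rewrite subn_gt0 im1 iE; split=> //; split.
  by rewrite -[hd _](vert_ph pg) [X in _ < X](chain_level ch mm).
by apply: (chain_neqz glev ch k0 mm).
Qed.

(** Only a constant labelling has to be excluded. With label 2 all edges of the face would go up,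
    with label 1 all down, and with label 3 the face would follow a chain and never descend at its
    end. *)
Lemma face_changes f a : (forall d, fconnect ph f d -> vert d != z) -> 0 < a <= 3 ->
  exists d, [/\ fconnect ph f d, corner_label d = a & corner_label (ph d) != a].
Proof.
move=> fz a3.
have inz w : fconnect ph f w -> hd w != z.
  by move=> fw; rewrite -(vert_ph pg) fz //; apply: connect_trans fw (fconnect1 _ _).
suff [w fw wf] : exists2 w, fconnect ph f w & corner_label w != corner_label f.
  apply: (orbit_three phI nxF3) a3 => [d fd|d fd|]; last by exists w.
    by apply/lam_range/fz.
  by case: (quadsP (fz _ fd) (inz _ fd)).
have [/existsP[w /andP[fw wf]]|const] := boolP [exists w, fconnect ph f w && (corner_label w != corner_label f)].
  by exists w.
have {}const w : fconnect ph f w -> corner_label w = corner_label f.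
  by move=> fw; apply/eqP; apply: contraNT const => wf; apply/existsP; exists w; rewrite fw.
have constp w : fconnect ph f w -> corner_label (ph w) = corner_label w.
  by move=> fw; rewrite !const //; apply: connect_trans fw (fconnect1 _ _).
have vph w : vert (ph w) = hd w := vert_ph pg w.
have hphi w : fconnect ph f w -> hor al vert L g w -> rightward al si vert L g w -> False.
  move=> fw hw rw; have [j [j0 [glt jz]]] := rightward_chain hw rw.
  have fj : fconnect ph f (iter j ph w) by apply: connect_trans fw (fconnect_iter _ _ _).
  have wz := fz _ fw; have wh := inz _ fw; have jh := inz _ fj.
  have adj' : up (al (iter j ph w)).
    by rewrite /upward (alK pg) jh jz glt.
  have l3 : corner_label w = 3.
    have := quad_right wz wh; case/andP: (hw) => _ /eqP hg.
    have wu : ~~ up w by rewrite /upward hg ltnn (negbTE wh) !andbF.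
    have awu : ~~ up (al w) by rewrite /upward (alK pg) -hg ltnn (negbTE wz) !andbF.
    by move=> /(_ wu awu rw); rewrite /edge_labels => -[->].
  have lj : corner_label (iter j ph w) = 3 by rewrite const // -(const _ fw).
  have := constp _ fj; rewrite lj => lj'.
  have := quad_up adj'; rewrite (alK pg) => /(_ jz); rewrite quad_al /edge_labels lj lj' /up_quads.
  by rewrite !inE; do ![case/orP] => /eqP[].
have cases w : fconnect ph f w -> (up w /\ corner_label f = 2) \/ (up (al w) /\ corner_label f = 1).
  move=> fw; have wz := fz _ fw; have wh := inz _ fw; have := constp _ fw; rewrite -(const _ fw) => wc.
  have [uw|uw] := boolP (up w).
    left; split=> //; have := quad_up uw wh; rewrite /edge_labels /up_quads wc.
    by rewrite !inE; do ![case/orP] => /eqP[] // -> // _ _ <-.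
  have [auw|auw] := boolP (up (al w)).
    right; split=> //; have := quad_up auw; rewrite (alK pg) => /(_ wz).
    by rewrite quad_al /edge_labels /up_quads wc !inE; do ![case/orP] => /eqP[] // _ _ -> // _ <-.
  have := base_down_or_hor wz wh uw; rewrite (negbTE auw) /= => hw.
  have /orP[/(hphi _ fw hw)[]|r] := hor_rightward pg tc glev hw.
  have := quad_right wh; rewrite (alK pg) => /(_ wz auw uw r).
  by rewrite quad_al /edge_labels wc => -[_ E1 E2 _]; rewrite E1 in E2.
have gph w : vert w != z -> hd w != z -> up w -> g (vert w) < g (vert (ph w)).
  by move=> wz wh uw; rewrite vph; apply: up_gt uw wh.
case: (cases f (connect0 _ _)) => -[_ lf].
  (* The distance to the maximal level turns the ascent into a descent. *)
  case: (@orbit_no_descent _ _ (fun w => g t - g (vert w)) f phI) => w fw.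
  have [[uw _]|[_]] := cases w fw; last by rewrite lf.
  have := gph w (fz _ fw) (inz _ fw) uw; rewrite vph => lt.
  apply: (ltn_sub2l _ lt); apply: leq_trans lt _; exact: (top_max pg glev).
case: (@orbit_no_descent _ _ (fun w => g (vert w)) f phI) => w fw.
have [[_]|[uw _]] := cases w fw; first by rewrite lf.
by have := up_gt uw; rewrite (alK pg) vph; apply; apply: fz.
Qed.

End Labels.

(** * Uniqueness of label changes by Euler's formula *)

Section Count.
Variables (V D : finType) (al si : D -> D) (vert : D -> V).
Hypothesis pg : plane_graph al si vert.
Local Notation ph := (face_perm al si).
Local Notation e := (adj al vert).
Local Notation face := (face_of al si).
Local Notation hd d := (vert (al d)).
Hypothesis tc : three_connected e.
Variable L : D.
Hypothesis L3 : order si L = 3.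
Local Notation z := (vert L).
Local Notation t := (hd (si L)).
Variable g : V -> nat.
Hypothesis glev : levels_from al si vert z t [set z] g.
Hypothesis glev1 : [set v | g v == 1] = face_seg al si vert L 1 (order ph L).-1.
Local Notation lam := (corner_label al si vert L g).
Let alI : injective al := al_inj pg.

Definition vertex_turn := [set d | (lam d != 0) && (lam d != lam (si d))].
Definition face_turn := [set d | [&& lam d != 0, lam (al d) != 0 & lam d != lam (ph d)]].

Lemma card_at_apex : #|[set d | vert d == z]| = 3.
Proof.
by rewrite -L3 /order; apply: eq_card => d; rewrite inE eq_sym (vertE pg).
Qed.

Lemma sum_al (F : D -> nat) : \sum_d F (al d) = \sum_d F d.
Proof. by rewrite [RHS](reindex_inj alI). Qed.

(** Three changes per edge, counted at both darts, but at most one at an edge of the apex: six darts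
    with two changes missing each give the 12. *)
Lemma turns_le : (#|vertex_turn| + #|face_turn|).*2 + 12 <= 3 * #|D|.
Proof.
pose touch := [set d | (vert d == z) || (hd d == z)].
have t6 : #|touch| = 6.
  have -> : touch = [set d | vert d == z] :|: [set d | hd d == z] by apply/setP => d; rewrite !inE.
  rewrite cardsU card_at_apex.
  have -> : [set d | vert d == z] :&: [set d | hd d == z] = set0.
    apply/setP => d; rewrite !inE; apply/negP => /andP[/eqP dz /eqP hz].
    by have := vert_al pg d; rewrite dz hz eqxx.
  rewrite -(card_imset _ alI) cards0 subn0.
  have -> : [set al x | x in [set d | hd d == z]] = [set d | vert d == z].
    apply/setP => d; rewrite inE; apply/imsetP/eqP => [[c]|dz].
      by rewrite inE => /eqP <- ->.
    by exists (al d); rewrite ?inE (alK pg) ?dz.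
  by rewrite card_at_apex.
pose w d := ((d \in vertex_turn) + (al d \in vertex_turn) + ((d \in face_turn) + (al d \in face_turn)))%N.
have wle d : w d + 2 * (d \in touch) <= 3.
  rewrite /w !inE !(lam_eq0 _ _ _ _ _) (alK pg).
  have [dz|dz] := eqVneq (vert d) z.
    have hz : hd d != z by rewrite -dz (vert_al pg).
    by rewrite (negbTE hz) /=; case: (_ == _).
  have [hz|hz] /= := eqVneq (hd d) z.
    by case: (_ == _).
  have [_ _] := quadsP pg tc glev dz hz.
  rewrite muln0 addn0 /face_perm (alK pg) => E; rewrite -[X in _ <= X]E; lia.
have card_sum (A : {set D}) : #|A| = \sum_d (d \in A).
  by rewrite -sum1_card big_mkcond; apply: eq_bigr => d _; case: (d \in A).
have E : (#|vertex_turn| + #|face_turn|).*2 = \sum_d w d.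
  rewrite /w !big_split /= !(card_sum vertex_turn) !(card_sum face_turn).
  by rewrite (sum_al (fun d => d \in vertex_turn)) (sum_al (fun d => d \in face_turn)) !addnn -doubleD.
rewrite E -[12]/(2 * 6) -t6 (card_sum touch) big_distrr /= -big_split /=.
rewrite mulnC -sum_nat_const; exact: leq_sum.
Qed.

Definition key4 (a : nat) : 'I_4 := inord a.

Lemma key4_pos : #|[set i : 'I_4 | i != ord0]| = 3.
Proof.
rewrite (_ : [set i | _] = ~: [set ord0]); last by apply/setP => i; rewrite !inE.
by rewrite cardsC1 card_ord.
Qed.

Lemma face_card : #|[set face d | d : D]| = fcard ph D.
Proof.
rewrite -(face_count pg) /nclass; congr (#|pred_of_set _|).
by apply: eq_imset => d; rewrite (face_cclass pg).
Qed.

Definition outer_faces := [set face d | d in [set d | vert d == z]].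
Definition inner_faces := [set face d | d : D] :\: outer_faces.

(** Each vertex other than the apex and each of the at least F - 3 faces avoiding it has a change
    from every label. By Euler's formula these already attain the upper bound of [turns_le], so no
    change is repeated and none lies on a face at the apex. *)
Lemma turns_unique :
  [/\ {in vertex_turn &, forall d d', vert d = vert d' -> lam d = lam d' -> d = d'},
      {in face_turn &, forall d d', face d = face d' -> lam d = lam d' -> d = d'}
    & forall d, d \in face_turn -> face d \in inner_faces].
Proof.
pose kS d := (vert d, key4 (lam d)); pose kF d := (face d, key4 (lam d)).
pose pos := [set i : 'I_4 | i != ord0].
have posP i : i \in pos -> 0 < val i <= 3 by rewrite inE => i0; apply/andP; split; [rewrite lt0n | rewrite -ltnS; apply: ltn_ord].
have key_val (i : 'I_4) : key4 (val i) = i by apply: inord_val.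
have imS : setX [set~ z] pos \subset kS @: vertex_turn.
  apply/subsetP => -[v i]; rewrite in_setX => /andP[/= vz /posP i3].
  have {}vz : v != z by move: vz; rewrite !inE.
  have [d [dv di sdi]] := vertex_changes pg tc L3 glev glev1 vz i3.
  apply/imsetP; exists d; last by rewrite /kS dv di key_val.
  by rewrite inE di [_ == lam (si d)]eq_sym sdi andbT -lt0n; case/andP: i3.
have imF : setX inner_faces pos \subset kF @: face_turn.
  apply/subsetP => -[F i]; rewrite in_setX => /andP[/= /setDP[/imsetP[f _ ->] fO] /posP i3].
  have fz d : fconnect ph f d -> vert d != z.
    move=> fd; apply: contra fO => dz; apply/imsetP; exists d; first by rewrite inE.
    by apply/eqP; rewrite (face_eq pg).
  have [d [fd di phi]] := face_changes pg tc glev fz i3.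
  have dfE : face f = face d by apply/eqP; rewrite (face_eq pg).
  apply/imsetP; exists d; last by rewrite /kF -dfE di key_val.
  rewrite inE di [_ == lam (ph d)]eq_sym phi andbT (lam_eq0 al si vert L g) -lt0n; case/andP: i3 => -> _ /=.
  by rewrite -(vert_ph pg) fz //; apply: connect_trans fd (fconnect1 _ _).
have cS : #|setX [set~ z] pos| = (#|V| - 1) * 3 by rewrite cardsX cardsC1 key4_pos subn1.
have cF : #|setX inner_faces pos| = #|inner_faces| * 3 by rewrite cardsX key4_pos.
have cin : fcard ph D - 3 <= #|inner_faces|.
  rewrite -face_card /inner_faces cardsD leq_sub2l //.
  apply: leq_trans (subset_leq_card (subsetIr _ _)) _.
  by rewrite -card_at_apex; apply: leq_imset_card.
have V0 : 0 < #|V| by apply/card_gt0P; exists z.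
have [sS sF] := (subset_leq_card imS, subset_leq_card imF).
have [iS iF] := (leq_imset_card kS vertex_turn, leq_imset_card kF face_turn).
have euler : (#|V| + fcard ph D).*2 = #|D| + 4 by case: pg.
have [eS eF] : #|kS @: vertex_turn| = #|vertex_turn| /\
    #|setX inner_faces pos| = #|face_turn| /\ #|kF @: face_turn| = #|face_turn|.
  have := turns_le; rewrite cS cF in sS sF *.
  move: #|kS @: _| #|kF @: _| #|vertex_turn| #|face_turn| #|inner_faces| (fcard _ _) #|V| #|D| sS sF iS iF cin V0 euler.
  clear => a b c d i f v n; lia.
case: eF => eF1 eF2.
split.
- move=> d d' dT d'T vd ld; have := imset_injP (introT eqP eS); apply=> //.
  by rewrite /kS vd ld.
- move=> d d' dT d'T fd ld; have := imset_injP (introT eqP eF2); apply=> //.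
  by rewrite /kF fd ld.
move=> d dT; have : kF d \in kF @: face_turn by apply: imset_f.
have /eqP <- : setX inner_faces pos == kF @: face_turn by rewrite eqEcard imF eF2 -eF1 leqnn.
by rewrite in_setX => /andP[].
Qed.

End Count.

(** * The degree bound *)

(* Each group keeps its left leg, its right leg, or is attached in the middle: then a single vertex
   keeps only the edge following its left leg, and a chain keeps both legs but not its first edge. *)
Definition mode := option bool.
Definition left : mode := Some true.
Definition right : mode := Some false.
Definition middle : mode := None.
(* Duality exchanges the two legs and the labels 1 and 2. *)
Definition flip (m : mode) : mode := omap negb m.

Definition swap12 (a : nat) := if a == 1 then 2 else if a == 2 then 1 else a.

Section Rules.
Variables (D : finType) (al si ph : D -> D) (lam : D -> nat) (mu : D -> mode).

(* For the rotation this says that the group is a single vertex with more than two edges to earlier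
   groups, for the face permutation that it is a chain. *)
Definition paired k := (lam (si k) == 3) || (lam (finv si k) == 3).

Definition label_quad d := (lam d, lam (si d), lam (al d), lam (ph d)).

(* The choice when the labels allow both legs; the last line depends on the mode of another group. *)
Definition face_rule (l r : D) : mode :=
  if lam (finv ph (al l)) == 2 then left
  else if lam (ph (ph r)) == 1 then right
  else if lam (si (ph r)) == 1 then left
  else if lam (al (ph r)) == 2 then right
  else if mu (si (ph r)) == left then right else left.

End Rules.

(* When both legs carry the label 1 (on the left) and 2 (on the right) at their lower end, the rule
   is the one of the dual map. *)
Definition step_mode (D : finType) (al si ph : D -> D) (lam : D -> nat) (mu : D -> mode) l r : mode :=
  if lam (ph l) == 1 then
    if lam (al r) == 2 then
      if paired ph lam r then middle
      else flip (face_rule al ph si (swap12 \o lam) (flip \o mu) (al l) r)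
    else left
  else
    if lam (al r) == 2 then right
    else if paired si lam r then middle
    else face_rule al si ph lam mu l r.

(** * The bound at one vertex, in a form that can be dualized *)

Section VertexBound.
Variables (D : finType) (al si ph : D -> D) (lam : D -> nat) (mu : D -> mode) (T : {set D}).
Hypotheses (alK : involutive al) (siI : injective si) (phI : injective ph).
Hypothesis phE : forall d, ph d = si (al d).
Local Notation gquad := (label_quad al si ph lam).
Local Notation fan := (paired si lam).
Local Notation chain := (paired ph lam).

Definition inner_edge d := [&& lam d != 0, lam (si d) != 0, lam (al d) != 0 & lam (ph d) != 0].

Hypothesis quad_nz : forall d, inner_edge d -> gquad d \in quads.
Hypothesis uniq_ph : forall d d', fconnect ph d d' -> lam d = lam d' -> lam d != 0 ->
  lam (ph d) != 0 -> lam (ph d') != 0 -> lam (ph d) != lam d -> lam (ph d') != lam d' -> d = d'.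
Hypothesis mu_si : forall d, lam d = 3 -> lam (si d) = 3 -> mu (si d) = mu d.
Hypothesis mu_ph : forall d, lam d = 3 -> lam (ph d) = 3 -> mu (ph d) = mu d.
Hypothesis fan_chain : forall d, lam d = 3 -> ~~ (fan d && chain d).
Hypothesis mu_middle : forall d, lam d = 3 -> mu d = middle -> fan d || chain d.

(** The two quadruples differ in whether the lower end lies inside the interval of label 2 or at its
    change to 1. Only in the first case can several legs compete for the same vertex. *)
Definition is_left_leg d := inner_edge d && (gquad d \in [:: (1,3,2,2); (1,3,2,1)]).
Definition is_right_leg d := inner_edge d && (gquad d \in [:: (3,2,1,1); (3,2,2,1)]).

Hypothesis T_al : forall d, (al d \in T) = (d \in T).
Hypothesis T_left : forall d, is_left_leg d ->
  (d \in T) = (mu (si d) == left) || (mu (si d) == middle) && ~~ fan (si d).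
Hypothesis T_right : forall d, is_right_leg d ->
  (d \in T) = (mu d == right) || (mu d == middle) && ~~ fan d.
Hypothesis T_spoke : forall d, inner_edge d -> gquad d = (3,3,2,1) ->
  (d \in T) = (mu d == middle) && (lam (finv si d) == 1).
(** Label 2 just before [d] on its face marks the first edge of the chain: the preceding dart is
    then the reversed left leg. *)
Hypothesis T_hor : forall d, inner_edge d -> gquad d = (3,2,1,3) ->
  (d \in T) = ~~ ((mu d == middle) && (lam (finv ph d) == 2)).

Definition step l r :=
  [/\ is_left_leg l, is_right_leg r, mu (si l) = mu r, fan (si l) = fan r
    & (~~ fan r -> fconnect ph r (al l)) /\ mu r = step_mode al si ph lam mu l r].
Hypothesis step_left : forall l, is_left_leg l -> exists r, step l r.
Hypothesis step_right : forall r, is_right_leg r -> exists l, step l r.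

Lemma nz_al d : inner_edge (al d) = inner_edge d.
Proof.
have E : si d = ph (al d) by rewrite phE alK.
rewrite /inner_edge alK -phE -E.
by case: (lam d != 0); case: (lam (si d) != 0); case: (lam (al d) != 0); case: (lam (ph d) != 0).
Qed.

Lemma gquad_al d : gquad (al d) = let: (a, b, c, d) := gquad d in (c, d, a, b).
Proof. by rewrite /label_quad alK -phE (phE (al d)) alK. Qed.

Lemma face_rule_LR l r : face_rule al si ph lam mu l r != middle.
Proof. by rewrite /face_rule; case: ifP => // _; case: ifP => // _; case: ifP => // _; case: ifP => // _; case: ifP. Qed.

Lemma iph_al d : al (finv ph d) = finv si d.
Proof. by apply: siI; rewrite -phE (f_finv phI) (f_finv siI). Qed.

(** A left leg kept in this position owes its choice to [face_rule]; the other branches of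
    [step_mode] drop it. *)
Lemma uni_left l r : step l r -> lam (ph l) = 2 -> l \in T ->
  [/\ ~~ fan r, mu r = left, lam (al r) != 2 & face_rule al si ph lam mu l r = left].
Proof.
case=> ll rl mulr fanlr [_]; rewrite T_left // mulr fanlr /step_mode => + ph2; rewrite ph2 /=.
have [a2|a2] := boolP (lam (al r) == 2); first by move=> ->.
have [fr|fr] := boolP (fan r); first by move=> ->.
move=> mE; have := face_rule_LR l r; rewrite -mE andbT.
by case: (mu r) => [[]|].
Qed.

Lemma uni_right l r : step l r -> lam (al r) = 1 -> r \in T ->
  [/\ ~~ fan r, mu r = right, lam (ph l) != 1 & face_rule al si ph lam mu l r = right].
Proof.
case=> ll rl mulr fanlr [_]; rewrite T_right // /step_mode => + a1; rewrite a1 /=.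
have [p1|p1] := boolP (lam (ph l) == 1); first by move=> ->.
have [fr|fr] := boolP (fan r); first by move=> ->.
move=> mE; have := face_rule_LR l r; rewrite -mE andbT.
by case: (mu r) => [[]|].
Qed.

(** The point is that [d] directly follows the change from 3 to 2, so there is only one such tree
    dart at a vertex. If the first test of [face_rule] succeeds, the dart before [d] on the face
    shows this; otherwise uniqueness on the face identifies that dart with [ph r], to which the
    remaining tests refer. *)
Lemma first_upper d : inner_edge d -> d \in T -> gquad d = (2,2,1,3) ->
    (inner_edge (finv ph d) \/ forall r, step (al d) r -> ~~ fan r ->
       face_rule al si ph lam mu (al d) r <> left) ->
    (forall w, fconnect ph d w -> lam w != 0) ->
  lam (finv si d) = 3.
Proof.
move=> dnz dT dq pnz fnz.
have ll : is_left_leg (al d) by rewrite /is_left_leg nz_al dnz gquad_al dq.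
have [r st] := step_left ll.
have lph : lam (ph (al d)) = 2 by move: dq; rewrite phE alK => -[].
have aT : al d \in T by rewrite T_al.
have [nf _ _ rule] := uni_left st lph aT.
have [_ rl _ _ [/(_ nf) con _]] := st; rewrite alK in con.
have pE : ph (finv ph d) = d by apply: f_finv.
case: pnz => [pnz|/(_ r st nf)//].
have := quad_nz pnz; rewrite -(iph_al d) /label_quad pE.
have -> : lam d = 2 by case: dq.
move: rule; rewrite /face_rule alK.
have rd : lam (ph r) = 1.
  by move: rl; rewrite /is_right_leg !inE => /andP[_ /orP[]/eqP[_ _ _]].
have conp : fconnect ph (ph r) (finv ph d).
  rewrite -(same_fconnect1 phI).
  by apply: connect_trans con _; rewrite fconnect_sym // -{2}pE fconnect1.
have rnz w : fconnect ph (ph r) w -> lam w != 0.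
  move=> rw; apply: fnz; apply: connect_trans rw; apply: connect_trans (fconnect1 _ _).
  by rewrite fconnect_sym.
have [p2|p2] := eqVneq (lam (finv ph d)) 2.
  by move=> _; rewrite p2 /quads !inE; do ![case/orP]=> /eqP[].
have [//|r1] := eqVneq (lam (ph (ph r))) 1.
move=> rule pq; have p1 : lam (finv ph d) = 1.
  by move: pq p2; rewrite /quads !inE; do ![case/orP]=> /eqP[] // ->.
have d2 : lam d = 2 by case: dq.
have rp : ph r = finv ph d.
  apply: (uniq_ph conp); rewrite ?rd ?p1 ?pE ?d2 //.
  by apply: rnz; apply: fconnect1.
by move: rule pq; rewrite rp p1 /quads !inE; case: ifP => [/eqP-> _|_];
  [| case: ifP => // /eqP c2 _]; do ![case/orP]=> /eqP[].
Qed.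

Lemma last_upper_rule d : inner_edge d -> d \in T -> gquad d = (1,1,3,2) ->
  exists l, step l (al d) /\ face_rule al si ph lam mu l (al d) = right /\ mu (al d) = right.
Proof.
move=> dnz dT dq.
have rl : is_right_leg (al d) by rewrite /is_right_leg nz_al dnz gquad_al dq.
have [l st] := step_right rl; exists l.
have al1 : lam (al (al d)) = 1 by rewrite alK; case: dq.
have aT : al d \in T by rewrite T_al.
by have [_ ? _ ?] := uni_right st al1 aT.
Qed.

(** Counterpart of [first_upper] at the end of the interval of label 1. Here [ph (al d)] is [si d],
    so the tests of [face_rule] concern the next dart at the same vertex. *)
Lemma last_upper d : inner_edge d -> d \in T -> gquad d = (1,1,3,2) -> inner_edge (si d) ->
  lam (si (si d)) = 3.
Proof.
move=> dnz dT dq rnz; have [l [st [rule _]]] := last_upper_rule dnz dT dq.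
have rE : ph (al d) = si d by rewrite phE alK.
have := quad_nz rnz; rewrite /label_quad.
have -> : lam (si d) = 1 by case: dq.
move: rule; rewrite /face_rule rE; case: ifP => // _.
case: ifP => [/eqP-> _|_]; first by rewrite /quads !inE; do ![case/orP]=> /eqP[].
by case: ifP => // /eqP b1 _; rewrite /quads !inE; do ![case/orP]=> /eqP[].
Qed.

Variable x : D.
Hypothesis x_nz : forall d, fconnect si x d -> lam d != 0.
Hypothesis x_uniq : forall d d', fconnect si x d -> fconnect si x d' -> lam d = lam d' ->
  lam (si d) != lam d -> lam (si d') != lam d' -> d = d'.
Hypothesis x_T : forall d, fconnect si x d -> d \in T -> inner_edge d.
Hypothesis x_face2 : forall d, fconnect si x d -> gquad d = (2,2,1,3) ->
  (inner_edge (finv ph d) \/ forall r, step (al d) r -> ~~ fan r ->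
       face_rule al si ph lam mu (al d) r <> left) /\
  forall w, fconnect ph d w -> lam w != 0.
Hypothesis x_face1 : forall d, fconnect si x d -> gquad d = (1,1,3,2) -> inner_edge (si d).

(** By [x_uniq], [b] is the only end of the interval of label 3, and [mu_si] carries the mode along
    the interval. *)
Lemma run3 k b : fconnect si x k -> fconnect si k b -> lam k = 3 -> lam b = 3 -> lam (si b) != 3 ->
  mu b = mu k /\ (k != b -> lam (finv si b) = 3).
Proof.
move=> xk kb k3 b3 sb3; set j := findex si k b.
have jb : iter j si k = b by apply: iter_findex.
have jo : j < order si k by apply: findex_max.
have run i : i <= j -> lam (iter i si k) = 3 /\ mu (iter i si k) = mu k.
  elim: i => [//|i IH] ij /=; have [l3 mE] := IH (ltnW ij).
  suff sl : lam (si (iter i si k)) = 3 by split; rewrite // mu_si.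
  apply/eqP; apply: contraLR (ij) => sl; rewrite -leqNgt.
  suff E : iter i si k = b by rewrite /j -E findex_iter // (ltn_trans ij).
  apply: x_uniq; rewrite ?l3 ?b3 //; last exact: connect_trans kb.
  by apply: connect_trans xk _; apply: fconnect_iter.
have [_ <-] := run j (leqnn j); rewrite jb; split=> // kb'.
have j0 : 0 < j by rewrite lt0n; apply: contraNneq kb' => j0; rewrite -jb j0.
have E : b = si (iter j.-1 si k) by rewrite -[LHS]jb -{1}(prednK j0).
by have [l3 _] := run j.-1 (leq_pred j); rewrite E (finv_f siI).
Qed.

(** A tree spoke means mode [middle] at a vertex with several corners labelled 3. There the right
    leg is dropped, and horizontal edges occur only on chains. *)
Lemma spoke_excludes s b : fconnect si x s -> s \in T -> gquad s = (3,3,2,1) ->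
    fconnect si x b -> b \in T -> lam b = 3 -> lam (si b) = 2 -> False.
Proof.
move=> xs sT sq xb bT b3 sb2; have snz := x_T xs sT; have bnz := x_T xb bT.
have s3 : lam s = 3 by case: sq.
have ss3 : lam (si s) = 3 by case: sq.
have sb : s != b by apply/eqP => E; move: sb2; rewrite -E ss3.
have conn_sb : fconnect si s b by apply: connect_trans xb; rewrite fconnect_sym.
have sb3 : lam (si b) != 3 by rewrite sb2.
have [mE ib] := run3 xs conn_sb s3 b3 sb3.
have fb : fan b by rewrite /paired ib ?eqxx ?orbT.
move: sT; rewrite (T_spoke snz sq) => /andP[/eqP ms _]; rewrite ms in mE.
have := quad_nz bnz; rewrite /label_quad b3 sb2 /quads !inE; do ![case/orP]=> /eqP[] // a2 p1.
- have bl : is_right_leg b by rewrite /is_right_leg bnz /label_quad b3 sb2 a2 p1.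
  by move: bT; rewrite (T_right bl) mE fb.
- have bl : is_right_leg b by rewrite /is_right_leg bnz /label_quad b3 sb2 a2 p1.
  by move: bT; rewrite (T_right bl) mE fb.
by have := fan_chain b3; rewrite fb /paired p1.
Qed.

Lemma bL_cases c : inner_edge c -> lam c = 1 -> lam (si c) = 3 -> is_left_leg c \/ gquad c = (1,3,3,2).
Proof.
move=> cnz c1 sc3; rewrite /is_left_leg cnz; have := quad_nz cnz.
rewrite /label_quad c1 sc3 /quads !inE; do ![case/orP]=> /eqP[] // -> ->; by [left | right].
Qed.

Lemma bR_cases b : inner_edge b -> lam b = 3 -> lam (si b) = 2 -> is_right_leg b \/ gquad b = (3,2,1,3).
Proof.
move=> bnz b3 sb2; rewrite /is_right_leg bnz; have := quad_nz bnz.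
rewrite /label_quad b3 sb2 /quads !inE; do ![case/orP]=> /eqP[] // -> ->; by [left | right].
Qed.

Lemma hor_chain c : gquad c = (1,3,3,2) -> chain (si c).
Proof.
by move=> cq; rewrite /paired -{2}(alK c) -phE (finv_f phI); case: cq => _ _ -> _; rewrite orbT.
Qed.

Lemma spoke_excludes_left s c : fconnect si x s -> s \in T -> gquad s = (3,3,2,1) ->
    fconnect si x c -> c \in T -> lam c = 1 -> lam (si c) = 3 -> False.
Proof.
move=> xs sT sq xc cT c1 sc3; have snz := x_T xs sT; have cnz := x_T xc cT.
move: sT; rewrite (T_spoke snz sq) => /andP[/eqP ms /eqP is1].
have s3 : lam s = 3 by case: sq.
have ss3 : lam (si s) = 3 by case: sq.
have cE : c = finv si s.
  apply: x_uniq; rewrite ?c1 ?is1 ?sc3 ?(f_finv siI) ?s3 //.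
  by apply: connect_trans xs (fconnect_finv _ _).
have sE : si c = s by rewrite cE (f_finv siI).
have fs : fan s by rewrite /paired ss3.
have [cl|cq] := bL_cases cnz c1 sc3.
  by move: cT; rewrite (T_left cl) sE ms fs.
by have := fan_chain s3; rewrite fs -sE hor_chain.
Qed.

(* Two ends of the base, two extra incoming legs and the edge between the labels 2 and 1: this is
   the only way in which the degree could reach five. *)
Lemma four_conflict b c d2 d1 :
    fconnect si x b -> b \in T -> lam b = 3 -> lam (si b) = 2 ->
    fconnect si x c -> c \in T -> lam c = 1 -> lam (si c) = 3 ->
    fconnect si x d2 -> d2 \in T -> gquad d2 = (2,2,1,3) ->
    fconnect si x d1 -> d1 \in T -> gquad d1 = (1,1,3,2) -> False.
Proof.
move=> xb bT b3 sb2 xc cT c1 sc3 x2 d2T q2 x1 d1T q1.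
have bnz := x_T xb bT; have cnz := x_T xc cT.
have conn_x u v : fconnect si x u -> fconnect si x v -> fconnect si u v.
  by move=> xu xv; apply: connect_trans xv; rewrite fconnect_sym.
have xs u : fconnect si x u -> fconnect si x (si u).
  by move=> xu; apply: connect_trans xu (fconnect1 _ _).
have xi u : fconnect si x u -> fconnect si x (finv si u).
  by move=> xu; apply: connect_trans xu (fconnect_finv _ _).
(* The four darts are tightly placed: [d1] just before [c], then the interval of label 3 ending at
   [b], then [d2]. *)
have d2E : d2 = si b.
  rewrite -(f_finv siI d2); congr si; have i3 := first_upper (x_T x2 d2T) d2T q2 (x_face2 x2 q2).1 (x_face2 x2 q2).2.
  apply: x_uniq; rewrite ?i3 ?b3 ?sb2 ?(f_finv siI) //; first exact: xi.
  by case: q2 => ->.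
have d1E : si d1 = c.
  have i3 := last_upper (x_T x1 d1T) d1T q1 (x_face1 x1 q1); have sd1 : lam (si d1) = 1 by case: q1.
  by apply: x_uniq; rewrite ?sd1 ?c1 ?i3 ?sc3 //; apply: xs.
have sb3 : lam (si b) != 3 by rewrite sb2.
have [mE ib] := run3 (xs _ xc) (conn_x _ _ (xs _ xc) xb) sc3 b3 sb3.
(* For horizontal [c] or [b] the last line of [face_rule] decides: keeping [d1] forces mode [left]
   on the chain of [c], and keeping [d2] forbids it on the chain of [b]. *)
have c_hor : gquad c = (1,3,3,2) -> mu (si c) = left.
  move=> cq; have [l [st [rule _]]] := last_upper_rule (x_T x1 d1T) d1T q1.
  have rE : ph (al d1) = c by rewrite phE alK.
  move: rule; rewrite /face_rule rE; case: ifP => // _.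
  case: cq => _ -> -> -> /=; by case: eqP.
have b_hor : gquad b = (3,2,1,3) -> mu b != left.
  move=> bq; have [pnz fnz] := x_face2 x2 q2; have dnz := x_T x2 d2T.
  have ll : is_left_leg (al d2) by rewrite /is_left_leg nz_al dnz gquad_al q2.
  have [r st] := step_left ll.
  have lph : lam (ph (al d2)) = 2 by move: q2; rewrite phE alK => -[].
  have aT : al d2 \in T by rewrite T_al.
  have [nf _ _ rule] := uni_left st lph aT.
  have [_ rl _ _ [/(_ nf) con _]] := st; rewrite alK in con.
  have pE : finv ph d2 = al b by rewrite d2E -{1}(alK b) -phE (finv_f phI).
  have rd : lam (ph r) = 1.
    by move: rl; rewrite /is_right_leg !inE => /andP[_ /orP[]/eqP[_ _ _]].
  have l21 : lam d2 = 2 by case: q2.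
  have p1 : lam (al b) = 1 by case: bq.
  have pb : ph (al b) = d2 by rewrite phE alK d2E.
  have conp : fconnect ph (ph r) (al b).
    rewrite -(same_fconnect1 phI).
    by apply: connect_trans con _; rewrite fconnect_sym // -pb fconnect1.
  have rnz w : fconnect ph (ph r) w -> lam w != 0.
    move=> rw; apply: fnz; apply: connect_trans rw; apply: connect_trans (fconnect1 _ _).
    by rewrite fconnect_sym.
  move: rule; rewrite /face_rule alK pE p1 /=.
  have [//|r1] := eqVneq (lam (ph (ph r))) 1.
  have rp : ph r = al b.
    apply: (uniq_ph conp); rewrite ?rd ?p1 ?pb ?l21 //.
    by apply: rnz; apply: fconnect1.
  have bph : lam (ph b) = 3 by case: bq.
  by rewrite rp -phE alK bph b3 /= mu_ph //; case: eqP.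
(* Each combination of legs and horizontal edges asks for two different modes of the same group, or
   for mode [middle] where that mode drops one of the edges. *)
have [fc|nfc] := boolP (fan (si c)).
  have [cl|cq] := bL_cases cnz c1 sc3; last by have := fan_chain sc3; rewrite fc hor_chain.
  have scb : si c != b.
    by apply: contraTneq fc => E; rewrite /paired (finv_f siI) c1 E sb2.
  have fb : fan b by rewrite /paired ib ?eqxx ?orbT.
  have [bl|bq] := bR_cases bnz b3 sb2; last first.
    by have := fan_chain b3; rewrite fb /paired; case: bq => _ _ _ ->.
  by move: cT bT; rewrite (T_left cl) (T_right bl) fc fb !andbF !orbF mE => /eqP->.
have scb : si c = b.
  apply/eqP; apply: contraNT nfc => scb; rewrite /paired.
  have [//|sc] := eqVneq (lam (si (si c))) 3.
  by case/eqP: scb; apply: x_uniq; rewrite ?sc3 ?b3 ?sb2 //; apply: xs.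
have nfb : ~~ fan b by rewrite -scb.
have [cl|cq] := bL_cases cnz c1 sc3; have [bl|bq] := bR_cases bnz b3 sb2.
- have nchb : ~~ chain b.
    have phb : lam (ph b) = 1 by move: bl; rewrite /is_right_leg !inE => /andP[_ /orP[]/eqP[_ _ _]].
    have iphb : lam (finv ph b) = 2.
      rewrite -scb -{1}(alK c) -phE (finv_f phI).
      by move: cl; rewrite /is_left_leg !inE => /andP[_ /orP[]/eqP[_ _ ->]].
    by rewrite /paired phb iphb.
  have mm : mu b != middle.
    by apply/eqP => /(mu_middle b3); rewrite (negbTE nfb) (negbTE nchb).
  move: cT bT; rewrite (T_left cl) (T_right bl) scb (negbTE mm) /= !orbF => /eqP->.
  by [].
- have iphb : lam (finv ph b) = 2.
    rewrite -scb -{1}(alK c) -phE (finv_f phI).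
    by move: cl; rewrite /is_left_leg !inE => /andP[_ /orP[]/eqP[_ _ ->]].
  move: cT bT; rewrite (T_left cl) (T_hor bnz bq) scb (negbTE (b_hor bq)) /= iphb andbT.
  by case/andP=> ->.
- move: bT; rewrite (T_right bl) -scb (c_hor cq) /=.
  by [].
by have := b_hor bq; rewrite -scb (c_hor cq).
Qed.

(** Uniqueness of label changes limits the classes 32, 13 and 21; the rules defining the tree limit
    33, 22 and 11. *)
Lemma vertex_bound : #|[set d in T | fconnect si x d]| <= 4.
Proof.
pose A := [set d in T | fconnect si x d]; rewrite -/A.
pose C a b := [set d in A | (lam d == a) && (lam (si d) == b)].
have xT d : d \in A -> d \in T /\ fconnect si x d by rewrite inE => /andP[].
have CP a b d : d \in C a b -> [/\ d \in T, fconnect si x d, lam d = a & lam (si d) = b].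
  by rewrite inE => /andP[/xT[? ?] /andP[/eqP ? /eqP ?]].
have quad_of a b d : d \in C a b -> a = b -> gquad d \in quads /\ inner_edge d.
  by case/CP => dT xd _ _ _; have dnz := x_T xd dT; split=> //; apply: quad_nz.
have q22 d : d \in C 2 2 -> gquad d = (2,2,1,3).
  move=> dC; have [q _] := quad_of _ _ _ dC erefl; have [_ _ a b] := CP _ _ _ dC.
  by move: q; rewrite /label_quad a b /quads !inE; do ![case/orP]=> /eqP[] // -> ->.
have q11 d : d \in C 1 1 -> gquad d = (1,1,3,2).
  move=> dC; have [q _] := quad_of _ _ _ dC erefl; have [_ _ a b] := CP _ _ _ dC.
  by move: q; rewrite /label_quad a b /quads !inE; do ![case/orP]=> /eqP[] // -> ->.
have q33 d : d \in C 3 3 -> gquad d = (3,3,2,1).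
  move=> dC; have [q _] := quad_of _ _ _ dC erefl; have [_ _ a b] := CP _ _ _ dC.
  by move: q; rewrite /label_quad a b /quads !inE; do ![case/orP]=> /eqP[] // -> ->.
have le1 (B : {set D}) : (forall u v, u \in B -> v \in B -> u = v) -> #|B| <= 1.
  by move=> h; apply/card_le1_eqP => u v uB vB; apply: h.
have turn1 a b : a != b -> 0 < a -> #|C a b| <= 1.
  move=> ab a0; apply: le1 => u v /CP[_ xu ua ub] /CP[_ xv va vb].
  have ba : b != a by rewrite eq_sym.
  have a00 : a != 0 by rewrite -lt0n.
  by apply: x_uniq; rewrite ?ua ?va ?ub ?vb.
have c22 : #|C 2 2| <= 1.
  apply: le1 => u v uC vC; have [uT xu _ _] := CP _ _ _ uC; have [vT xv _ _] := CP _ _ _ vC.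
  have qu := q22 _ uC; have qv := q22 _ vC.
  have iu := first_upper (x_T xu uT) uT qu (x_face2 xu qu).1 (x_face2 xu qu).2; have iv := first_upper (x_T xv vT) vT qv (x_face2 xv qv).1 (x_face2 xv qv).2.
  apply: (can_inj (f_finv siI)); apply: x_uniq; rewrite ?iu ?iv ?(f_finv siI) //.
  - by apply: connect_trans xu (fconnect_finv _ _).
  - by apply: connect_trans xv (fconnect_finv _ _).
  - by case: qu => ->.
  - by case: qv => ->.
have c11 : #|C 1 1| <= 1.
  apply: le1 => u v uC vC; have [uT xu _ u1] := CP _ _ _ uC; have [vT xv _ v1] := CP _ _ _ vC.
  have iu := last_upper (x_T xu uT) uT (q11 _ uC) (x_face1 xu (q11 _ uC)); have iv := last_upper (x_T xv vT) vT (q11 _ vC) (x_face1 xv (q11 _ vC)).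
  apply: siI; apply: x_uniq; rewrite ?iu ?iv ?u1 ?v1 //.
  - by apply: connect_trans xu (fconnect1 _ _).
  - by apply: connect_trans xv (fconnect1 _ _).
have c33 : #|C 3 3| <= 1.
  apply: le1 => u v uC vC; have [uT xu u3 _] := CP _ _ _ uC; have [vT xv v3 _] := CP _ _ _ vC.
  have [_ unz] := quad_of _ _ _ uC erefl; have [_ vnz] := quad_of _ _ _ vC erefl.
  move: uT vT; rewrite (T_spoke unz (q33 _ uC)) (T_spoke vnz (q33 _ vC)) => /andP[_ /eqP iu] /andP[_ /eqP iv].
  apply: (can_inj (f_finv siI)); apply: x_uniq; rewrite ?iu ?iv ?(f_finv siI) ?u3 ?v3 //.
  - by apply: connect_trans xu (fconnect_finv _ _).
  - by apply: connect_trans xv (fconnect_finv _ _).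
have ex33 : 0 < #|C 3 3| -> #|C 3 2| = 0 /\ #|C 1 3| = 0.
  case/card_gt0P => s sC; have [sT xs _ _] := CP _ _ _ sC; have sq := q33 _ sC.
  split; apply/eqP; rewrite cards_eq0 -subset0; apply/subsetP => u /CP[uT xu ua ub].
    by case: (spoke_excludes xs sT sq xu uT ua ub).
  by case: (spoke_excludes_left xs sT sq xu uT ua ub).
have four : ~ (0 < #|C 3 2| /\ 0 < #|C 1 3| /\ 0 < #|C 2 2| /\ 0 < #|C 1 1|).
  case=> /card_gt0P[b /CP[bT xb b3 sb]] [/card_gt0P[c /CP[cT xc c1 sc]]].
  case=> /card_gt0P[d2 d2C] /card_gt0P[d1 d1C].
  have [d2T x2 _ _] := CP _ _ _ d2C; have [d1T x1 _ _] := CP _ _ _ d1C.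
  exact: (four_conflict xb bT b3 sb xc cT c1 sc x2 d2T (q22 _ d2C) x1 d1T (q11 _ d1C)).
have cover : A \subset C 3 3 :|: C 3 2 :|: C 1 3 :|: C 2 2 :|: C 1 1 :|: C 2 1.
  apply/subsetP => d dA; have [dT xd] := xT d dA; rewrite !inE dT xd /=.
  have dz := x_nz xd; have dnz := x_T xd dT.
  by have := quad_nz dnz; rewrite /label_quad /quads !inE; do ![case/orP]=> /eqP[-> -> _ _].
have uD (X Y : {set D}) : #|X :|: Y| <= #|X| + #|Y| by rewrite cardsU leq_subr.
have := leq_trans (subset_leq_card cover) (uD _ _).
have := turn1 3 2 isT isT; have := turn1 1 3 isT isT; have := turn1 2 1 isT isT.
have u5 := uD (C 3 3 :|: C 3 2 :|: C 1 3 :|: C 2 2) (C 1 1).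
have u4 := uD (C 3 3 :|: C 3 2 :|: C 1 3) (C 2 2).
have u3 := uD (C 3 3 :|: C 3 2) (C 1 3).
have u2 := uD (C 3 3) (C 3 2).
move: u2 u3 u4 u5 c22 c11 c33 ex33 four.
move: #|C 3 3 :|: C 3 2 :|: C 1 3 :|: C 2 2 :|: C 1 1| #|C 3 3 :|: C 3 2 :|: C 1 3 :|: C 2 2|
  #|C 3 3 :|: C 3 2 :|: C 1 3| #|C 3 3 :|: C 3 2| #|C 3 3| #|C 3 2| #|C 1 3| #|C 2 2| #|C 1 1| #|C 2 1| #|A|.
clear; lia.
Qed.

End VertexBound.

(** * Groups and modes *)

Section Groups.
Variables (V D : finType) (al si : D -> D) (vert : D -> V).
Hypothesis pg : plane_graph al si vert.
Local Notation ph := (face_perm al si).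
Local Notation e := (adj al vert).
Local Notation hd d := (vert (al d)).
Local Notation fpos := (face_pos al si vert).
Local Notation fseg := (face_seg al si vert).
Local Notation isi := (finv si).
Hypothesis tc : three_connected e.
Variable L : D.
Hypothesis L3 : order si L = 3.
Local Notation z := (vert L).
Local Notation t := (hd (si L)).
Variable g : V -> nat.
Hypothesis glev : levels_from al si vert z t [set z] g.
Hypothesis glev1 : [set v | g v == 1] = fseg L 1 (order ph L).-1.
Let siI : injective si := si_inj pg.
Let phI : injective ph := face_perm_inj pg.
Local Notation up := (upward al si vert L g).
Local Notation lam := (corner_label al si vert L g).
Local Notation quad := (edge_labels al si vert L g).
Local Notation fan := (paired si lam).
Local Notation chain := (paired ph lam).
Local Notation nz := (inner_edge al si ph lam).
Local Notation left_leg := (is_left_leg al si ph lam).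
Local Notation right_leg := (is_right_leg al si ph lam).

Let vs d : vert (si d) = vert d. Proof. exact: vert_si pg d. Qed.
Let vi d : vert (isi d) = vert d. Proof. exact: isi_vert pg d. Qed.
Let vp d : vert (ph d) = hd d. Proof. exact: vert_ph pg d. Qed.

Lemma lam_neq0 d : (lam d != 0) = (vert d != z).
Proof. by rewrite lam_eq0. Qed.

Lemma nzE d : nz d = (vert d != z) && (hd d != z).
Proof.
by rewrite /inner_edge !lam_neq0 vs vp; case: (vert d != z); case: (hd d != z).
Qed.

Lemma quad_nz d : nz d -> quad d \in quads.
Proof. by rewrite nzE => /andP[dz hz]; apply: (quad_in pg tc glev). Qed.

Lemma turn_uniq d d' : vert d = vert d' -> vert d != z -> lam d = lam d' ->
  lam (si d) != lam d -> lam (si d') != lam d' -> d = d'.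
Proof.
move=> vE dz lE cd cd'; have [h _ _] := turns_unique pg tc L3 glev glev1.
have dz' : vert d' != z by rewrite -vE.
by apply: h => //; rewrite inE lam_neq0 ?dz ?dz' eq_sym.
Qed.

Lemma lam3E d : vert d != z -> (lam d == 3) = ~~ up (isi d) && ~~ up d.
Proof.
move=> dz; rewrite /corner_label (negbTE dz).
by case: (up (isi d)); case: (up d) => //; case: (up (ph d)).
Qed.

Lemma exists_right v : v != z -> exists b, [/\ vert b = v, lam b = 3 & lam (si b) = 2].
Proof.
move=> vz; have [b [bv b3 sb]] := vertex_changes pg tc L3 glev glev1 (a := 3) vz isT.
have bz : vert b != z by rewrite bv.
exists b; split=> //; case: (lam_si pg tc L3 glev glev1 bz); rewrite b3 => //.
by move=> E; case/eqP: sb.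
Qed.

Lemma exists_left v : v != z -> exists c, [/\ vert c = v, lam c = 1 & lam (si c) = 3].
Proof.
move=> vz; have [b [bv b1 sb]] := vertex_changes pg tc L3 glev glev1 (a := 1) vz isT.
have bz : vert b != z by rewrite bv.
exists b; split=> //; case: (lam_si pg tc L3 glev glev1 bz); rewrite b1 => //.
by move=> E; case/eqP: sb.
Qed.

Lemma left_uniq c c' : vert c = vert c' -> lam c = 1 -> lam c' = 1 -> lam (si c) = 3 ->
  lam (si c') = 3 -> c = c'.
Proof.
move=> vE c1 c1' s3 s3'; apply: turn_uniq; rewrite ?c1 ?c1' ?s3 ?s3' //.
by rewrite -lam_neq0 c1.
Qed.

Lemma right_uniq c c' : vert c = vert c' -> lam c = 3 -> lam c' = 3 -> lam (si c) != 3 ->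
  lam (si c') != 3 -> c = c'.
Proof.
move=> vE c1 c1' s3 s3'; apply: turn_uniq; rewrite ?c1 ?c1' ?s3 ?s3' //.
by rewrite -lam_neq0 c1.
Qed.

(** The corners labelled 3 form one interval with last corner [b], so there are several exactly when
    the corner before [b] is one of them. *)
Lemma fanE k b : vert k = vert b -> lam k = 3 -> lam b = 3 -> lam (si b) != 3 ->
  fan k = (lam (isi b) == 3).
Proof.
move=> vE k3 b3 sb3; rewrite /paired; have [->|kb] := eqVneq k b; first by rewrite (negbTE sb3).
have bz : vert b != z by rewrite -lam_neq0 b3.
have [_ /=|sk] := eqVneq (lam (si k)) 3; last by case/eqP: kb; apply: right_uniq.
apply/esym/eqP; have con : fconnect si b k by rewrite -(vertE pg) vE.
have [||w [bw nw qw]] := orbit_step (q := fun x => (lam x == 3) && (x != b)) con.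
- by rewrite k3 kb.
- by rewrite eqxx andbF.
have wb : vert w = vert b by apply/eqP; rewrite (vertE pg) fconnect_sym.
case/andP: qw => /eqP sw3 swb.
have w1 : lam w != 3.
  apply: contraTneq nw => w3; rewrite negbK w3 eqxx /=.
  by apply: contraNneq sb3 => <-; rewrite sw3.
have wz : vert w != z by rewrite wb.
have lw1 : lam w = 1.
  have := lam_range al si g wz.
  case: (lam_si pg tc L3 glev glev1 wz); rewrite sw3; first by move=> E; rewrite -E in w1.
  by rewrite /nxS; case: (lam w) w1 => [|[|[|[|]]]].
apply/eqP; apply: contraNT swb => ib; apply/eqP.
have iz : vert (isi b) != z by rewrite vi.
have ib1 : lam (isi b) = 1.
  have := lam_range al si g iz.
  case: (lam_si pg tc L3 glev glev1 iz); rewrite (f_finv siI) b3; first by move=> E; rewrite -E in ib.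
  by rewrite /nxS; case: (lam _) ib => [|[|[|[|]]]].
have -> : w = isi b by apply: left_uniq; rewrite ?vi ?(f_finv siI).
exact: f_finv.
Qed.

Lemma fan_vertex k k' : vert k = vert k' -> lam k = 3 -> lam k' = 3 -> fan k = fan k'.
Proof.
move=> vE k3 k3'; have kz : vert k != z by rewrite -lam_neq0 k3.
have [b [bv b3 sb]] := exists_right kz.
have nsb : lam (si b) != 3 by rewrite sb.
by rewrite !(fanE _ _ b3 nsb) -?vE ?bv.
Qed.

Lemma hor_quad d : lam d = 3 -> lam (ph d) = 3 -> quad d = (3,2,1,3) /\ hor al vert L g d.
Proof.
move=> d3 p3.
have dz : vert d != z by rewrite -lam_neq0 d3.
have hz : hd d != z by rewrite -vp -lam_neq0 p3.
have pz : vert (ph d) != z by rewrite vp.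
have := quad_nz (d := d); rewrite nzE dz hz => /(_ isT).
have /eqP := d3; rewrite lam3E // => /andP[_ nu].
have /eqP := p3; rewrite lam3E // (finv_f siI) => /andP[nu' _].
have [un|h] := orP (base_down_or_hor pg dz hz nu); first by rewrite un in nu'.
by rewrite /edge_labels d3 p3 /quads !inE => q; split=> //; move: q; do ![case/orP]=> /eqP[] // -> ->.
Qed.

(** By [rightward], the edges next to the two lower ones go up at both ends, which leaves a single
    corner labelled 3 at each. *)
Lemma hor_nofan d : lam d = 3 -> lam (ph d) = 3 ->
  [/\ g (vert d) = g (hd d), forall k, vert k = vert d -> lam k = 3 -> ~~ fan k
    & forall k, vert k = hd d -> lam k = 3 -> ~~ fan k].
Proof.
move=> d3 p3; have [dq dh] := hor_quad d3 p3.
have dz : vert d != z by rewrite -lam_neq0 d3.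
have hz : hd d != z by rewrite -vp -lam_neq0 p3.
have pz : vert (ph d) != z by rewrite vp.
have gE : g (vert d) = g (hd d) by case/andP: dh => _ /eqP.
have /eqP := d3; rewrite lam3E // => /andP[ni nd].
have /eqP := p3; rewrite lam3E // (finv_f siI) => /andP[na np].
have rw : rightward al si vert L g d.
  have [//|rw] := orP (hor_rightward pg tc glev dh).
  have haz : vert (al (al d)) != z by rewrite (alK pg).
  have naa : ~~ up (al (al d)) by rewrite (alK pg).
  have := quad_right pg hz haz na naa rw.
  by rewrite (quad_al pg) dq.
case/and5P: rw => u1 u2 u3 u4 /andP[u5 u6].
have sd2 : lam (si d) != 3 by rewrite lam3E ?vs // u1 andbF.
have sp2 : lam (si (ph d)) != 3 by rewrite lam3E ?vs ?vp // u6 andbF.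
split=> // k kv k3.
  by rewrite (fanE kv k3 d3 sd2) lam3E ?vi // u5.
rewrite (fanE _ k3 p3 sp2) ?vp // (finv_f siI) lam3E //.
by case: up u3.
Qed.

Lemma chainP d : lam d = 3 -> chain d ->
  exists w, [/\ lam w = 3, lam (ph w) = 3 & w = d \/ ph w = d].
Proof.
move=> d3 /orP[/eqP p3|/eqP i3]; first by exists d; split=> //; left.
by exists (finv ph d); rewrite (f_finv phI); split=> //; right.
Qed.

Lemma fan_chain d : lam d = 3 -> ~~ (fan d && chain d).
Proof.
move=> d3; apply/negP => /andP[fd /(chainP d3)[w [w3 pw wd]]].
have [_ h1 h2] := hor_nofan w3 pw.
case: wd => E; first by move: fd; apply/negP/h1; rewrite -?E.
by move: fd; apply/negP/h2; rewrite -?E ?vp.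
Qed.

(** Lower edges to the apex occur only at the ends of the first chain, on level 1; the edge from the
    last vertex counts as going up. *)
Lemma nz_base d : 1 < g (vert d) -> ~~ up d -> hd d != z.
Proof.
move=> g1 nu; apply/eqP => hz.
have [[m1 _ _ _ _] _ _] := first_group pg tc L3; set m := (order ph L).-1 in m1.
have low i : 0 < i <= m -> vert d = fpos L i -> False.
  move=> im dv; have : vert d \in [set v | g v == 1] by rewrite glev1 dv; apply/fsegP; exists i.
  by rewrite inE => /eqP E; rewrite E in g1.
have [adE|adE|adE] := apex_darts pg L3 hz.
- by apply: (low 1); rewrite ?(ltnW m1) // /fpos /= vp -adE (alK pg).
- have dt : vert d = t by rewrite -adE (alK pg).
  by case/negP: nu; rewrite (up_top pg glev dt) hz.
have [_ _ E] := face_prev pg L.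
by apply: (low m); rewrite ?leqnn ?(ltnW m1) // /fpos -[iter m _ _]/(finv ph L) -[d](alK pg) adE -E (alK pg).
Qed.

Lemma left_legP d : reflect [/\ nz d, lam d = 1, lam (si d) = 3 & lam (al d) = 2] (left_leg d).
Proof.
rewrite /is_left_leg /label_quad; apply: (iffP andP) => [[dnz]|[dnz d1 s3 a2]].
  by rewrite !inE => /orP[]/eqP[-> -> -> _].
split=> //; have := quad_nz dnz; rewrite /edge_labels d1 s3 a2 /quads !inE.
by do ![case/orP]=> /eqP[] // ->.
Qed.

Lemma right_legP d : reflect [/\ nz d, lam d = 3, lam (si d) = 2 & lam (ph d) = 1] (right_leg d).
Proof.
rewrite /is_right_leg /label_quad; apply: (iffP andP) => [[dnz]|[dnz d1 s3 a2]].
  by rewrite !inE => /orP[]/eqP[-> -> _ ->].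
split=> //; have := quad_nz dnz; rewrite /edge_labels d1 s3 a2 /quads !inE.
by do ![case/orP]=> /eqP[] // ->.
Qed.

Lemma left_cases c : nz c -> lam c = 1 -> lam (si c) = 3 ->
  left_leg c \/ [/\ lam (al c) = 3, lam (ph (al c)) = 3 & ph (al c) = si c].
Proof.
move=> cnz c1 sc; have pE : ph (al c) = si c by rewrite /face_perm (alK pg).
have := quad_nz cnz; rewrite /edge_labels c1 sc /quads !inE.
do ![case/orP]=> /eqP[] // ac pc; try (by left; apply/left_legP).
by right; rewrite pE.
Qed.

Lemma right_cases b : nz b -> lam b = 3 -> lam (si b) = 2 ->
  right_leg b \/ lam (ph b) = 3.
Proof.
move=> cnz c1 sc; have := quad_nz cnz; rewrite /edge_labels c1 sc /quads !inE.
by do ![case/orP]=> /eqP[] // ac pc; try (by left; apply/right_legP); right.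
Qed.

Section Chain.
Variables (k : nat) (L' : D) (m : nat).
Hypothesis chg : chain_group al si vert [set u | g u < k] [set u | g u == k] L' m.
Hypothesis k0 : 0 < k.

Lemma chain_pos v : g v = k -> exists2 i, 0 < i <= m & v = fpos L' i.
Proof.
move=> gv; have [[_ _ _ _ PE] _ _] := chg.
have : v \in [set u | g u == k] by rewrite inE gv.
by rewrite PE => /fsegP.
Qed.

Lemma chain_corner i : 0 < i <= m -> [/\ lam (al (iter i.-1 ph L')) = 1, lam (iter i ph L') = 3,
  lam (si (iter i ph L')) = 2 & si (al (iter i.-1 ph L')) = iter i ph L'].
Proof.
move=> im; have i0 : 0 < i by case/andP: im.
have [nb1 nb2 u1 u2 _] := chain_ups pg tc glev chg k0 im.
have vz := chain_neqz glev chg k0 im.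
have sE := chain_si al si L' i0; have vE := chain_vert1 pg L' i0.
have v1z : vert (al (iter i.-1 ph L')) != z by rewrite vE.
have v2z : vert (iter i ph L') != z by [].
have v3z : vert (si (iter i ph L')) != z by rewrite vs.
rewrite /corner_label (negbTE v1z) (negbTE v2z) (negbTE v3z) u1 (negbTE nb1) (negbTE nb2) u2.
have -> : isi (iter i ph L') = al (iter i.-1 ph L') by rewrite -sE (finv_f siI).
by rewrite (finv_f siI) (negbTE nb1) (negbTE nb2).
Qed.

Lemma chain_corner3 i d : 0 < i <= m -> vert d = fpos L' i -> lam d = 3 -> d = iter i ph L'.
Proof.
move=> im dv d3; have dz : vert d != z by rewrite -lam_neq0 d3.
have /eqP := d3; rewrite lam3E // => /andP[_]; rewrite (chain_base pg tc glev chg k0 im dv).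
by case/orP => /eqP dE //; have [l1 _ _ _] := chain_corner im; rewrite -dE d3 in l1.
Qed.

Lemma chain_corner1 i d : 0 < i <= m -> vert d = fpos L' i -> lam d = 1 -> lam (si d) = 3 ->
  d = al (iter i.-1 ph L').
Proof.
move=> im dv d1 s3; have [l1 l3 _ sE] := chain_corner im; have i0 : 0 < i by case/andP: im.
by apply: left_uniq; rewrite ?(chain_vert1 pg) // sE.
Qed.

Lemma chain_chain d : g (vert d) = k -> lam d = 3 -> chain d.
Proof.
case/chain_pos=> i im dv d3; rewrite (chain_corner3 im dv d3) /paired.
have [[m1 _ _ _ _] _ _] := chg; have [i0 i_m] := andP im.
have [im'|mi] := ltnP i m.
  have [_ l3 _ _] := @chain_corner i.+1 im'; by rewrite -iterS l3.
have im1 : 0 < i.-1 <= m by lia.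
have [_ l3 _ _] := chain_corner im1.
by rewrite -{2}(prednK i0) iterS (finv_f phI) l3 orbT.
Qed.

Lemma chain_legs : 1 < k -> [/\ left_leg (al L'), right_leg (iter m ph L'),
  g (hd L') = k & g (fpos L' m) = k].
Proof.
move=> k1; have [[m1 _ LS mS _] _ _] := chg.
have i1 : 0 < 1 <= m by rewrite (ltnW m1).
have im : 0 < m <= m by rewrite leqnn (ltnW m1).
have [a1 a3 sa as3] := chain_corner i1; have [b1 b3 sb _] := chain_corner im.
have [nu1 _ _ _ _] := chain_ups pg tc glev chg k0 i1.
have [_ nu2 _ _ _] := chain_ups pg tc glev chg k0 im.
have g1 : g (hd L') = k by rewrite -(chain_level chg i1) /fpos /= vp.
have gm : g (fpos L' m) = k by exact: (chain_level chg im).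
have nzl : nz (al L').
  by rewrite nzE -lam_neq0 /= a1 nz_base //= ?g1 //.
have nzr : nz (iter m ph L').
  by rewrite nzE -lam_neq0 /= b3 nz_base //= ?gm.
split=> //.
- have [//|[h3 h3' _]] := left_cases nzl a1 (etrans (congr1 lam as3) a3).
  have [gE _ _] := hor_nofan h3 h3'; move: LS; rewrite (alK pg) in gE.
  by rewrite inE gE g1 ltnn.
have [//|p3] := right_cases nzr b3 sb.
have [gE _ _] := hor_nofan b3 p3; move: mS.
by rewrite inE /fpos iterS vp -gE -/(fpos L' m) gm ltnn.
Qed.

End Chain.

Definition legs_of k l r :=
  [/\ left_leg l, right_leg r, g (vert l) = k & g (vert r) = k] /\
  [/\ forall d, g (vert d) = k -> left_leg d -> d = l,
      forall d, g (vert d) = k -> right_leg d -> d = r,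
      fan (si l) = fan r, ~~ fan r -> fconnect ph r (al l)
    & ([/\ vert l = vert r, forall u, g u = k -> u = vert r
         & forall d, g (vert d) = k -> lam d = 3 -> ~~ chain d]) \/
      (forall d, g (vert d) = k -> lam d = 3 -> chain d)].

(** For a single vertex the legs are the changes from 1 to 3 and from 3 to 2; for a chain they are
    the reversed [L'] and the dart leaving the last chain vertex. *)
Lemma group_legs v : 1 < g v -> exists l r, legs_of (g v) l r.
Proof.
move=> g1; have vz : v != z by rewrite -(g_gt0 glev); apply: ltnW.
have [single|[L' [m [i [chg im vE _]]]]] := group_kind glev vz.
  have only u : g u = g v -> u = v.
    by move=> gu; apply/set1P; rewrite -single inE gu.
  have [c [cv c1 sc]] := exists_left vz; have [b [bv b3 sb]] := exists_right vz.
  have nhor w : g (vert w) = g v -> lam w = 3 -> lam (ph w) <> 3.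
    move=> gw w3 p3; have [gE _ _] := hor_nofan w3 p3.
    have := vert_al pg w; rewrite (only _ gw) (only (hd w)) ?eqxx //.
    by rewrite -gE.
  have sc3 : vert (si c) != z by rewrite vs cv.
  have cu : ~~ up c by have /eqP := sc; rewrite lam3E // (finv_f siI) => /andP[].
  have bu : ~~ up b by have /eqP := b3; rewrite lam3E ?bv // => /andP[].
  have cnz : nz c by rewrite nzE cv vz nz_base ?cv.
  have bnz : nz b by rewrite nzE bv vz nz_base ?bv.
  have ll : left_leg c.
    have [//|[h3 h3' E]] := left_cases cnz c1 sc.
    have [gE _ _] := hor_nofan h3 h3'; case: (nhor _ _ h3 h3').
    by rewrite gE (alK pg) cv.
  have rl : right_leg b by have [//|p3] := right_cases bnz b3 sb; case: (nhor b); rewrite ?bv.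
  have nsb : lam (si b) != 3 by rewrite sb.
  exists c, b; split; first by rewrite cv bv.
  split.
  - move=> d gd /left_legP[_ d1 s3 _]; apply: left_uniq => //.
    by rewrite cv (only _ gd).
  - move=> d gd /right_legP[_ d3 s2 _]; apply: right_uniq; rewrite ?s2 //.
    by rewrite bv (only _ gd).
  - by apply: fan_vertex; rewrite ?vs ?cv ?bv.
  - rewrite (fan_vertex (k' := si c)) ?vs ?cv ?bv // /paired negb_or => /andP[ss3 _].
    have <- : si c = b by apply: right_uniq; rewrite ?vs ?cv ?bv.
    by have -> : si c = ph (al c); [rewrite /face_perm (alK pg) | rewrite fconnect_sym ?fconnect1].
  left; split; [by rewrite cv bv | by move=> u /only->; rewrite bv |].
  move=> d gd d3; apply/negP => /(chainP d3)[w [w3 p3 wd]].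
  case: (nhor w _ w3 p3); have [gE _ _] := hor_nofan w3 p3.
  by case: wd => E; rewrite -gd -E // gE vp.
have k0 : 0 < g v by apply: ltnW.
have [ll rl gl gr] := chain_legs chg k0 g1.
have [[m1 _ _ _ _] _ _] := chg.
have i1 : 0 < 1 <= m by rewrite (ltnW m1).
have ipm : 0 < m <= m by rewrite leqnn (ltnW m1).
have [_ a3 _ as3] := chain_corner chg k0 i1; have [_ b3 _ _] := chain_corner chg k0 ipm.
have isch d := @chain_chain _ _ _ chg k0 d.
have nofan d : g (vert d) = g v -> lam d = 3 -> ~~ fan d.
  by move=> gd d3; have := fan_chain d3; rewrite isch // andbT.
exists (al L'), (iter m ph L'); split; first by split.
split=> //.
- move=> d gd /left_legP[_ d1 s3 a2]; have [j jm dv] := chain_pos chg gd.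
  have dE := chain_corner1 chg k0 jm dv d1 s3.
  have [j1|j1] := leqP j 1; first by rewrite dE; have -> : j = 1 by case/andP: jm => ? _; lia.
  have jm' : 0 < j.-1 <= m by case/andP: jm => ? ?; lia.
  by have [_ l3 _ _] := chain_corner chg k0 jm'; rewrite dE (alK pg) l3 in a2.
- move=> d gd /right_legP[_ d3 s2 p1]; have [j jm dv] := chain_pos chg gd.
  have dE := chain_corner3 chg k0 jm dv d3.
  have [j1|j1] := ltnP j m; last by rewrite dE; have -> : j = m by case/andP: jm => _ ?; apply/eqP; rewrite eqn_leq j1 andbT.
  by have [_ l3 _ _] := @chain_corner _ _ _ chg k0 j.+1 j1; rewrite iterS -dE p1 in l3.
- rewrite (negbTE (nofan _ gr b3)); apply/negbTE/nofan; first by rewrite vs.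
  by rewrite as3.
- by move=> _; rewrite (alK pg) fconnect_sym // fconnect_iter.
by right.
Qed.

End Groups.

(* The rules of chains look at earlier groups, those of single vertices possibly at later ones, so
   that modes are not defined by a plain recursion along the ordering. *)
Lemma rank_fixpoint (X : Type) (x0 : X) (F : (nat -> X) -> nat -> X) (rank : nat -> nat) :
    (forall m m' k, (forall j, rank j < rank k -> m j = m' j) -> F m k = F m' k) ->
  exists m, forall k, m k = F m k.
Proof.
move=> Fext; pose m n := iter n F (fun=> x0).
have stable n n' k : rank k < n -> rank k < n' -> m n k = m n' k.
  elim: n n' k => // n IH [//|n'] k kn kn'; apply: Fext => j jk.
  by apply: IH; [apply: leq_trans jk _ | apply: leq_trans jk _].
exists (fun k => m (rank k).+1 k) => k; apply: Fext => j jk.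
exact: stable.
Qed.

(** * Choosing the modes *)

Section Modes.
Variables (V D : finType) (al si : D -> D) (vert : D -> V).
Hypothesis pg : plane_graph al si vert.
Local Notation ph := (face_perm al si).
Local Notation e := (adj al vert).
Local Notation hd d := (vert (al d)).
Local Notation fseg := (face_seg al si vert).
Hypothesis tc : three_connected e.
Variable L : D.
Hypothesis L3 : order si L = 3.
Local Notation z := (vert L).
Local Notation t := (hd (si L)).
Variable g : V -> nat.
Hypothesis glev : levels_from al si vert z t [set z] g.
Hypothesis glev1 : [set v | g v == 1] = fseg L 1 (order ph L).-1.
Let siI : injective si := si_inj pg.
Let phI : injective ph := face_perm_inj pg.
Local Notation up := (upward al si vert L g).
Local Notation lam := (corner_label al si vert L g).
Local Notation fan := (paired si lam).
Local Notation chain := (paired ph lam).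
Local Notation nz := (inner_edge al si ph lam).
Local Notation left_leg := (is_left_leg al si ph lam).
Local Notation right_leg := (is_right_leg al si ph lam).
Local Notation legs := (legs_of al si vert L g).
Local Notation dmode m := (fun d => m (g (vert d))).

Definition chain_at k := [exists d, [&& g (vert d) == k, lam d == 3 & chain d]].

Lemma chain_atP d : chain d -> lam d = 3 -> chain_at (g (vert d)).
Proof. by move=> cd d3; apply/existsP; exists d; rewrite eqxx d3 cd. Qed.

Lemma legs_chain k l r : legs k l r -> chain_at k = chain r.
Proof.
case=> [[_ rl _ gr] [_ _ _ _ kind]].
have r3 : lam r = 3 by case/(right_legP pg tc glev): rl.
case: kind => [[_ _ nch]|ch]; last by rewrite (ch _ gr r3) -gr; apply: chain_atP => //; apply: ch.
rewrite (negbTE (nch _ gr r3)); apply/existsP => -[d /and3P[/eqP gd /eqP d3]].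
by apply/negP/nch.
Qed.

Lemma fan_level d : 1 < g (vert d) -> lam d = 3 -> fan d -> ~~ chain_at (g (vert d)).
Proof.
move=> g1 d3 fd; have [l [r lr]] := group_legs pg tc L3 glev glev1 g1.
rewrite (legs_chain lr); case: lr => [[_ rl _ gr] [_ _ _ _ [[_ _ nch]|ch]]].
  by apply: nch => //; case/(right_legP pg tc glev): rl.
by have := fan_chain pg tc L3 glev glev1 d3; rewrite fd ch.
Qed.

Lemma base_down d : nz d -> ~~ up d -> lam (ph d) != 3 -> lam (al d) != 3 -> g (hd d) < g (vert d).
Proof.
move=> dnz nu p3 a3; have := dnz; rewrite nzE // => /andP[dz hz].
have haz : vert (al (al d)) != z by rewrite (alK pg).
have [ua|h] := orP (base_down_or_hor pg dz hz nu).
  by have := up_gt ua haz; rewrite (alK pg).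
have gE : g (vert d) = g (hd d) by case/andP: h => _ /eqP.
have nua : ~~ up (al d).
  by apply/negP => ua; have := up_gt ua haz; rewrite (alK pg) gE ltnn.
have naa : ~~ up (al (al d)) by rewrite (alK pg).
case/orP: (hor_rightward pg tc glev h) => rw.
  by have [_ _ _ E] := quad_right pg dz hz nu nua rw; rewrite E in p3.
by have [E _ _ _] := quad_right pg hz haz nua naa rw; rewrite E in a3.
Qed.

Lemma right_leg_down r : right_leg r -> g (hd r) < g (vert r).
Proof.
case/(right_legP pg tc glev) => rnz r3 s2 p1; have := rnz; rewrite nzE // => /andP[rz hz].
have /eqP := r3; rewrite (lam3E al si g rz) => /andP[_ nu].
apply: base_down; rewrite ?p1 //.
have := quad_nz pg tc glev rnz; rewrite /edge_labels r3 s2 p1 /quads !inE.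
by do ![case/orP]=> /eqP[] // ->.
Qed.

Lemma left_leg_down l : left_leg l -> g (hd l) < g (vert l).
Proof.
case/(left_legP pg tc glev) => lnz l1 s3 a2; have := lnz; rewrite nzE // => /andP[lz hz].
have sz : vert (si l) != z by rewrite (vert_si pg).
have nu : ~~ up l by have /eqP := s3; rewrite (lam3E al si g sz) (finv_f siI) => /andP[].
apply: base_down; rewrite ?a2 //.
have := quad_nz pg tc glev lnz; rewrite /edge_labels l1 s3 a2 /quads !inE.
by do ![case/orP]=> /eqP[] // ->.
Qed.

(** The value [right] on level 1 directs the first chain to its last vertex, the root of the tree;
    on level 0 it is what the dual rule reads at the apex. *)
Definition mode_step (m : nat -> mode) k : mode :=
  if k < 2 then right else
  if [pick p : D * D | [&& left_leg p.1, right_leg p.2, g (vert p.1) == k & g (vert p.2) == k]]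
    is Some p then step_mode al si ph lam (dmode m) p.1 p.2 else right.

Lemma mode_stepE m k l r : 1 < k -> legs k l r ->
  mode_step m k = step_mode al si ph lam (dmode m) l r.
Proof.
move=> k1 [[ll rl gl gr] [lu ru _ _ _]]; rewrite /mode_step ltnNge k1 /=.
case: pickP => [[l' r'] /= /and4P[ll' rl' /eqP gl' /eqP gr']|/(_ (l, r))/=].
  by rewrite (lu _ gl' ll') (ru _ gr' rl').
by rewrite ll rl gl gr eqxx.
Qed.

Lemma face_rule_ext (al' si' ph' : D -> D) lam' mu mu' l r :
    (lam' (ph' (ph' r)) != 1 -> lam' (si' (ph' r)) != 1 -> lam' (al' (ph' r)) != 2 ->
     mu (si' (ph' r)) = mu' (si' (ph' r))) ->
  face_rule al' si' ph' lam' mu l r = face_rule al' si' ph' lam' mu' l r.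
Proof.
rewrite /face_rule => E; case: ifP => // _; case: ifP => // /negbT h1.
by case: ifP => // /negbT h2; case: ifP => // /negbT h3; rewrite E.
Qed.

Lemma swap12_eq a b : (swap12 a == b) = (a == swap12 b).
Proof. by rewrite /swap12; case: a b => [|[|[|a]]] [|[|[|b]]]. Qed.

(** If the last test is reached above level 1, [ph r] has the labels of a horizontal edge, so the
    mode read is that of an earlier chain. *)
Lemma left_rule_lookup k l r : 1 < k -> legs k l r ->
    lam (si (ph r)) != 1 -> lam (al (ph r)) != 2 ->
  let j := g (vert (si (ph r))) in j < k /\ ((j < 2) || chain_at j).
Proof.
move=> k1 [[ll rl gl gr] _] s1 a2 /=; have [rnz r3 s2 p1] := right_legP pg tc glev r rl.
have hz : hd r != z by move: rnz; rewrite nzE // => /andP[].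
have pz : vert (ph r) != z by rewrite (vert_ph pg).
rewrite (vert_si pg) {1}(vert_ph pg) -gr (right_leg_down rl); split=> //.
have sq3 : lam (si (ph r)) = 3.
  by case: (lam_si pg tc L3 glev glev1 pz); rewrite p1 // => E; rewrite E in s1.
have [//|j1] := ltnP (g (vert (ph r))) 2; rewrite orFb.
have sz : vert (si (ph r)) != z by rewrite (vert_si pg).
have nu : ~~ up (ph r).
  by have /eqP := sq3; rewrite (lam3E al si g sz) (finv_f siI) => /andP[].
have qnz : nz (ph r) by rewrite nzE // pz (nz_base pg tc L3 glev glev1).
have [/(left_legP pg tc glev)[_ _ _ E]|[h3 h3' E]] := left_cases pg tc glev qnz p1 sq3.
  by rewrite E in a2.
rewrite -(vert_si pg); apply: chain_atP => //.
by rewrite /paired -E (finv_f phI) h3 orbT.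
Qed.

(** In the dual rule [si r] goes up, either to the apex or to a later vertex with several corners
    labelled 3, which is not on a chain. *)
Lemma right_rule_lookup k l r : 1 < k -> legs k l r ->
    lam (ph (si r)) != 2 -> lam (si (si r)) != 2 -> lam (al (si r)) != 1 ->
  let j := g (vert (ph (si r))) in (j < 2) || (k < j) && ~~ chain_at j.
Proof.
move=> k1 [[ll rl gl gr] _] p2 s2 a1 /=; have [rnz r3 sr2 p1] := right_legP pg tc glev r rl.
have rz : vert r != z by move: rnz; rewrite nzE // => /andP[].
rewrite (vert_ph pg).
have [->|hz] := eqVneq (hd (si r)) z.
  by have /eqP -> : g z == 0 by rewrite (g_eq0 glev).
have sz : vert (si r) != z by rewrite (vert_si pg).
have us : up (si r).
  have := lam3E al si g sz; rewrite sr2 (finv_f siI).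
  by have /eqP := r3; rewrite (lam3E al si g rz) => /andP[_ ->]; case: up.
have kj : k < g (hd (si r)) by rewrite -gr -(vert_si pg r); exact: up_gt us hz.
rewrite kj; apply/orP; right.
have := quad_in pg tc glev sz hz; rewrite /edge_labels sr2 /quads !inE => q.
have [a3 p3] : lam (al (si r)) = 3 /\ lam (ph (si r)) = 3.
  move: q p2 s2 a1; do ![case/orP]=> /eqP[] // -> -> -> //.
rewrite -(vert_ph pg); apply: fan_level => //.
  by rewrite (vert_ph pg); apply: ltn_trans k1 kj.
by rewrite /paired /face_perm (finv_f siI) a3 orbT.
Qed.

Lemma exists_modes : exists m : nat -> mode, (forall k, k < 2 -> m k = right) /\
  forall k l r, 1 < k -> legs k l r -> m k = step_mode al si ph lam (dmode m) l r.
Proof.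
pose M := (g t).+1.
(* Chains read only earlier chains or the lowest levels; single vertices may also read later single
   vertices. So chains are ranked by increasing level and single vertices after them by decreasing
   level. *)
pose rank k := if k < 2 then 0 else if chain_at k then k else M + (M - k).
have gM j v : g v = j -> j < M by move=> <-; rewrite ltnS (top_max pg glev).
have [m mE] : exists m, forall k, m k = mode_step m k.
  apply: (rank_fixpoint right (rank := rank)) => m m' k ext.
  have [k1|k1] := ltnP k 2; first by rewrite /mode_step k1.
  have [/existsP[v /eqP gv]|] := boolP [exists v, g v == k]; last first.
    move/existsPn => none; rewrite /mode_step ltnNge k1 /=; case: pickP => // -[l r] /=.
    by case/and4P=> _ _; rewrite (negbTE (none _)).
  have := k1; rewrite -gv => /(group_legs pg tc L3 glev glev1)[l [r]]; rewrite gv => lr.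
  rewrite !(mode_stepE _ k1 lr); have lc := legs_chain lr.
  have kM : k < M := gM _ _ gv.
  rewrite /step_mode; case: ifP => // _; case: ifP => //.
    move=> _; case: ifP => // nch; congr flip; apply: face_rule_ext => s1 p1 a1.
    rewrite /= in s1 p1 a1; rewrite !swap12_eq /= in s1 p1 a1; congr flip; apply: ext.
    have := right_rule_lookup k1 lr p1 s1 a1.
    have gj := gM _ _ (erefl (g (vert (ph (si r))))).
    move: gj; rewrite /= /rank lc nch [k < 2]ltnNge k1 /=; move: (g _) => j; clear -kM k1.
    by case: (ltnP j 2) => /= j1 jM; [lia | case/andP=> kj /negbTE->; lia].
  move=> _; case: ifP => // _; apply: face_rule_ext => p1 s1 a1; apply: ext.
  have [jk jc] := left_rule_lookup k1 lr s1 a1.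
  move: jk jc; rewrite /rank; move: (g _) => j jk; rewrite [k < 2]ltnNge k1 /=.
  case: (ltnP j 2) => /= [j1 _|j1 ->]; case: ifP => _; clear -kM k1 jk; lia.
exists m; split=> [k k1|k l r k1 lr]; rewrite mE; first by rewrite /mode_step k1.
exact: mode_stepE lr.
Qed.

End Modes.

(** * The tree and its co-tree *)

Section Tree.
Variables (V D : finType) (al si : D -> D) (vert : D -> V).
Hypothesis pg : plane_graph al si vert.
Local Notation ph := (face_perm al si).
Local Notation e := (adj al vert).
Local Notation hd d := (vert (al d)).
Local Notation fseg := (face_seg al si vert).
Local Notation isi := (finv si).
Hypothesis tc : three_connected e.
Variable L : D.
Hypothesis L3 : order si L = 3.
Local Notation z := (vert L).
Local Notation t := (hd (si L)).
Variable g : V -> nat.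
Hypothesis glev : levels_from al si vert z t [set z] g.
Hypothesis glev1 : [set v | g v == 1] = fseg L 1 (order ph L).-1.
Let siI : injective si := si_inj pg.
Let phI : injective ph := face_perm_inj pg.
Local Notation up := (upward al si vert L g).
Local Notation lam := (corner_label al si vert L g).
Local Notation quad := (edge_labels al si vert L g).
Local Notation fan := (paired si lam).
Local Notation chain := (paired ph lam).
Local Notation nz := (inner_edge al si ph lam).
Local Notation left_leg := (is_left_leg al si ph lam).
Local Notation right_leg := (is_right_leg al si ph lam).
Local Notation legs := (legs_of al si vert L g).
Variable m : nat -> mode.
Hypothesis m_low : forall k, k < 2 -> m k = right.
Local Notation mu := (fun d => m (g (vert d))).
Hypothesis m_step : forall k l r, 1 < k -> legs k l r -> m k = step_mode al si ph lam mu l r.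

Let lP := left_legP pg tc glev.
Let rP := right_legP pg tc glev.

Let lz d : (lam d != 0) = (vert d != z). Proof. by rewrite lam_neq0. Qed.

Lemma lam_opp d : (lam (al d) != 0) = (lam (ph d) != 0).
Proof. by rewrite !lz (vert_ph pg). Qed.

Definition tree_rule d : bool :=
  if left_leg d then (mu d == left) || (mu d == middle) && ~~ fan (si d)
  else if right_leg d then (mu d == right) || (mu d == middle) && ~~ fan d
  else if quad d == (3,3,2,1) then (mu d == middle) && (lam (isi d) == 1)
  else (quad d == (3,2,1,3)) && ~~ ((mu d == middle) && (lam (finv ph d) == 2)).

Definition tree_edges := [set d | nz d && (tree_rule d || tree_rule (al d))].

Lemma nz_opp d : nz (al d) = nz d.
Proof. by rewrite !nzE // (alK pg) andbC. Qed.

Lemma tree_al d : (al d \in tree_edges) = (d \in tree_edges).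
Proof. by rewrite !in_set nz_opp (alK pg) orbC. Qed.

Lemma tree_nz d : d \in tree_edges -> nz d.
Proof. by rewrite in_set => /andP[]. Qed.

Lemma not_parent d : lam d != 3 -> ~~ left_leg d -> ~~ tree_rule d.
Proof.
move=> d3 /negbTE nl; rewrite /tree_rule nl; case: ifP => [/rP[_ E _ _]|_].
  by rewrite E in d3.
by case: ifP => [/eqP[E _ _ _]|_]; [rewrite E in d3 | apply/negP => /andP[/eqP[E _ _ _]]; rewrite E in d3].
Qed.

Lemma tree_parent d : nz d -> lam (al d) != 3 -> ~~ left_leg (al d) ->
  (d \in tree_edges) = tree_rule d.
Proof. by move=> dnz a3 nl; rewrite in_set dnz (negbTE (not_parent a3 nl)) orbF. Qed.

Lemma tree_left d : left_leg d ->
  (d \in tree_edges) = (mu (si d) == left) || (mu (si d) == middle) && ~~ fan (si d).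
Proof.
move=> ll; have [dnz d1 s3 a2] := lP _ ll.
rewrite tree_parent ?a2 //; last by apply/negP => /lP[]; rewrite a2.
by rewrite /tree_rule ll (vert_si pg).
Qed.

Lemma tree_right d : right_leg d ->
  (d \in tree_edges) = (mu d == right) || (mu d == middle) && ~~ fan d.
Proof.
move=> rl; have [dnz d3 s2 p1] := rP _ rl.
have nl : ~~ left_leg d by apply/negP => /lP[]; rewrite d3.
have a3 : lam (al d) != 3.
  have := quad_nz pg tc glev dnz; rewrite /edge_labels d3 s2 p1 /quads !inE.
  by do ![case/orP]=> /eqP[] // ->.
rewrite tree_parent //; first by rewrite /tree_rule (negbTE nl) rl.
by apply/negP => /lP[_ _ _]; rewrite (alK pg) d3.
Qed.

Lemma tree_spoke d : nz d -> quad d = (3,3,2,1) ->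
  (d \in tree_edges) = (mu d == middle) && (lam (isi d) == 1).
Proof.
move=> dnz dq; have [d3 s3 a2 p1] := dq.
have nl : ~~ left_leg d by apply/negP => /lP[]; rewrite d3.
have nr : ~~ right_leg d by apply/negP => /rP[]; rewrite s3.
rewrite tree_parent ?a2 //; last by apply/negP => /lP[]; rewrite a2.
by rewrite /tree_rule (negbTE nl) (negbTE nr) dq.
Qed.

Lemma tree_hor d : nz d -> quad d = (3,2,1,3) ->
  (d \in tree_edges) = ~~ ((mu d == middle) && (lam (finv ph d) == 2)).
Proof.
move=> dnz dq; have [d3 s3 a1 p3] := dq.
have nl : ~~ left_leg d by apply/negP => /lP[]; rewrite d3.
have nr : ~~ right_leg d by apply/negP => /rP[]; rewrite p3.
rewrite tree_parent ?a1 //; last by apply/negP => /lP[_ _ _]; rewrite (alK pg) d3.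
by rewrite /tree_rule (negbTE nl) (negbTE nr) dq.
Qed.

Lemma first_chain : chain_group al si vert [set u | g u < 1] [set u | g u == 1] L (order ph L).-1.
Proof.
have -> : [set u | g u < 1] = [set z].
  by apply/setP => u; rewrite !inE ltnS leqn0 (g_eq0 glev).
by rewrite glev1; apply: (first_group pg tc L3).
Qed.

Lemma level1 d : nz d -> (1 < g (vert d)) = (g (vert d) != 1).
Proof. by rewrite nzE // -(g_gt0 glev) => /andP[+ _]; case: (g _) => [|[|n]]. Qed.

(** On level 1 the leftmost lower edge leads to the apex, and the others run along the chain. *)
Lemma left_level l : left_leg l -> 1 < g (vert l).
Proof.
case/lP=> lnz l1 s3 a2; rewrite level1 //; apply/eqP => g1.
have [i im lv] := chain_pos first_chain g1.
have lE := chain_corner1 pg tc L3 glev glev1 first_chain isT im lv l1 s3.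
have [i1|i1] := leqP i 1.
  have E : i = 1 by case/andP: im => ? _; lia.
  by move: lnz; rewrite nzE // lE E /= (alK pg) eqxx andbF.
have jm : 0 < i.-1 <= (order ph L).-1 by case/andP: im => ? ?; lia.
by have [_ l3 _ _] := chain_corner pg tc glev first_chain isT jm; rewrite lE (alK pg) l3 in a2.
Qed.

Lemma right_level r : right_leg r -> 1 < g (vert r).
Proof.
case/rP=> rnz r3 s2 p1; rewrite level1 //; apply/eqP => g1.
have [i im rv] := chain_pos first_chain g1.
have rE := chain_corner3 pg tc glev first_chain isT im rv r3.
have [i1|i1] := ltnP i (order ph L).-1.
  have [_ l3 _ _] := chain_corner pg tc glev first_chain isT (i := i.+1) i1.
  by rewrite iterS -rE p1 in l3.
have E : i = (order ph L).-1 by case/andP: im => _ ?; apply/eqP; rewrite eqn_leq i1 andbT.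
move: rnz; rewrite nzE // -(vert_ph pg) rE E -iterS prednK ?order_gt0 // iter_order //.
by rewrite eqxx andbF.
Qed.

Lemma flip_neq_middle a : a != middle -> flip a != middle.
Proof. by case: a => [[]|]. Qed.

Lemma rule_neq_middle al' si' ph' lam' (mu' : D -> mode) l r : face_rule al' si' ph' lam' mu' l r != middle.
Proof. by rewrite /face_rule; do 5 (case: ifP => // _). Qed.

Lemma middle_kind d : lam d = 3 -> mu d = middle -> fan d || chain d.
Proof.
move=> d3 md; have [g1|g1] := ltnP (g (vert d)) 2; first by rewrite m_low in md.
have [l [r lr]] := group_legs pg tc L3 glev glev1 g1.
have := m_step g1 lr; rewrite md /step_mode.
have [[_ rl _ gr] [_ _ _ _ kind]] := lr; have [_ r3 _ _] := rP _ rl.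
case: ifP => _; case: ifP => _ //.
  case: ifP => [cr _|_ /eqP]; last by rewrite eq_sym (negbTE (flip_neq_middle _)) ?rule_neq_middle.
  case: kind => [[_ _ nch]|->//]; last by rewrite orbT.
  by have := nch _ gr r3; rewrite cr.
case: ifP => [fr _|_ /eqP]; last by rewrite eq_sym (negbTE (rule_neq_middle _ _ _ _ _ _ _)).
case: kind => [[_ only _]|ch]; last by rewrite (ch d) ?orbT.
by rewrite (@fan_vertex _ _ _ _ _ pg tc _ L3 _ glev glev1 d r) ?fr // (only _ erefl).
Qed.

Lemma mu_face d : lam d = 3 -> lam (ph d) = 3 -> mu (ph d) = mu d.
Proof.
by move=> d3 p3; have [gE _ _] := hor_nofan pg tc L3 glev glev1 d3 p3; rewrite (vert_ph pg) gE.
Qed.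

Definition legs_step l r := [/\ legs (g (vert r)) l r, g (vert l) = g (vert r)
  & mu r = step_mode al si ph lam mu l r].

Lemma left_step l : left_leg l -> exists r, legs_step l r.
Proof.
move=> ll; have g1 := left_level ll; have [l' [r lr]] := group_legs pg tc L3 glev glev1 g1.
have [[_ _ gl gr] [lu _ _ _ _]] := lr; have E := lu _ erefl ll; subst l'.
by exists r; split; rewrite ?gr // -(m_step g1 lr).
Qed.

Lemma right_step r : right_leg r -> exists l, legs_step l r.
Proof.
move=> ll; have g1 := right_level ll; have [l [r' lr]] := group_legs pg tc L3 glev glev1 g1.
have [[_ _ gl gr] [_ ru _ _ _]] := lr; have E := ru _ erefl ll; subst r'.
by exists l; split; rewrite // -(m_step g1 lr).
Qed.

Lemma face_uniq d d' : fconnect ph d d' -> lam d = lam d' -> lam d != 0 ->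
  lam (ph d) != 0 -> lam (ph d') != 0 -> lam (ph d) != lam d -> lam (ph d') != lam d' -> d = d'.
Proof.
move=> con dE d0 p0 p0' pd pd'; have [_ h _] := turns_unique pg tc L3 glev glev1.
apply: h => //; last by apply/eqP; rewrite (face_eq pg).
  by rewrite inE d0 lam_opp p0 eq_sym.
by rewrite inE -dE d0 lam_opp p0' eq_sym dE.
Qed.

(** By the tight count, labels never change along the inner edges of the faces at the apex. *)
Lemma inner_turn d w : lam d != 0 -> lam (ph d) != 0 -> lam (ph d) != lam d ->
  fconnect ph d w -> lam w != 0.
Proof.
move=> d0 p0 pd con; have [_ _ h] := turns_unique pg tc L3 glev glev1.
have : d \in face_turn al si vert L g.
  by rewrite inE d0 lam_opp p0 eq_sym.
move/h; rewrite inE => /andP[out _]; apply: contra out => w0; apply/imsetP.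
exists w; first by rewrite inE -(negbK (_ == _)) -lz w0.
by apply/eqP; rewrite (face_eq pg).
Qed.

Lemma tree_degree x : vert x != z -> #|[set d in tree_edges | fconnect si x d]| <= 4.
Proof.
move=> xz; have xv d : fconnect si x d -> vert d = vert x.
  by rewrite -(vertE pg) => /eqP.
have phE d : ph d = si (al d) by [].
apply: (@vertex_bound _ al si ph lam mu tree_edges (alK pg) siI phI phE).
- by move=> d dnz; exact: (quad_nz pg tc glev dnz).
- exact: face_uniq.
- by move=> d _ _; rewrite (vert_si pg).
- exact: mu_face.
- by move=> d d3; apply: (fan_chain pg tc L3 glev glev1 d3).
- exact: middle_kind.
- exact: tree_al.
- exact: tree_left.
- exact: tree_right.
- exact: tree_spoke.
- exact: tree_hor.
- move=> l /left_step[r [[[ll rl _ _] [_ _ fE con _]] gE mE]]; exists r.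
  by split; rewrite ?(vert_si pg) ?gE.
- move=> r /right_step[l [[[ll rl _ _] [_ _ fE con _]] gE mE]]; exists l.
  by split; rewrite ?(vert_si pg) ?gE.
- by move=> d /xv dv; rewrite lz dv.
- move=> d d' /xv dv /xv dv' dE sd sd'.
  by apply: (turn_uniq pg tc L3 glev glev1); rewrite ?dv ?dv'.
- by move=> d _; apply: tree_nz.
(* The label changes along [d], so by [inner_turn] its face avoids the apex and the preceding edge
   is inner. *)
- move=> d /xv dv [d2 s2 a1 p3].
  have fz w : fconnect ph d w -> lam w != 0 by apply: inner_turn; rewrite ?d2 ?p3.
  split=> //; left; rewrite nzE //; have [_ -> _] := face_prev pg d.
  by rewrite dv xz andbT -lz fz // fconnect_finv.
move=> d /xv dv [d1 s1 a3 p2].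
have ap : ph (al d) = si d by rewrite phE (alK pg).
rewrite nzE // (vert_si pg) dv xz /= -(vert_ph pg) -lz.
apply: (@inner_turn (al d)); rewrite ?ap ?a3 ?s1 //.
by apply: connect_trans (fconnect1 _ _) _; rewrite ap fconnect1.
Qed.

(* The hypotheses of [vertex_bound] also hold for the dual map and the co-tree. *)
Local Notation lam' := (swap12 \o lam).
Local Notation mu' := (flip \o mu).

Lemma nz_dual d : inner_edge al ph si lam' d = nz d.
Proof.
have s0 a : (swap12 a != 0) = (a != 0) by rewrite swap12_eq.
by rewrite /inner_edge /= !s0; case: (lam d != 0); case: (lam (si d) != 0);
  case: (lam (al d) != 0); case: (lam (ph d) != 0).
Qed.

Lemma left_leg_dual d : is_left_leg al ph si lam' d = left_leg (al d).
Proof.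
rewrite /is_left_leg nz_dual nz_opp; congr (_ && _).
rewrite /label_quad /= -/(ph d) (alK pg) [ph (al d)]/face_perm (alK pg) !inE !xpair_eqE !swap12_eq /=.
by case: (lam d == 2); case: (lam (ph d) == 3); case: (lam (al d) == 1); case: (lam (si d) == 1);
  case: (lam (si d) == 2).
Qed.

Lemma right_leg_dual d : is_right_leg al ph si lam' d = right_leg d.
Proof.
rewrite /is_right_leg nz_dual; congr (_ && _).
rewrite /label_quad /= !inE !xpair_eqE !swap12_eq /=.
by case: (lam d == 3); case: (lam (ph d) == 1); case: (lam (si d) == 2); case: (lam (al d) == 1);
  case: (lam (al d) == 2).
Qed.

Lemma fan_dual d : paired ph lam' d = chain d.
Proof. by rewrite /paired /= !swap12_eq. Qed.

Lemma chain_dual d : paired si lam' d = fan d.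
Proof. by rewrite /paired /= !swap12_eq. Qed.

Lemma swap12K : involutive swap12.
Proof. by case=> [|[|[|a]]]. Qed.

Lemma flipK : involutive flip.
Proof. by case=> [[]|]. Qed.

Lemma swap12_inj a b : swap12 a = swap12 b -> a = b.
Proof. exact: (can_inj swap12K). Qed.

Lemma flip_eq a b : (flip a == b) = (a == flip b).
Proof. by apply/eqP/eqP => [<-|->]; rewrite flipK. Qed.

Lemma dual_quad d : inner_edge al ph si lam' d -> label_quad al ph si lam' d \in quads.
Proof.
rewrite nz_dual => /(quad_nz pg tc glev); rewrite /edge_labels /label_quad /= /quads !inE.
by do ![case/orP]=> /eqP[-> -> -> ->].
Qed.

Lemma dual_uniq d d' : fconnect si d d' -> lam' d = lam' d' -> lam' d != 0 ->
  lam' (si d) != 0 -> lam' (si d') != 0 -> lam' (si d) != lam' d -> lam' (si d') != lam' d' -> d = d'.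
Proof.
rewrite -(vertE pg) /= !(inj_eq swap12_inj) => /eqP vE /swap12_inj dE d0 _ _ sd sd'.
apply: (turn_uniq pg tc L3 glev glev1) => //; rewrite -lz.
by apply: contraNneq d0 => ->.
Qed.

Lemma face_rule_eq (al' si' ph' : D -> D) (lam1 lam2 : D -> nat) (mu1 mu2 : D -> mode) l r :
  lam1 =1 lam2 -> mu1 =1 mu2 -> face_rule al' si' ph' lam1 mu1 l r = face_rule al' si' ph' lam2 mu2 l r.
Proof. by move=> lE mE; rewrite /face_rule !lE !mE. Qed.

(** Duality negates both label conditions of [step_mode], so the branch with both labels and the
    branch with neither change places; each is the flipped dual of the other. *)
Lemma step_mode_dual l r : left_leg l -> right_leg r ->
  step_mode al ph si lam' mu' (al l) r = flip (step_mode al si ph lam mu l r).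
Proof.
move=> ll rl; have pl : (lam (ph l) == 2) = (lam (ph l) != 1).
  move: ll; rewrite /is_left_leg /label_quad !inE => /andP[_ /orP[]/eqP[_ _ _ ->]] //.
have ar : (lam (al r) == 1) = (lam (al r) != 2).
  by move: rl; rewrite /is_right_leg /label_quad !inE => /andP[_ /orP[]/eqP[_ _ -> _]].
rewrite /step_mode /= -/(ph l) !swap12_eq /= pl ar !fan_dual !chain_dual (alK pg).
case: (lam (ph l) == 1); case: (lam (al r) == 2) => //=; case: ifP => // _.
  by rewrite flipK.
congr flip; apply: face_rule_eq => d /=; [exact: swap12K | exact: flipK].
Qed.

Lemma dual_mu_si d : lam' d = 3 -> lam' (ph d) = 3 -> mu' (ph d) = mu' d.
Proof. by move=> /= /eqP + /eqP; rewrite !swap12_eq => /eqP d3 /eqP p3; rewrite mu_face. Qed.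

Lemma dual_mu_ph d : lam' d = 3 -> lam' (si d) = 3 -> mu' (si d) = mu' d.
Proof. by move=> _ _ /=; rewrite (vert_si pg). Qed.

Lemma lam3_dual d : lam' d = 3 -> lam d = 3.
Proof. by move=> /= /eqP; rewrite swap12_eq => /eqP. Qed.

Lemma dual_fan_chain d : lam' d = 3 -> ~~ (paired ph lam' d && paired si lam' d).
Proof.
by move/lam3_dual => d3; rewrite fan_dual chain_dual andbC (fan_chain pg tc L3 glev glev1 d3).
Qed.

Lemma dual_middle d : lam' d = 3 -> mu' d = middle -> paired ph lam' d || paired si lam' d.
Proof.
move/lam3_dual => d3 /= /eqP; rewrite flip_eq => /eqP md.
by rewrite fan_dual chain_dual orbC middle_kind.
Qed.

Lemma dual_T_al d : (al d \in ~: tree_edges) = (d \in ~: tree_edges).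
Proof. by rewrite !in_setC tree_al. Qed.

(** In mode [middle] exactly one of [fan] and [chain] holds, so dropping both legs on one side is
    keeping both on the dual side. *)
Lemma mode_dual d : lam d = 3 -> ~~ ((mu d == left) || (mu d == middle) && ~~ fan d) =
  (mu' d == left) || (mu' d == middle) && ~~ paired ph lam' d.
Proof.
move=> d3; rewrite fan_dual /=; have := middle_kind d3; have := fan_chain pg tc L3 glev glev1 d3.
case: (m _) => [[]|] //= fc /(_ erefl); case: (fan d) fc; case: (chain d) => //=.
Qed.

Lemma mode_dual_right d : lam d = 3 -> ~~ ((mu d == right) || (mu d == middle) && ~~ fan d) =
  (mu' d == right) || (mu' d == middle) && ~~ paired ph lam' d.
Proof.
move=> d3; rewrite fan_dual /=; have := middle_kind d3; have := fan_chain pg tc L3 glev glev1 d3.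
case: (m _) => [[]|] //= fc /(_ erefl); case: (fan d) fc; case: (chain d) => //=.
Qed.

Lemma dual_T_left d : is_left_leg al ph si lam' d ->
  (d \in ~: tree_edges) = (mu' (ph d) == left) || (mu' (ph d) == middle) && ~~ paired ph lam' (ph d).
Proof.
rewrite left_leg_dual => ll; have [_ _ s3 _] := lP _ ll.
by rewrite -mode_dual // in_setC -tree_al tree_left.
Qed.

Lemma dual_T_right d : is_right_leg al ph si lam' d ->
  (d \in ~: tree_edges) = (mu' d == right) || (mu' d == middle) && ~~ paired ph lam' d.
Proof.
rewrite right_leg_dual => ll; have [_ s3 _ _] := rP _ ll.
by rewrite -mode_dual_right // in_setC tree_right.
Qed.

Lemma dual_T_spoke d : inner_edge al ph si lam' d -> label_quad al ph si lam' d = (3,3,2,1) ->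
  (d \in ~: tree_edges) = (mu' d == middle) && (lam' (finv ph d) == 1).
Proof.
rewrite nz_dual => dnz /eqP; rewrite /label_quad /= !xpair_eqE !swap12_eq /=.
case/andP=> /andP[/andP[/eqP d3 /eqP p3] /eqP a1] /eqP s2.
by rewrite in_setC tree_hor ?negbK ?flip_eq // /edge_labels d3 p3 a1 s2.
Qed.

Lemma dual_T_hor d : inner_edge al ph si lam' d -> label_quad al ph si lam' d = (3,2,1,3) ->
  (d \in ~: tree_edges) = ~~ ((mu' d == middle) && (lam' (isi d) == 2)).
Proof.
rewrite nz_dual => dnz /eqP; rewrite /label_quad /= !xpair_eqE !swap12_eq /=.
case/andP=> /andP[/andP[/eqP d3 /eqP p3] /eqP a1] /eqP s2.
by rewrite in_setC tree_spoke ?flip_eq // /edge_labels d3 p3 a1 s2.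
Qed.

Lemma dual_step l r : legs_step l r -> step al ph si lam' mu' (al l) r.
Proof.
move=> [[[ll rl _ _] [_ _ fE con kind]] gE mE].
have [lnz l1 sl3 _] := lP _ ll; have [_ r3 _ _] := rP _ rl.
have pE : ph (al l) = si l by rewrite /face_perm (alK pg).
have gs : g (vert (si l)) = g (vert r) by rewrite (vert_si pg).
have chE : chain (si l) = chain r.
  case: kind => [[_ _ nch]|ch]; last by rewrite !ch.
  by rewrite (negbTE (nch _ gs sl3)) (negbTE (nch _ erefl r3)).
split; rewrite ?left_leg_dual ?right_leg_dual ?fan_dual ?(alK pg) ?pE //=; first by rewrite gs.
rewrite step_mode_dual // mE; split=> // ncr.
case: kind => [[vE _ _]|ch]; last by rewrite ch in ncr.
by rewrite -(vertE pg) vE.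
Qed.

Lemma dual_step_left l : is_left_leg al ph si lam' l -> exists r, step al ph si lam' mu' l r.
Proof.
rewrite left_leg_dual => /left_step[r lr]; exists r.
by have := dual_step lr; rewrite (alK pg).
Qed.

Lemma dual_step_right r : is_right_leg al ph si lam' r -> exists l, step al ph si lam' mu' l r.
Proof. by rewrite right_leg_dual => /right_step[l lr]; exists (al l); apply: dual_step. Qed.

(* At the last vertex the rule looks at the mode of the apex, which was chosen accordingly. *)
Lemma dual_prev d : nz d -> label_quad al ph si lam' d = (2,2,1,3) ->
  inner_edge al ph si lam' (isi d) \/
  forall r, step al ph si lam' mu' (al d) r -> ~~ paired ph lam' r ->
    face_rule al ph si lam' mu' (al d) r <> left.
Proof.
rewrite nz_dual => dnz /eqP; rewrite /label_quad /= !xpair_eqE !swap12_eq /=.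
case/andP=> /andP[/andP[/eqP d1 _] _] _.
have pz : vert (isi d) != z by rewrite (isi_vert pg); move: dnz; rewrite nzE // => /andP[].
have [hz|hz] := eqVneq (hd (isi d)) z; last by left; rewrite nzE // pz.
right=> r [_ rl _ _ [con _]] nch; rewrite right_leg_dual in rl.
have [rnz r3 sr2 _] := rP _ rl.
have sp1 : lam (si (isi d)) = 1 by rewrite (f_finv siI).
have lp2 : lam (isi d) = 2.
  by case: (apex_lam pg tc L3 glev glev1 pz hz) => -[]; rewrite sp1.
rewrite /face_rule (alK pg) /= !swap12_eq /= lp2 /=.
have [//|ssr] := eqVneq (lam (si (si r))) 2.
have srE : si r = isi d.
  apply: (turn_uniq pg tc L3 glev glev1); rewrite ?sr2 ?lp2 ?sp1 //.
    apply/eqP; rewrite (vert_si pg) (isi_vert pg) (vertE pg).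
    by have := con nch; rewrite (alK pg).
  by rewrite (vert_si pg) -lz r3.
have /eqP pp0 : lam (ph (isi d)) == 0 by rewrite -(negbK (_ == 0)) lz (vert_ph pg) hz eqxx.
have /eqP ap0 : lam (al (isi d)) == 0 by rewrite -(negbK (_ == 0)) lz hz eqxx.
rewrite srE pp0 ap0 /= (vert_ph pg) hz.
have /eqP -> : g z == 0 by rewrite (g_eq0 glev).
by rewrite m_low.
Qed.

Lemma face_degree f : (forall w, fconnect ph f w -> vert w != z) ->
  #|[set d in ~: tree_edges | fconnect ph f d]| <= 4.
Proof.
move=> fz; have phE d : si d = ph (al d) by rewrite /face_perm (alK pg).
have fnz w : fconnect ph f w -> nz w.
  by move=> fw; rewrite nzE // fz // -(vert_ph pg) fz // (connect_trans fw) ?fconnect1.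
apply: (@vertex_bound _ al ph si lam' mu' (~: tree_edges) (alK pg) phI siI phE dual_quad dual_uniq
  dual_mu_si dual_mu_ph dual_fan_chain dual_middle dual_T_al dual_T_left dual_T_right dual_T_spoke
  dual_T_hor dual_step_left dual_step_right f).
- by move=> d fd; rewrite /= swap12_eq lz fz.
- move=> d d' fd fd' /= /swap12_inj dE; rewrite !(inj_eq swap12_inj) => pd pd'.
  apply: face_uniq; rewrite // ?lz ?fz //.
  + by apply: connect_trans fd'; rewrite fconnect_sym.
  + by apply: connect_trans fd (fconnect1 _ _).
  by apply: connect_trans fd' (fconnect1 _ _).
- by move=> d fd _; rewrite nz_dual fnz.
- move=> d fd dq; split; first exact: dual_prev (fnz _ fd) dq.
  by move=> w dw /=; rewrite swap12_eq lz; have := fz _ fd; rewrite -(vertE pg) in dw; rewrite (eqP dw).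
by move=> d fd _; rewrite nz_dual fnz // (connect_trans fd) ?fconnect1.
Qed.

(** As the labels of such a face are constant on its inner part, three quadruples remain. The dual
    forms of [first_upper] and [last_upper] and the rule for horizontal edges each force a change of
    label, except just before the edge from the last vertex to the apex. *)
Lemma outer_edge d w : nz d -> d \notin tree_edges -> fconnect ph d w -> vert w = z ->
  hd (ph d) = z /\ lam (ph d) = 2.
Proof.
move=> dnz dT dw wz; have phE d' : si d' = ph (al d') by rewrite /face_perm (alK pg).
have turn d' : fconnect ph d' w -> lam d' != 0 -> lam (ph d') != 0 -> lam (ph d') = lam d'.
  move=> dw' d0 p0; apply/eqP; apply/idPn => pd.
  by have := inner_turn d0 p0 pd dw'; rewrite lz wz eqxx.
have d'w : fconnect ph (finv ph d) w.
  by apply: connect_trans dw; rewrite -{2}(f_finv phI d) fconnect1.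
have pw : fconnect ph (ph d) w by rewrite -(same_fconnect1 phI).
have [dz hz] : vert d != z /\ hd d != z by move: dnz; rewrite nzE // => /andP[].
have d0 : lam d != 0 by rewrite lz.
have p0 : lam (ph d) != 0 by rewrite lz (vert_ph pg).
have pd := turn _ dw d0 p0.
have prev a : lam (finv ph d) = a -> a != 0 -> lam d = a.
  by move=> <- a0; have := turn _ d'w a0; rewrite (f_finv phI) => ->.
have dT' : d \in ~: tree_edges by rewrite in_setC.
have dnz' : inner_edge al ph si lam' d by rewrite nz_dual.
have dq := quad_nz pg tc glev dnz.
have : [\/ quad d = (1,3,2,1), quad d = (3,2,1,3) | quad d = (2,1,3,2)].
  move: dq; rewrite /edge_labels pd /quads !inE.
  by do ![case/orP]=> /eqP[d1 s1 a1 d1']; rewrite d1 // in d1' *; rewrite s1 a1;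
    [apply: Or31 | apply: Or32 | apply: Or33].
case=> qE; have [d1 s1 a1 p1] := qE.
- have gq : label_quad al ph si lam' d = (2,2,1,3) by rewrite /label_quad /= d1 s1 a1 p1.
  have fnz w' : fconnect si d w' -> lam' w' != 0.
    by rewrite -(vertE pg) /= swap12_eq lz => /eqP<-.
  have := first_upper (alK pg) phI siI phE dual_quad dual_uniq dual_T_al dual_T_left
    dual_step_left dnz' dT' gq (dual_prev dnz gq) fnz.
  by move/lam3_dual/prev => /(_ isT); rewrite d1.
- move: dT; rewrite (tree_hor dnz qE) negbK => /andP[_ /eqP/prev/(_ isT)].
  by rewrite d1.
have gq : label_quad al ph si lam' d = (1,1,3,2) by rewrite /label_quad /= d1 s1 a1 p1.
have [hp|hp] := eqVneq (hd (ph d)) z; first by rewrite p1.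
have pnz : inner_edge al ph si lam' (ph d) by rewrite nz_dual nzE // hp -lz p0.
have := last_upper (alK pg) phE dual_quad dual_T_al dual_T_right dual_step_right dnz' dT' gq pnz.
move/lam3_dual => pp3; have := turn _ pw p0; rewrite pp3 p1.
by move/(_ isT).
Qed.

(** By [outer_edge] every such dart is followed by the dart from the last vertex to the apex, which
    determines it. *)
Lemma outer_degree : #|[set d in ~: tree_edges | nz d && [exists w, fconnect ph d w && (vert w == z)]]| <= 1.
Proof.
apply/card_le1_eqP => d d' /setIdP[+ /andP[dnz /existsP[w /andP[dw /eqP wz]]]].
rewrite in_setC => dT /setIdP[+ /andP[dnz' /existsP[w' /andP[dw' /eqP wz']]]].
rewrite in_setC => dT'.
have [h p2] := outer_edge dnz dT dw wz; have [h' p2'] := outer_edge dnz' dT' dw' wz'.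
have top a : hd a = z -> lam a = 2 -> vert a = t.
  move=> ha a2; have az : vert a != z by rewrite -lz a2.
  have : up a by move: a2; rewrite /corner_label (negbTE az); case: (up a); case: (up (isi a)).
  by rewrite /upward ha az eqxx /= andbT => /eqP.
by apply: phI; apply: (simple_map pg); rewrite ?h ?h' // (top _ h p2) (top _ h' p2').
Qed.

End Tree.

(** * Size and connectivity of the tree *)

Section Spanning.
Variables (V D : finType) (al si : D -> D) (vert : D -> V).
Hypothesis pg : plane_graph al si vert.
Local Notation ph := (face_perm al si).
Local Notation e := (adj al vert).
Local Notation hd d := (vert (al d)).
Local Notation fpos := (face_pos al si vert).
Local Notation fseg := (face_seg al si vert).
Local Notation isi := (finv si).
Hypothesis tc : three_connected e.
Variable L : D.
Hypothesis L3 : order si L = 3.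
Local Notation z := (vert L).
Local Notation t := (hd (si L)).
Variable g : V -> nat.
Hypothesis glev : levels_from al si vert z t [set z] g.
Hypothesis glev1 : [set v | g v == 1] = fseg L 1 (order ph L).-1.
Let siI : injective si := si_inj pg.
Let phI : injective ph := face_perm_inj pg.
Local Notation up := (upward al si vert L g).
Local Notation lam := (corner_label al si vert L g).
Local Notation quad := (edge_labels al si vert L g).
Local Notation fan := (paired si lam).
Local Notation nz := (inner_edge al si ph lam).
Local Notation left_leg := (is_left_leg al si ph lam).
Local Notation legs := (legs_of al si vert L g).
Variable m : nat -> mode.
Hypothesis m_low : forall k, k < 2 -> m k = right.
Local Notation mu := (fun d => m (g (vert d))).
Hypothesis m_step : forall k l r, 1 < k -> legs k l r -> m k = step_mode al si ph lam mu l r.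
Local Notation tree := (tree_edges al si vert L g m).
Local Notation parent_edge := (tree_rule al si vert L g m).

Let lP := left_legP pg tc glev.
Let rP := right_legP pg tc glev.

(* [d] is the edge at [vert d] leading towards the root. *)
Definition parent d : bool :=
  if mu d == left then (lam d == 1) && (lam (si d) == 3)
  else if mu d == right then (lam d == 3) && (lam (si d) == 2)
  else [|| [&& lam d == 3, lam (si d) == 3 & lam (isi d) == 1],
           left_leg d && ~~ fan (si d)
         | [&& lam d == 3, lam (si d) == 2, ~~ fan d & ~~ left_leg (isi d)]].

Lemma mode_cases a : [\/ a = left, a = right | a = middle].
Proof. by case: a => [[]|]; [apply: Or31 | apply: Or32 | apply: Or33]. Qed.

(** In mode [middle] the three alternatives are told apart by [fan] and by whether the only corner
    labelled 3 follows a left leg. *)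
Lemma parent_uniq d d' : vert d = vert d' -> parent d -> parent d' -> d = d'.
Proof.
move=> vE; rewrite /parent /= vE.
have LL c c' : vert c = vert c' -> lam c = 1 -> lam (si c) = 3 -> lam c' = 1 -> lam (si c') = 3 -> c = c'.
  by move=> ? ? ? ? ?; apply: (left_uniq pg tc L3 glev glev1).
have RR c c' : vert c = vert c' -> lam c = 3 -> lam (si c) = 2 -> lam c' = 3 -> lam (si c') = 2 -> c = c'.
  by move=> ? ? s2 ? s2'; apply: (right_uniq pg tc L3 glev glev1); rewrite ?s2 ?s2'.
have FF c c' : vert c = vert c' -> lam c = 3 -> lam c' = 3 -> fan c = fan c'.
  by move=> ? ? ?; apply: (fan_vertex pg tc L3 glev glev1).
have LR c b : vert c = vert b -> left_leg c -> ~~ fan (si c) -> lam b = 3 -> lam (si b) = 2 -> left_leg (isi b).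
  move=> cb ll nf b3 sb2; have [_ _ sc3 _] := lP _ ll.
  have [ss3 _] : lam (si (si c)) <> 3 /\ True.
    by split=> // E; move: nf; rewrite /paired E.
  suff <- : si c = b by rewrite (finv_f siI).
  apply: (right_uniq pg tc L3 glev glev1); rewrite ?sb2 ?(vert_si pg) //.
  exact/eqP.
case: ifP => _; first by move=> /andP[/eqP ? /eqP ?] /andP[/eqP ? /eqP ?]; apply: LL.
case: ifP => _; first by move=> /andP[/eqP ? /eqP ?] /andP[/eqP ? /eqP ?]; apply: RR.
have SN c c' : vert c = vert c' -> lam c = 3 -> lam (si c) = 3 -> lam c' = 3 -> fan c'.
  by move=> cc c3 s3 c3'; rewrite -(FF _ _ cc c3 c3') /paired s3.
case/or3P => [/and3P[/eqP d3 /eqP s3 /eqP i1]|/andP[ll nf]|/and4P[/eqP d3 /eqP s2 nf nl]];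
  case/or3P => [/and3P[/eqP d3' /eqP s3' /eqP i1']|/andP[ll' nf']|/and4P[/eqP d3' /eqP s2' nf' nl']].
- by apply: (can_inj (f_finv siI)); apply: LL; rewrite ?(isi_vert pg) ?(f_finv siI).
- by case/negP: nf'; have [_ _ ? _] := lP _ ll'; apply: SN d3 s3 _; rewrite ?(vert_si pg).
- by case/negP: nf'; apply: SN d3 s3 _.
- by case/negP: nf; have [_ _ ? _] := lP _ ll; apply: SN d3' s3' _; rewrite ?(vert_si pg).
- by have [_ ? ? _] := lP _ ll; have [_ ? ? _] := lP _ ll'; apply: LL.
- by case/negP: nl'; apply: (LR d).
- by case/negP: nf; apply: SN d3' s3' _.
- by case/negP: nl; apply: (LR d').
exact: RR.
Qed.

(** The second alternative is for horizontal edges, which lead towards the left leg in mode [left]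
    and towards the right leg otherwise. *)
Lemma parent_edgeP d : nz d -> parent_edge d -> parent d || parent (al d).
Proof.
move=> dnz; rewrite /tree_rule.
case: ifP => [ll|_].
  have [_ d1 s3 _] := lP _ ll.
  case/orP => [/eqP E|/andP[/eqP E nf]]; rewrite /parent E; first by rewrite d1 s3.
  by rewrite ll nf orbT.
case: ifP => [rl|_].
  have [_ d3 s2 p1] := rP _ rl.
  case/orP => [/eqP E|/andP[/eqP E nf]]; rewrite /parent E; first by rewrite d3 s2.
  have := middle_kind pg tc L3 glev glev1 m_low m_step d3 E; rewrite (negbTE nf).
  case/(chainP pg d3) => w [w3 p3 [wd|wd]]; first by rewrite -wd p3 in p1.
  have nl : ~~ left_leg (isi d).
    by apply/negP => /lP[_ _ _]; rewrite -wd /face_perm (finv_f siI) (alK pg) w3.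
  by rewrite d3 s2 nl !orbT.
case: ifP => [/eqP[d3 s3 a2 p1] /andP[/eqP E /eqP i1]|_].
  by rewrite /parent E d3 s3 i1.
case/andP=> /eqP[d3 s2 a1 p3] nm.
have [gE nf _] := hor_nofan pg tc L3 glev glev1 d3 p3.
have [E|E|E] := mode_cases (mu d); rewrite /parent -gE E.
- by rewrite a1 -/(ph d) p3 orbT.
- by rewrite d3 s2.
rewrite E /= in nm.
have nl : ~~ left_leg (isi d).
  apply/negP => /lP[_ _ _]; have [_ _ <-] := face_prev pg d.
  by rewrite (alK pg) => E2; rewrite E2 in nm.
by rewrite d3 s2 (nf d) // nl !orbT.
Qed.

Local Notation root := (hd (isi L)).

(** Every tree edge is the parent edge of one of its ends. The apex has none, and that of the root
    would be the edge to the apex, which is not inner. *)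
Lemma tree_card : #|tree| <= (#|V| - 2).*2.
Proof.
pose A := [set d in tree | parent d].
have cover : tree \subset A :|: al @: A.
  apply/subsetP => d dT; have dT' := dT; move: dT'; rewrite inE => /andP[dnz dp].
  have : parent d || parent (al d).
    case/orP: dp => [/(parent_edgeP dnz)//|].
    by move=> pd; have := parent_edgeP _ pd; rewrite nz_opp // (alK pg) orbC; apply.
  case/orP => p; apply/setUP; [left | right]; first by apply/setIdP.
  apply/imsetP; exists (al d); last by rewrite (alK pg).
  by apply/setIdP; rewrite tree_al.
have rz : root != z by have := vert_al pg (isi L); rewrite (isi_vert pg).
suff cA : #|A| <= #|V| - 2.
  have := subset_leq_card cover; rewrite cardsU.
  have := leq_imset_card al A; move: cA; clear; lia.
have vA : {in A &, injective vert}.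
  by move=> d d' /setIdP[_ p] /setIdP[_ p'] E; apply: parent_uniq.
rewrite -(card_in_imset vA).
have <- : #|~: [set z; root]| = #|V| - 2.
  by rewrite -(cardsC [set z; root]) cards2 eq_sym rz addKn.
apply/subset_leq_card/subsetP => _ /imsetP[d /setIdP[dT dp] ->].
have dnz := tree_nz dT; have := dnz; rewrite nzE // => /andP[dz hz].
rewrite in_setC in_set2 negb_or dz /=; apply/eqP => vr.
have ch := first_chain pg tc L3 glev glev1; set M := (order ph L).-1 in ch.
have [[M1 _ _ _ _] _ _] := ch.
have iM : 0 < M <= M by rewrite leqnn ltnW.
have [_ b3 sb2 _] := chain_corner pg tc glev ch isT iM.
have ME : al (iter M ph L) = isi L by have [_ _] := face_prev pg L.
have vE : vert d = vert (iter M ph L) by rewrite vr -ME (alK pg).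
have g1 : g (vert d) = 1 by rewrite vE; apply: (chain_level ch iM).
move: dp; rewrite /parent /= g1 m_low //= => /andP[/eqP d3 /eqP s2].
have dE : d = iter M ph L by apply: (right_uniq pg tc L3 glev glev1); rewrite ?s2 ?sb2.
by move: hz; rewrite dE ME (isi_vert pg) eqxx.
Qed.

Local Notation adjT := (sub_adj al vert tree).

Lemma adjT_sym : connect_sym adjT.
Proof.
apply: sym_connect_sym => u v; apply/existsP/existsP => -[d /and3P[dT /eqP du /eqP dv]];
  by exists (al d); rewrite tree_al // (alK pg) dT du dv !eqxx.
Qed.

Lemma tree_adj d : d \in tree -> adjT (vert d) (hd d).
Proof. by move=> dT; apply/existsP; exists d; rewrite dT !eqxx. Qed.

Section Run.
Variables (k : nat) (L' : D) (M : nat).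
Hypothesis chg : chain_group al si vert [set u | g u < k] [set u | g u == k] L' M.
Hypothesis k0 : 0 < k.

Lemma run_hor i : 0 < i < M -> nz (iter i ph L') /\ quad (iter i ph L') = (3,2,1,3).
Proof.
case/andP=> i0 iM; have im : 0 < i <= M by rewrite i0 ltnW.
have [_ l3 _ _] := chain_corner pg tc glev chg k0 im.
have [_ p3 _ _] := @chain_corner _ _ _ _ _ pg tc _ _ glev _ _ _ chg k0 i.+1 iM.
have [-> _] := hor_quad pg tc glev l3 p3; split=> //.
rewrite nzE // -(vert_ph pg) -iterS; apply/andP; split.
  exact: (chain_neqz glev chg k0 im).
exact: (chain_neqz glev chg k0 (i := i.+1)).
Qed.

Lemma run_tree i : 0 < i < M -> (1 < i) || (m k != middle) -> iter i ph L' \in tree.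
Proof.
move=> iM im; have [inz iq] := run_hor iM; case/andP: iM => i0 iM.
have i_m : 0 < i <= M by rewrite i0 ltnW.
rewrite (tree_hor pg tc glev m inz iq); case/orP: im => [i1|]; last first.
  by rewrite -/(fpos L' i) (chain_level chg i_m) => /negbTE->.
have im1 : 0 < i.-1 <= M by lia.
have [_ l3 _ _] := chain_corner pg tc glev chg k0 im1.
by rewrite -{2}(prednK i0) iterS (finv_f phI) l3 andbF.
Qed.

Lemma run_connect i : 0 < i <= M -> (1 < i) || (m k != middle) ->
  connect adjT (fpos L' i) (fpos L' M).
Proof.
move=> /andP[i0 iM] im; have [n nE] : exists n, n = M - i by exists (M - i).
elim: n i i0 iM im nE => [|n IH] i i0 iM im nE.
  by have -> : i = M by [lia|].
have iM' : 0 < i < M by lia.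
apply: connect_trans (IH i.+1 _ _ _ _); try lia.
- by apply: connect1; rewrite /fpos iterS (vert_ph pg); apply: tree_adj; apply: run_tree.
Qed.

End Run.

(** Induction on the level. A chain is followed to an end whose leg is kept; in mode [middle] its
    first vertex uses the left leg and all others run to the right leg. *)
Lemma tree_root v : v != z -> connect adjT v root.
Proof.
have [n] := ubnP (g v); elim: n v => // n IH v gn vz.
have low d : d \in tree -> g (hd d) < g (vert d) -> g (vert d) = g v -> connect adjT (vert d) root.
  move=> dT down gE; apply: connect_trans (connect1 (tree_adj dT)) (IH _ _ _).
    by apply: leq_trans down _; rewrite gE -ltnS.
  by have := tree_nz dT; rewrite nzE // => /andP[].
have [g1|g1] := eqVneq (g v) 1.
  have ch := first_chain pg tc L3 glev glev1.
  have [i im vE] := chain_pos ch g1; rewrite vE.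
  have -> : root = fpos L (order ph L).-1.
    by have [_ _ <-] := face_prev pg L; rewrite (alK pg).
  by apply: (run_connect ch isT im); rewrite m_low // orbT.
have k1 : 1 < g v by have := vz; rewrite -(g_gt0 glev); case: (g v) g1 => [|[|]].
have k0 : 0 < g v by apply: ltnW.
have [single|[L' [M [i [chg im vE _]]]]] := group_kind glev vz.
  have only u : g u = g v -> u = v by move=> gu; apply/set1P; rewrite -single inE gu.
  have [l [r [[ll rl gl gr] _]]] := group_legs pg tc L3 glev glev1 k1.
  have lv := only _ gl; have rv := only _ gr.
  have [lnz l1 s3 _] := lP _ ll.
  have ldown := left_leg_down pg tc glev ll.
  have lT := tree_left pg tc glev m ll; rewrite /= (vert_si pg) gl in lT.
  have [E|E|E] := mode_cases (m (g v)); rewrite E /= in lT.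
  - by rewrite -lv; apply: low; rewrite ?lT.
  - rewrite -rv; apply: (low r _ (right_leg_down pg tc glev rl) gr).
    by rewrite (tree_right pg tc glev m rl) /= gr E.
  have [fs|nf] := boolP (fan (si l)); last by rewrite -lv; apply: low; rewrite ?lT ?nf.
  have sv : vert (si l) = v by rewrite (vert_si pg).
  have sz : vert (si l) != z by rewrite sv.
  have ss3 : lam (si (si l)) = 3 by move: fs; rewrite /paired (finv_f siI) l1 orbF => /eqP.
  have nu : ~~ up (si l) by have /eqP := s3; rewrite (lam3E al si g sz) => /andP[].
  have snz : nz (si l) by rewrite nzE // sz (nz_base pg tc L3 glev glev1) ?sv.
  have sq : quad (si l) = (3,3,2,1).
    have := quad_nz pg tc glev snz; rewrite /edge_labels s3 ss3 /quads !inE.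
    by do ![case/orP]=> /eqP[] // -> ->.
  have [_ _ a2 p1] := sq.
  rewrite -sv; apply: low; rewrite ?sv //; last by rewrite -sv (base_down pg tc glev) ?a2 ?p1.
  by rewrite (tree_spoke pg tc glev m snz sq) /= sv E (finv_f siI) l1.
have [ll rl gl gr] := chain_legs pg tc L3 glev glev1 chg k0 k1.
have [[M1 _ _ _ _] _ _] := chg.
have i1 : 0 < 1 <= M by rewrite (ltnW M1).
have iM : 0 < M <= M by rewrite leqnn (ltnW M1).
have [_ a3 _ as3] := chain_corner pg tc glev chg k0 i1.
have [_ b3 _ _] := chain_corner pg tc glev chg k0 iM.
have f1 : vert (al L') = fpos L' 1 by rewrite /face_pos /= (vert_ph pg).
have nofan d : g (vert d) = g v -> lam d = 3 -> ~~ fan d.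
  move=> gd d3; have := fan_chain pg tc L3 glev glev1 d3.
  by rewrite (chain_chain pg tc L3 glev chg k0 gd d3) andbT.
have lT : (al L' \in tree) = (m (g v) != right).
  rewrite (tree_left pg tc glev m ll) /= (vert_si pg) gl nofan ?(vert_si pg) ?as3 // andbT.
  by case: (m _) => [[]|].
have rT : (iter M ph L' \in tree) = (m (g v) != left).
  rewrite (tree_right pg tc glev m rl) /= -/(fpos L' M) gr nofan // andbT.
  by case: (m _) => [[]|].
have toL : m (g v) != right -> connect adjT (fpos L' 1) root.
  by move=> E; rewrite -f1; apply: low; rewrite ?lT // (left_leg_down pg tc glev ll).
have toR : m (g v) != left -> connect adjT (fpos L' M) root.
  by move=> E; apply: (low (iter M ph L')); rewrite ?rT // (right_leg_down pg tc glev rl).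
rewrite vE; have [E|E|E] := mode_cases (m (g v)).
- have nm : m (g v) != middle by rewrite E.
  apply: connect_trans (run_connect chg k0 im _) _; first by rewrite nm orbT.
  apply: connect_trans (toL _); last by rewrite E.
  by rewrite adjT_sym; apply: (run_connect chg k0 i1); rewrite nm orbT.
- apply: connect_trans (run_connect chg k0 im _) (toR _); by rewrite E ?orbT.
have [i_1|i_1] := ltnP 1 i.
  by apply: connect_trans (run_connect chg k0 im _) (toR _); rewrite ?E ?i_1.
have -> : i = 1 by case/andP: im => i0 _; apply/eqP; rewrite eqn_leq i_1 i0.
by apply: toL; rewrite E.
Qed.

End Spanning.

Lemma connect_invariant (T : finType) (r : rel T) (P : pred T) x y :
  (forall a b, P a -> r a b -> P b) -> P x -> connect r x y -> P y.
Proof.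
move=> cl Px /connectP[p + ->]; elim: p x Px => //= a p IH x Px /andP[xa ap].
by apply: IH ap; apply: cl xa.
Qed.

(** * Acyclicity by counting edges *)

Section Counting.
Variables (V D : finType) (al : D -> D) (vert : D -> V).
Hypotheses (alK : involutive al) (al_neq : forall d, al d != d).
Local Notation adjT := (sub_adj al vert).

Lemma sub_adj_sym (T : {set D}) : edge_set al T -> symmetric (adjT T).
Proof.
move=> eT u v; apply/existsP/existsP => -[d /and3P[dT /eqP du /eqP dv]];
  by exists (al d); rewrite eT alK dT du dv !eqxx.
Qed.

Lemma sub_adj_del (T : {set D}) d u v : adjT T u v ->
  [\/ adjT (T :\ d :\ al d) u v, u = vert d /\ v = vert (al d) | u = vert (al d) /\ v = vert d].
Proof.
case/existsP=> a /and3P[aT /eqP au /eqP av].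
have [ad|ad] := eqVneq a d; first by apply: Or32; rewrite -au -av ad.
have [aad|aad] := eqVneq a (al d); first by apply: Or33; rewrite -au -av aad alK.
by apply: Or31; apply/existsP; exists a; rewrite !in_setD1 ad aad aT au av !eqxx.
Qed.

Lemma sub_adj_sub (T T' : {set D}) : T \subset T' -> subrel (adjT T) (adjT T').
Proof.
move=> TT' u v /existsP[a /and3P[aT au av]]; apply/existsP; exists a.
by rewrite (subsetP TT') // au av.
Qed.

Lemma card_del (T : {set D}) d : edge_set al T -> d \in T -> #|T| = #|T :\ d :\ al d| + 2.
Proof.
move=> eT dT; rewrite (cardsD1 d) dT (cardsD1 (al d) (T :\ d)) in_setD1 al_neq eT dT /=.
by rewrite addnA addnC.
Qed.

Lemma nclass_edges (T : {set D}) : edge_set al T -> (#|V|).*2 <= #|T| + (nclass (adjT T)).*2.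
Proof.
have [n] := ubnP #|T|; elim: n T => // n IH T Tn eT.
have [T0|[d dT]] := set_0Vmem T.
  apply: leq_trans (leq_addl _ _); rewrite leq_double.
  apply: (@nclass_ge _ _ _ (sub_adj_sym eT) id) => [x|x y]; first by exists x.
  case/connectP=> -[_ -> //|a p /= /andP[/existsP[b]]].
  by rewrite T0 in_set0.
have eT' : edge_set al (T :\ d :\ al d) by apply: edge_setD2.
have cT := card_del eT dT.
have := IH _ _ eT'; rewrite cT in Tn *.
have := @nclass_add _ (adjT (T :\ d :\ al d)) (adjT T) (vert d) (vert (al d)) (sub_adj_sym eT') (sub_adj_sym eT).
have sT : subrel (adjT (T :\ d :\ al d)) (adjT T).
  by apply: sub_adj_sub; apply: subset_trans (subsetDl _ _) (subsetDl _ _).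
move/(_ sT (@sub_adj_del T d)).
move: Tn; clear; lia.
Qed.

(** Deleting an edge that is not a bridge would leave a connected graph with fewer than [#|V| - 1]
    edges. *)
Lemma bridges_of_card (T : {set D}) : edge_set al T -> #|T| <= (#|V| - 1).*2 ->
    (forall u v, connect (adjT T) u v) ->
  forall d, d \in T -> ~~ connect (adjT (T :\ d :\ al d)) (vert d) (vert (al d)).
Proof.
move=> eT cT con d dT; apply/negP => cd.
have eT' : edge_set al (T :\ d :\ al d) by apply: edge_setD2.
have sT' := sub_adj_sym eT'; have cS := sym_connect_sym sT'.
have con' u v : connect (adjT (T :\ d :\ al d)) u v.
  have near w : connect (adjT (T :\ d :\ al d)) (vert d) w \/
      connect (adjT (T :\ d :\ al d)) (vert (al d)) w -> connect (adjT (T :\ d :\ al d)) (vert d) w.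
    by case=> // ?; apply: connect_trans cd _.
  have [//|[/near nu /near nv]] := connect_add sT' (@sub_adj_del T d) (con u v).
  by apply: connect_trans nv; rewrite cS.
have n1 : nclass (adjT (T :\ d :\ al d)) <= 1.
  by rewrite -card_unit; apply: (nclass_le sT' (f := fun=> tt)).
have := nclass_edges eT'; have := card_del eT dT.
have : 0 < #|V| by apply/card_gt0P; exists (vert d).
move: n1 cT; clear; lia.
Qed.

End Counting.

(** The last clause bounds the three faces at the apex together, because they become one face when
    the apex is removed. *)
Lemma apex_tree (V D : finType) (al si : D -> D) (vert : D -> V) (L : D) (ph := face_perm al si) :
    plane_graph al si vert -> three_connected (adj al vert) -> order si L = 3 ->
  exists T : {set D},
    [/\ edge_set al T, #|T| <= (#|V| - 2).*2,
        forall u v, u != vert L -> v != vert L -> connect (sub_adj al vert T) u v,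
        forall v, v != vert L -> tree_deg vert T v <= 4
      & (forall d, d \in T -> vert d != vert L) /\
        (forall f, (forall w, fconnect ph f w -> vert w != vert L) -> cotree_deg al si T f <= 4) /\
        #|[set d in ~: T | [&& vert d != vert L, vert (al d) != vert L &
             [exists w, fconnect ph d w && (vert w == vert L)]]]| <= 1].
Proof.
move=> pg tc L3; have [g [glev glev1]] := exists_levels pg tc L3.
have [m [m_low m_step]] := exists_modes pg tc L3 glev glev1.
exists (tree_edges al si vert L g m); split.
- exact: (tree_al pg L g m).
- exact: (tree_card pg tc L3 glev glev1 m_low m_step).
- move=> u v uz vz.
  have cu := tree_root pg tc L3 glev glev1 m_low uz.
  have := tree_root pg tc L3 glev glev1 m_low vz.
  by rewrite (adjT_sym pg L g m); apply: connect_trans cu.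
- move=> v; have [x <-] := vert_surj pg v => xz.
  have := tree_degree pg tc L3 glev glev1 m_low m_step xz.
  apply: leq_trans; apply/subset_leq_card/subsetP => d /setIdP[dT /eqP dx].
  by apply/setIdP; rewrite dT -(vertE pg) dx.
split; last split.
- by move=> d /tree_nz; rewrite nzE // => /andP[].
- move=> f fz; apply: leq_trans (face_degree pg tc L3 glev glev1 m_low m_step fz).
  apply/subset_leq_card/subsetP => d; rewrite inE => /andP[fd dT].
  by apply/setIdP; rewrite in_setC dT.
apply: leq_trans (outer_degree pg tc L3 glev glev1 m_low m_step).
apply/subset_leq_card/subsetP => d /setIdP[dT /and3P[dz hz dw]].
by apply/setIdP; rewrite dT nzE // dz hz.
Qed.

(** * Adding the apex *)

Lemma nclass_ge_image (T U : finType) (r : rel T) (f : T -> U) : symmetric r ->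
  (forall x y, connect r x y -> f x = f y) -> #|[set f x | x : T]| <= nclass r.
Proof.
move=> rS fE; pose K : finType := {u | u \in [set f x | x : T]}.
have fx x : f x \in [set f x | x : T] by apply: imset_f.
pose h x : K := exist _ (f x) (fx x).
rewrite -card_sig; apply: (@nclass_ge _ K _ rS h) => [[u uP]|x y xy]; last exact/val_inj/fE.
by have /imsetP[x _ uE] := uP; exists x; apply: val_inj; rewrite /= uE.
Qed.

Section Apex.
Variables (V D : finType) (al si : D -> D) (vert : D -> V).
Hypothesis pg : plane_graph al si vert.
Local Notation ph := (face_perm al si).
Local Notation isi := (finv si).
Variables (o : D) (c : 'I_3 -> D) (lab : D -> 'I_3).
Hypothesis c_inj : injective (vert \o c).
Hypothesis c_face : forall i, fconnect ph o (c i).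
(** On the outer face, [lab d] names the corner that starts the piece of the boundary containing
    [d]. *)
Hypothesis lab_c : forall i, lab (c i) = i.
Hypothesis lab_prev : forall d i, ph d = c i -> lab d = ord_pred i.
Hypothesis lab_ph : forall d, fconnect ph o d -> (forall i, ph d != c i) -> lab (ph d) = lab d.
Let siI : injective si := si_inj pg.
Let phI : injective ph := face_perm_inj pg.

(* [inr (true, i)] is the half-edge at [vert (c i)] inserted just before the dart [c i] of the outer
   face, and [inr (false, i)] is its opposite at the apex. *)
Definition apexD : finType := (D + bool * 'I_3)%type.

Definition ap_al (d : apexD) : apexD :=
  match d with inl d => inl (al d) | inr (b, i) => inr (~~ b, i) end.
Definition ap_vert (d : apexD) : option V :=
  match d with inl d => Some (vert d) | inr (b, i) => if b then Some (vert (c i)) else None end.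
Definition ap_si (d : apexD) : apexD :=
  match d with
  | inl d => if [pick i | c i == si d] is Some i then inr (true, i) else inl (si d)
  | inr (b, i) => if b then inl (c i) else inr (false, ord_pred i)
  end.
Definition ap_isi (d : apexD) : apexD :=
  match d with
  | inl d => if [pick i | c i == d] is Some i then inr (true, i) else inl (isi d)
  | inr (b, i) => if b then inl (isi (c i)) else inr (false, ordS i)
  end.
Local Notation ap_ph := (face_perm ap_al ap_si).

Let cI : injective c.
Proof. by move=> i j E; apply: c_inj; rewrite /= E. Qed.

Lemma ap_alK : involutive ap_al.
Proof. by case=> [d|[b i]] /=; rewrite ?(alK pg) ?negbK. Qed.

Lemma ap_al_neq d : ap_al d != d.
Proof.
case: d => [d|[b i]] /=; first by rewrite (inj_eq (@inl_inj _ _)) (al_neq pg).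
by rewrite (inj_eq (@inr_inj _ _)) xpair_eqE; case: b.
Qed.

Lemma pick_c i : [pick j | c j == c i] = Some i.
Proof. by case: pickP => [j /eqP/cI->|/(_ i)] //; rewrite eqxx. Qed.

Lemma ap_siK : cancel ap_si ap_isi.
Proof.
case=> [d|[[] i]] /=; last by rewrite ordSK || rewrite ord_predK.
  case: pickP => [i /eqP E|none] /=; first by rewrite E (finv_f siI).
  by case: pickP => [i|_]; rewrite ?none // (finv_f siI).
by rewrite pick_c.
Qed.

Lemma ap_siI : injective ap_si.
Proof. exact: can_inj ap_siK. Qed.

Lemma ap_phI : injective ap_ph.
Proof. exact: ph_inj ap_alK ap_siI. Qed.

Lemma ap_vert_si d : ap_vert (ap_si d) = ap_vert d.
Proof.
case: d => [d|[[] i]] //=; case: pickP => [i /eqP E|_] /=; last by rewrite (vert_si pg).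
by rewrite E (vert_si pg).
Qed.

Lemma ap_si_inl d d' : fconnect si d d' -> fconnect ap_si (inl d) (inl d').
Proof.
apply: (@connect_invariant _ _ (fun d' => fconnect ap_si (inl d) (inl d'))); last exact: connect0.
move=> a b da /eqP <-; apply: connect_trans da _.
have : fconnect ap_si (inl a) (ap_si (inl a)) by apply: fconnect1.
rewrite /=; case: pickP => [i /eqP E|_] // h; apply: connect_trans h _.
by rewrite -E; apply: (fconnect1 ap_si (inr (true, i))).
Qed.

Lemma ap_si_c i : fconnect ap_si (inr (true, i)) (inl (c i)).
Proof. exact: (fconnect1 ap_si (inr (true, i))). Qed.

Lemma ap_vertE d d' : (ap_vert d == ap_vert d') = fconnect ap_si d d'.
Proof.
apply/eqP/idP => [|con]; last first.
  apply/eqP; apply: (@connect_invariant _ _ (fun d' => ap_vert d == ap_vert d')) con => //.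
  by move=> a b /eqP-> /eqP <-; rewrite ap_vert_si.
have sC := fconnect_sym ap_siI.
have inlP a b : vert a = vert b -> fconnect ap_si (inl a) (inl b).
  by move=> /eqP; rewrite (vertE pg) => /ap_si_inl.
have apex i j : fconnect ap_si (inr (false, i)) (inr (false, j)).
  have step k : fconnect ap_si (inr (false, k)) (inr (false, ord_pred k)).
    exact: (fconnect1 ap_si (inr (false, k))).
  have [->|[->|->]] : j = i \/ j = ord_pred i \/ j = ord_pred (ord_pred i).
    case: i j => [[|[|[|i]]] Hi] [[|[|[|j]]] Hj] //; by [left; apply: val_inj
      | right; left; apply: val_inj | right; right; apply: val_inj].
  - exact: connect0.
  - exact: step.
  exact: connect_trans (step i) (step _).
case: d d' => [a|[[] i]] [b|[[] j]] //=.
- by case=> /inlP.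
- by case=> /inlP h; apply: connect_trans h _; rewrite sC ap_si_c.
- by case=> /inlP h; apply: connect_trans (ap_si_c i) h.
by case=> /c_inj->; apply: connect0.
Qed.

Let ap_link := fun x y => (y == ap_si x) || (y == ap_al x).

Lemma ap_connected d d' : connect ap_link d d'.
Proof.
have link_si x : connect ap_link x (ap_si x) by apply: connect1; rewrite /ap_link eqxx.
have link_al x : connect ap_link x (ap_al x) by apply: connect1; rewrite /ap_link eqxx orbT.
have link_orbit x y : fconnect ap_si x y -> connect ap_link x y.
  apply: (@connect_invariant _ _ (fun y => connect ap_link x y)); last exact: connect0.
  by move=> a b xa /eqP <-; apply: connect_trans xa _.
have inner a b : connect ap_link (inl a) (inl b).
  have [_ _ con _ _] := pg; have := con a b.
  apply: (@connect_invariant _ _ (fun b => connect ap_link (inl a) (inl b))); last exact: connect0.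
  move=> u v au /orP[]/eqP->; apply: connect_trans au _; last exact: (link_al (inl u)).
  by apply: link_orbit; apply: ap_si_inl; apply: fconnect1.
have to_inner x : exists a, connect ap_link x (inl a).
  case: x => [a|[b i]]; first by exists a; apply: connect0.
  exists (c i); have h : connect ap_link (inr (true, i)) (inl (c i)) by apply: (link_si (inr (true, i))).
  by case: b => //; apply: connect_trans (link_al (inr (false, i))) h.
have from_inner x : exists a, connect ap_link (inl a) x.
  case: x => [a|[b i]]; first by exists a; apply: connect0.
  exists (c i); have h : connect ap_link (inl (c i)) (inr (true, i)).
    by apply: link_orbit; rewrite (fconnect_sym ap_siI) ap_si_c.
  by case: b => //; apply: connect_trans h (link_al (inr (true, i))).
have [a da] := to_inner d; have [b bd'] := from_inner d'.
by apply: connect_trans da (connect_trans (inner a b) bd').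
Qed.

Lemma ap_ph_inl d : ap_ph (inl d) = if [pick i | c i == ph d] is Some i then inr (true, i) else inl (ph d).
Proof. by []. Qed.

Lemma ap_ph_al x : ap_si x = ap_ph (ap_al x).
Proof. by rewrite /face_perm ap_alK. Qed.

Let in_outer d i : ph d = c i -> fconnect ph o d.
Proof. by move=> E; rewrite (same_fconnect1_r phI) E. Qed.

(* The three new edges cut the outer face into three. *)
Definition apex_face (x : apexD) : {set D} + 'I_3 :=
  match x with
  | inl d => if fconnect ph o d then inr (lab d) else inl (face_of al si d)
  | inr (b, i) => inr (if b then ord_pred i else i)
  end.

Lemma apex_face_ph x : apex_face (ap_ph x) = apex_face x.
Proof.
case: x => [d|[[] i]] //; last first.
  by rewrite /face_perm /= c_face lab_c.
rewrite ap_ph_inl; case: pickP => [i /eqP E|none] /=.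
  by rewrite (in_outer (esym E)) (lab_prev (esym E)).
rewrite -(same_fconnect1_r phI) (face_ph pg); case: ifP => // od.
by rewrite lab_ph // => i; rewrite eq_sym none.
Qed.

Lemma apex_faces_ge : fcard ph D + 2 <= #|[set apex_face x | x : apexD]|.
Proof.
have FE : #|[set face_of al si d | d : D]| = fcard ph D.
  by rewrite -(face_count pg) /nclass; congr #|pred_of_set _|; apply: eq_imset => d; rewrite (face_cclass pg).
pose A := [set face_of al si d | d : D] :\ face_of al si o.
have oF : face_of al si o \in [set face_of al si d | d : D] by apply: imset_f.
have cA : #|A| + 1 = fcard ph D by rewrite -FE [RHS](cardsD1 (face_of al si o)) oF addnC.
have sub : inl @: A :|: inr @: [set: 'I_3] \subset [set apex_face x | x : apexD].
  apply/subsetP => u; rewrite in_setU => /orP[] /imsetP[a aA ->].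
    move: aA; rewrite in_setD1 => /andP[ao /imsetP[d _ aE]].
    apply/imsetP; exists (inl d) => //=; rewrite ifN ?aE // -(face_eq pg) eq_sym.
    by apply: contraNneq ao => <-; rewrite aE.
  by apply/imsetP; exists (inr (false, a)).
have := subset_leq_card sub; rewrite cardsU disjoint_setI0 ?cards0; last first.
  by rewrite disjoint_subset; apply/subsetP => u /imsetP[a _ ->]; rewrite !inE; apply/imsetP => -[].
rewrite card_imset; last exact: inl_inj.
rewrite card_imset; last exact: inr_inj.
by rewrite cardsT card_ord subn0 -cA -addnA.
Qed.

(** The split outer face gives enough faces; [euler_subset] for the full edge set is Euler's
    inequality for connected maps and shows that there are no more. *)
Lemma ap_euler : (#|{: option V}| + fcard ap_ph apexD).*2 = #|apexD| + 4.
Proof.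
have eT : edge_set ap_al [set: apexD] by move=> d; rewrite !in_setT.
have e0 : edge_set ap_al (set0 : {set apexD}) by move=> d; rewrite !in_set0.
have one (p : apexD -> apexD) : (forall x y, connect ap_link x y -> connect (orel ap_al p setT) x y) ->
    nclass (orel ap_al p setT) <= 1.
  move=> h; rewrite -card_unit; apply: (@nclass_le _ _ _ (orel_sym ap_alK p eT) (fun=> tt)) => x y _.
  exact/h/ap_connected.
have link_al' p x : connect (orel ap_al p setT) x (ap_al x).
  by apply: connect1; rewrite /orel /= in_setT eqxx !orbT.
have link_p p x : connect (orel ap_al p setT) x (p x).
  by apply: connect1; rewrite /orel /= eqxx.
have n1 : nclass (orel ap_al ap_si setT) <= 1.
  apply: one => x y.
  apply: (@connect_invariant _ _ (fun y => connect (orel ap_al ap_si setT) x y)); last exact: connect0.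
  by move=> a b xa /orP[]/eqP->; apply: connect_trans xa _.
have n2 : nclass (orel ap_al ap_ph setT) <= 1.
  apply: one => x y.
  apply: (@connect_invariant _ _ (fun y => connect (orel ap_al ap_ph setT) x y)); last exact: connect0.
  move=> a b xa /orP[]/eqP->; apply: connect_trans xa _ => //.
  by rewrite ap_ph_al; apply: connect_trans (link_al' _ a) (link_p _ _).
have nF : nclass (orel ap_al ap_ph set0) = fcard ap_ph apexD.
  by apply: nclass_ncomp; [apply: orel_sym ap_alK _ _ e0 | apply: connect_orel0 ap_phI].
have nV : #|{: option V}| <= nclass (orel ap_al ap_si set0).
  apply: (@nclass_ge _ _ _ (orel_sym ap_alK ap_si e0) ap_vert) => [[v|]|x y].
  - by have [d <-] := vert_surj pg v; exists (inl d).
  - by exists (inr (false, ord0)).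
  by rewrite (connect_orel0 ap_al ap_siI) -ap_vertE => /eqP.
have F2 : fcard ph D + 2 <= fcard ap_ph apexD.
  apply: leq_trans apex_faces_ge _; rewrite -nF; apply: nclass_ge_image; first exact: (orel_sym ap_alK ap_ph e0).
  move=> x y; rewrite (connect_orel0 ap_al ap_phI) => con; apply/eqP.
  apply: (@connect_invariant _ _ (fun y => apex_face x == apex_face y)) con => //.
  by move=> a b /eqP-> /eqP<-; rewrite apex_face_ph.
have := euler_subset ap_alK ap_al_neq ap_siI eT; rewrite setCT nF.
have := let: And5 _ _ _ _ eu := pg in eu.
have -> : #|apexD| = #|D| + 6 by rewrite card_sum card_prod card_bool card_ord.
have cV := card_option V; rewrite cV in nV *.
rewrite cardsT card_sum card_prod card_bool card_ord.
move: nV F2 n1 n2; clear; lia.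
Qed.

Lemma ap_plane : plane_graph ap_al ap_si ap_vert.
Proof.
split.
- split; [exact: ap_alK | exact: ap_al_neq | exact: ap_siI].
- split; first exact: ap_vertE.
  by case=> [v|]; [have [d <-] := vert_surj pg v; exists (inl d) | exists (inr (false, ord0))].
- exact: ap_connected.
- split; first by case=> [d|[[] i]] //=; rewrite (inj_eq Some_inj) (vert_al pg).
  case=> [d|[[] i]] [d'|[[] j]] //=.
  + by case=> vE [hE]; congr inl; apply: (simple_map pg).
  + by case=> /c_inj->.
  by move=> _ [/c_inj->].
exact: ap_euler.
Qed.

Lemma ap_adj : adj ap_al ap_vert =2
  susp_adj al vert (vert (c ord0)) (vert (c (inord 1))) (vert (c (inord 2))).
Proof.
have three v : (v == vert (c ord0)) || (v == vert (c (inord 1))) || (v == vert (c (inord 2))) ->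
    exists i, v = vert (c i).
  by case/orP => [/orP[]|] /eqP->; [exists ord0 | exists (inord 1) | exists (inord 2)].
have all3 i : [|| vert (c i) == vert (c ord0), vert (c i) == vert (c (inord 1)) | vert (c i) == vert (c (inord 2))].
  have : [|| i == ord0, i == inord 1 | i == inord 2].
    by case: i => [[|[|[|i]]] Hi] //; rewrite -!val_eqE /= !inordK.
  by case/or3P => /eqP->; rewrite eqxx ?orbT.
have out u v : (adj ap_al ap_vert u v) -> exists d, ap_vert d = u /\ ap_vert (ap_al d) = v.
  by case/existsP=> d /andP[/eqP du /eqP dv]; exists d.
have into d : adj ap_al ap_vert (ap_vert d) (ap_vert (ap_al d)).
  by apply/existsP; exists d; rewrite !eqxx.
move=> [u|] [v|]; rewrite /susp_adj;
  last (by apply/negbTE/negP => /out[[d|[[] i]]] /= []); apply/idP/idP.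
- case/out=> [[d|[[] i]]] /= [] // [du] [dv].
  by apply/existsP; exists d; rewrite du dv !eqxx.
- by case/existsP=> d /andP[/eqP <- /eqP <-]; apply: (into (inl d)).
- by case/out=> [[d|[[] i]]] /= [] // [du] _; rewrite -du -orbA all3.
- by case/three=> i ->; apply: (into (inr (true, i))).
- by case/out=> [[d|[[] i]]] /= [] // _ [dv]; rewrite -dv -orbA all3.
- by case/three=> i ->; apply: (into (inr (false, i))).
Qed.

Lemma ap_order : order ap_si (inr (false, ord0)) = 3.
Proof.
have -> : order ap_si (inr (false, ord0)) = #|[set (inr (false, i) : apexD) | i : 'I_3]|.
  apply: eq_card => d; rewrite -[LHS]/(fconnect ap_si (inr (false, ord0)) d) -ap_vertE; apply/idP/idP.
    by case: d => [d|[[] i]] //= _; apply: imset_f.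
  by case/imsetP=> i _ ->.
by rewrite card_imset ?card_ord // => i j [].
Qed.

End Apex.

(** * Removing the apex *)

Section Transfer.
Variables (V D : finType) (al si : D -> D) (vert : D -> V).
Hypothesis pg : plane_graph al si vert.
Local Notation ph := (face_perm al si).
Variables (o : D) (c : 'I_3 -> D) (lab : D -> 'I_3).
Hypothesis c_inj : injective (vert \o c).
Hypothesis c_face : forall i, fconnect ph o (c i).
Hypothesis lab_c : forall i, lab (c i) = i.
Hypothesis lab_prev : forall d i, ph d = c i -> lab d = ord_pred i.
Hypothesis lab_ph : forall d, fconnect ph o d -> (forall i, ph d != c i) -> lab (ph d) = lab d.
Hypothesis tc : internally_3_connected al vert (vert (c ord0)) (vert (c (inord 1))) (vert (c (inord 2))).
Let phI : injective ph := face_perm_inj pg.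
Local Notation aal := (ap_al al).
Local Notation asi := (ap_si si c).
Local Notation avert := (ap_vert vert c).
Local Notation aph := (face_perm aal asi).

Lemma three_connected_eq (W : finType) (e e' : rel W) : e =2 e' -> three_connected e -> three_connected e'.
Proof.
move=> E [W3 h]; split=> // S S2 x y xS yS.
by rewrite -(eq_connect (fun a b => congr1 (fun k => [&& k, _ & _]) (E a b))); apply: h.
Qed.

Lemma aph_inl d : (forall i, ph d != c i) -> aph (inl d) = inl (ph d).
Proof.
by move=> none; rewrite ap_ph_inl; case: pickP => // i /eqP E; have := none i; rewrite E eqxx.
Qed.

Lemma face_inner f d : ~~ fconnect ph o f -> fconnect ph f d ->
  fconnect aph (inl f) (inl d) /\ ~~ fconnect ph o d.
Proof.
move=> of_ fd; apply/andP; move: fd.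
apply: (@connect_invariant _ _ (fun d => fconnect aph (inl f) (inl d) && ~~ fconnect ph o d)).
  move=> a b /andP[fa oa] /eqP<-; rewrite -(same_fconnect1_r phI) oa andbT.
  apply: connect_trans fa _; rewrite -aph_inl ?fconnect1 // => i.
  by apply: contraNneq oa => E; rewrite (same_fconnect1_r phI) E.
by rewrite connect0.
Qed.

Lemma face_inner_apex f x : ~~ fconnect ph o f -> fconnect aph (inl f) x -> avert x != None.
Proof.
move=> of_ fx; pose P (x : apexD D) := if x is inl d then ~~ fconnect ph o d else false.
suff : P x by case: x {fx}.
apply: (@connect_invariant _ (frel aph) P (inl f) x) => // -[a|//] b oa /eqP<-.
by rewrite aph_inl /P -?(same_fconnect1_r phI) // => i; apply: contraNneq oa => E; rewrite (same_fconnect1_r phI) E.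
Qed.

Lemma face_outer_apex d : fconnect ph o d -> exists x, fconnect aph (inl d) x && (avert x == None).
Proof.
move=> od; have dc : fconnect ph d (finv ph (c ord0)).
  apply: connect_trans (fconnect_finv _ _); apply: connect_trans (c_face _).
  by rewrite fconnect_sym.
have hit : fconnect aph (inl d) (inl (finv ph (c ord0))) \/ exists i, fconnect aph (inl d) (inr (true, i)).
  have [/existsP[i h]|/existsPn none] := boolP [exists i, fconnect aph (inl d) (inr (true, i))].
    by right; exists i.
  left; move: dc.
  apply: (@connect_invariant _ _ (fun a => fconnect aph (inl d) (inl a))); last exact: connect0.
  move=> a b da /eqP<-; have := connect_trans da (fconnect1 _ _).
  by rewrite ap_ph_inl; case: pickP => // i _ h; have := none i; rewrite h.
have [i di] : exists i, fconnect aph (inl d) (inr (true, i)).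
  case: hit => // h; exists ord0; apply: connect_trans h _.
  have := fconnect1 aph (inl (finv ph (c ord0))).
  by rewrite ap_ph_inl (f_finv phI) (pick_c c_inj).
exists (aph (inr (true, i))); rewrite /= eqxx andbT.
by apply: connect_trans di (fconnect1 _ _).
Qed.

(** The tree avoids the apex, so it restricts without loss. Inner faces keep their boundary, and the
    outer face is covered by the three faces at the apex. *)
Lemma transfer : exists T : {set D},
    [/\ spanning_tree al vert T, (forall v, tree_deg vert T v <= 4)
      & (forall f, cotree_deg al si T f <= 4)].
Proof.
have pg' := ap_plane pg c_inj c_face lab_c lab_prev lab_ph.
have tc' : three_connected (adj aal avert).
  by apply: three_connected_eq tc => a b; rewrite -(ap_adj al vert c).
have [T [eT cT conT degT [zT [faceT outT]]]] := apex_tree pg' tc' (ap_order pg c_inj).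
pose T0 := [set d | inl d \in T].
have eT0 : edge_set al T0 by move=> d; rewrite !in_set; exact: (eT (inl d)).
have inlI : injective (@inl D (bool * 'I_3)) by exact: inl_inj.
have con0 u v : connect (sub_adj al vert T0) u v.
  have := conT (Some u) (Some v) isT isT.
  apply: (@connect_invariant _ _ (fun w => if w is Some v then connect (sub_adj al vert T0) u v else false)).
    move=> [a|//] b ua /existsP[[d|[[] i]] /and3P[dT /eqP // [da] /eqP <-]] /=.
      apply: connect_trans ua (connect1 _).
      by apply/existsP; exists d; rewrite in_set dT da !eqxx.
    by have := zT _ (etrans (eT _) dT).
  exact: connect0.
have card0 : #|T0| <= (#|V| - 1).*2.
  have -> : #|V| - 1 = #|{: option V}| - 2 by rewrite card_option; lia.
  apply: leq_trans cT; rewrite -(card_imset _ inlI); apply/subset_leq_card/subsetP => _ /imsetP[d + ->].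
  by rewrite in_set.
exists T0; split.
- split=> //; exact: (bridges_of_card (alK pg) (al_neq pg)).
- move=> v; apply: leq_trans (degT (Some v) isT); rewrite /tree_deg.
  rewrite -(card_imset _ inlI); apply/subset_leq_card/subsetP => _ /imsetP[d /setIdP[+ /eqP <-] ->].
  by rewrite in_set => dT; apply/setIdP.
move=> f; rewrite /cotree_deg -(card_imset _ inlI).
have [of_|of_] := boolP (fconnect ph o f).
  (* The outer face even has co-tree degree at most 1. *)
  apply: leq_trans (leq_trans outT _) => //.
  apply/subset_leq_card/subsetP => _ /imsetP[d + ->]; rewrite in_set => /andP[fd dT].
  apply/setIdP; rewrite in_setC; rewrite in_set in dT; split=> //; apply/and3P; split=> //.
  by apply/existsP; apply: face_outer_apex; apply: connect_trans fd.
apply: leq_trans (faceT (inl f) (fun x => face_inner_apex of_)).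
apply/subset_leq_card/subsetP => _ /imsetP[d + ->]; rewrite in_set => /andP[fd dT].
by have [ffd _] := face_inner of_ fd; rewrite in_set ffd; rewrite in_set in dT.
Qed.

End Transfer.

(** * The three corners along the outer face *)

Section Corners.
Variables (V D : finType) (al si : D -> D) (vert : D -> V).
Hypothesis pg : plane_graph al si vert.
Local Notation ph := (face_perm al si).
Variables (c0 c1 c2 : D).
Hypotheses (c01 : fconnect ph c0 c1) (c02 : fconnect ph c0 c2).
Hypotheses (v01 : vert c0 != vert c1) (v12 : vert c1 != vert c2) (v02 : vert c0 != vert c2).
Hypothesis c12 : findex ph c0 c1 < findex ph c0 c2.
Let phI : injective ph := face_perm_inj pg.

Definition corner (i : 'I_3) := nth c0 [:: c0; c1; c2] i.
Definition segment d : 'I_3 :=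
  let p := findex ph c0 d in
  if p < findex ph c0 c1 then ord0 else if p < findex ph c0 c2 then inord 1 else inord 2.

Lemma ord3P (i : 'I_3) : [\/ i = ord0, i = inord 1 | i = inord 2].
Proof.
case: i => [[|[|[|i]]] Hi] //; [apply: Or31 | apply: Or32 | apply: Or33]; apply: val_inj => //=;
  by rewrite inordK.
Qed.

Lemma corner0 : corner ord0 = c0. Proof. by []. Qed.
Lemma corner1 : corner (inord 1) = c1. Proof. by rewrite /corner inordK. Qed.
Lemma corner2 : corner (inord 2) = c2. Proof. by rewrite /corner inordK. Qed.

Lemma corner_inj : injective (vert \o corner).
Proof.
move=> i j /=; have [->|->|->] := ord3P i; have [->|->|->] := ord3P j;
  rewrite ?corner0 ?corner1 ?corner2 => // /eqP E; move: E v01 v12 v02; rewrite eq_sym => /eqP->;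
  by rewrite eqxx.
Qed.

Lemma corner_face i : fconnect ph c0 (corner i).
Proof. by have [->|->|->] := ord3P i; rewrite ?corner0 ?corner1 ?corner2. Qed.

Let index0 : 0 < findex ph c0 c1.
Proof. by rewrite lt0n findex_eq0; apply: contraNneq v01 => ->. Qed.

Lemma segment_corner i : segment (corner i) = i.
Proof.
have [->|->|->] := ord3P i; rewrite ?corner0 ?corner1 ?corner2 /segment.
- by rewrite findex0 index0.
- by rewrite ltnn c12.
by rewrite ltnn ltnNge ltnW.
Qed.

Lemma findex_next d : fconnect ph c0 d -> ph d != c0 -> findex ph c0 (ph d) = (findex ph c0 d).+1.
Proof.
move=> c0d dc; have qo := findex_max c0d.
have E : ph d = iter (findex ph c0 d).+1 ph c0 by rewrite iterS iter_findex.
rewrite {1}E findex_iter // ltn_neqAle qo andbT.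
by apply: contraNneq dc => Eo; rewrite E Eo iter_order.
Qed.

Lemma segment_next d : fconnect ph c0 d -> (forall i, ph d != corner i) -> segment (ph d) = segment d.
Proof.
move=> c0d none; have := none ord0; rewrite corner0 => n0.
have n1 : (findex ph c0 d).+1 != findex ph c0 c1.
  apply: contraNneq (none (inord 1)) => E; rewrite corner1 -(iter_findex c01) -E iterS iter_findex //.
have n2 : (findex ph c0 d).+1 != findex ph c0 c2.
  by apply: contraNneq (none (inord 2)) => E; rewrite corner2 -(iter_findex c02) -E iterS iter_findex.
by rewrite /segment findex_next // !(ltn_neqAle _.+1) n1 n2.
Qed.

Lemma segment_prev d i : ph d = corner i -> segment d = ord_pred i.
Proof.
move=> E; have c0d : fconnect ph c0 d by rewrite (same_fconnect1_r phI) E corner_face.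
have [iE|ni] := eqVneq i ord0; last first.
  have dc : ph d != c0 by rewrite E -corner0; apply: contraNneq ni => h; apply/eqP/corner_inj; rewrite /= h.
  have := findex_next c0d dc; rewrite E /segment => F.
  move: F; have [iE|->|->] := ord3P i; first by rewrite iE eqxx in ni.
    rewrite corner1 => ->; rewrite ltnSn; apply: val_inj; rewrite /= inordK //.
  rewrite corner2 => F; have := c12; rewrite F ltnS leqNgt => /negbTE->; rewrite ltnSn.
  by apply: val_inj; rewrite /= !inordK.
(* The dart before [c0] is the last one of the face walk, so it belongs to the third segment. *)
rewrite iE corner0 in E *.
have qE : (findex ph c0 d).+1 = order ph c0.
  apply/eqP; rewrite eqn_leq (findex_max c0d) /= leqNgt; apply/negP => lt.
  have := findex_iter lt; rewrite iterS iter_findex // E findex0; lia.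
have p2 : findex ph c0 c2 <= findex ph c0 d by rewrite -ltnS qE; apply: findex_max.
rewrite /segment ltnNge (leq_trans (ltnW c12) p2) ltnNge p2 /=.
by apply: val_inj; rewrite /= inordK.
Qed.

Lemma tree_of_corners : internally_3_connected al vert (vert c0) (vert c1) (vert c2) ->
  exists T : {set D},
    [/\ spanning_tree al vert T, (forall v, tree_deg vert T v <= 4)
      & (forall f, cotree_deg al si T f <= 4)].
Proof.
move=> tc; apply: (transfer pg corner_inj corner_face segment_corner segment_prev segment_next).
by rewrite corner0 corner1 corner2.
Qed.

End Corners.

Theorem theorem1 (V D : finType) (alpha sigma : D -> D) (vert : D -> V)
    (o : D) (r1 r2 r3 : V) :
  plane_graph alpha sigma vert ->
  [/\ r1 != r2, r2 != r3 & r1 != r3] ->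
  on_face alpha sigma vert o r1 -> on_face alpha sigma vert o r2 ->
  on_face alpha sigma vert o r3 ->
  internally_3_connected alpha vert r1 r2 r3 ->
  exists T : {set D},
    [/\ spanning_tree alpha vert T,
        (forall v, tree_deg vert T v <= 4)
      & (forall f, cotree_deg alpha sigma T f <= 4)].
Proof.
move=> pg [r12 r23 r13] /existsP[c1 /andP[/eqP v1 o1]] /existsP[c2 /andP[/eqP v2 o2]].
case/existsP=> c3 /andP[/eqP v3 o3] tc; subst r1 r2 r3.
have phS := fconnect_sym (face_perm_inj pg).
have c12 : fconnect (face_perm alpha sigma) c1 c2 by apply: connect_trans o2; rewrite phS.
have c13 : fconnect (face_perm alpha sigma) c1 c3 by apply: connect_trans o3; rewrite phS.
have r32 : vert c3 != vert c2 by rewrite eq_sym.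
(* The walk may meet [r2] and [r3] in either order; the suspension is symmetric in them. *)
have [lt|gt|E] := ltngtP (findex (face_perm alpha sigma) c1 c2) (findex (face_perm alpha sigma) c1 c3).
- exact: (tree_of_corners pg c12 c13).
- apply: (tree_of_corners pg c13 c12) => //; apply: three_connected_eq tc => -[u|] [v|] //=.
    by rewrite orbAC.
  by rewrite orbAC.
by case/eqP: r23; rewrite -(iter_findex c12) E iter_findex.
Qed.
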